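(* Let $(V_a,H_{ba},B_a)$ be a normalized irreducible matrix system with inner products and let $(\widehat V_a,\widehat H_{ba},\widehat B_a)$ be its twin system. Assume that the two systems are inequivalent. For any $\varepsilon>0$, $a,b\in A$, $v_a\in V_a$ and $v_b\in V_b$ let $$\|\phi_\varepsilon^{v_a,v_b}\|_2^2=\sum_{x\in\Gamma}|\langle\mu[e,a,v_a],\pi(x)\mu[e,b,v_b]\rangle|^2e^{-\varepsilon|x|}.$$ Let $Q_b:V_b\to\widehat V_b$ ($b\in A$) be the linear maps defined in the context and $$E_0=\sum_{a,b\in A}\mathrm{tr}\left(\widehat B_a(\widehat H_{ab}Q_b+E_{ab}-Q_aH_{ab})\widehat B_{b^{-1}}(\widehat H_{ab}Q_b+E_{ab}-Q_aH_{ab})^*\right).$$ Then $\|\phi_\varepsilon^{v_a,v_b}\|_2^2\simeq 1/\varepsilon$ (as $\varepsilon\to0^+$) if and only if $E_0=0$. Moreover, when $E_0\ne0$, $$\|\phi_\varepsilon^{v_a,v_b}\|_2^2=\frac{E_0}{k_0^2}\,\varepsilon^{-2}B_a(v_a,v_a)B_b(v_b,v_b)+o(\varepsilon^{-2})\quad\text{as }\varepsilon\to0^+,$$ where $k_0=\sum_{c\in A}\mathrm{tr}(\widehat B_cB_{c^{-1}})$.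
   Context: $\Gamma$ is a non-commutative free group on finitely many generators; $A$ is the finite symmetric set consisting of the free generators and their inverses; $e$ is the identity, $|x|$ is the reduced word length and $d(x,y)=|x^{-1}y|$. Matrix systems. A matrix system $(V_a,H_{ba})$ consists of finite-dimensional complex vector spaces $V_a$ ($a\in A$) and linear maps $H_{ba}:V_a\to V_b$ ($a,b\in A$) with $H_{ba}=0$ whenever $ba=e$. An invariant subsystem is a collection of subspaces $W_a\subseteq V_a$ with $H_{ba}(W_a)\subseteq W_b$ for all $a,b$. The system is irreducible if it is nonzero and its only invariant subsystems are itself and zero. Two systems $(V_a,H_{ba})$, $(V_a^\sharp,H_{ba}^\sharp)$ are equivalent if there are linear bijections $J_a:V_a\to V_a^\sharp$ with $H^\sharp_{ba}J_a=J_bH_{ba}$ for all $a,b$. $(V_a,H_{ba},B_a)$ is a normalized system with inner products if each $B_a$ is a strictly positive definite sesquilinear form on $V_a$ (linear in the first variable) and $B_a(v,v)=\sum_{b\in A}B_b(H_{ba}v,H_{ba}v)$ for all $a\in A$, $v\in V_a$. Multiplicative representation. A multiplicative function is a map $f:\Gamma\to\coprod_{a\in A}V_a$ for which there is $N$ such that for all $|x|\ge N$: $f(xa)\in V_a$ if $|xa|=|x|+1$, and $f(xab)=H_{ba}f(xa)$ if $|xab|=|x|+2$. Functions agreeing off a finite set are identified; $\mathcal{H}^\infty$ is the quotient, with $\langle f_1,f_2\rangle=\sum_{|x|=N}\sum_{a\in A,|xa|=|x|+1}B_a(f_1(xa),f_2(xa))$, $N$ large, and $\mathcal{H}$ is its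 completion; $\pi$ is the unitary representation of $\Gamma$ on $\mathcal{H}$ extending $(\pi(y)f)(x)=f(y^{-1}x)$. For $x\in\Gamma$, $a\in A$ let $\Gamma(x,xa)=\{y:d(y,xa)<d(y,x)\}$; for $v_a\in V_a$, $\mu[x,xa,v_a]$ is the multiplicative function that is $0$ off $\Gamma(x,xa)$, equals $v_a$ at $xa$, and satisfies $\mu[x,xa,v_a](ybc)=H_{cb}\,\mu[x,xa,v_a](yb)$ if $yb,ybc\in\Gamma(x,xa)$ and $d(ybc,x)=d(y,x)+2$ ($b,c\in A$). Twin system. For a finite-dimensional complex space $V$, $V^*$ is the space of antilinear functionals on $V$, $V^{**}$ is identified with $V$, and for $T:V_1\to V_2$ linear, $T^*:V_2^*\to V_1^*$ is $T^*f=f\circ T$. A sesquilinear form $B$ on $V$ is identified with the linear map $V\to V^*$, $v\mapsto B(v,\cdot)$. Put $\widehat V_a=V_{a^{-1}}^*$ and $\widehat H_{ba}=H^*_{a^{-1}b^{-1}}:\widehat V_a\to\widehat V_b$. There is a tuple, unique up to a positive scalar, of strictly positive definite forms $\widehat B_a$ on $\widehat V_a$ with $\widehat B_a=\sum_b\widehat H_{ba}^*\widehat B_b\widehat H_{ba}$; fix one. Then $(\widehat V_a,\widehat H_{ba},\widehat B_a)$ is the twin system. In particular $\widehat B_{a}:\widehat V_a\to\widehat V_a^*=V_{a^{-1}}$. $E_{ab}:V_b\to\widehat V_a$ is $E_{ab}=\sum_{c\in A,\,c\ne a,b^{-1}}H^*_{ca^{-1}}B_cH_{cb}$ if $ab\ne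 e$ and $E_{ab}=0$ if $ab=e$. The maps $Q_b:V_b\to\widehat V_b$ are the (unique, since the systems are inequivalent) linear maps satisfying $\sum_{b\in A}\left(\widehat H_{ab}Q_b\widehat B_{b^{-1}}H_{ab}^*+E_{ab}\widehat B_{b^{-1}}H_{ab}^*\right)=Q_a\widehat B_{a^{-1}}$ for all $a\in A$. $g(\varepsilon)\simeq1/\varepsilon$ as $\varepsilon\to0^+$ means $c_1/\varepsilon\le g(\varepsilon)\le c_2/\varepsilon$ for some positive constants $c_1,c_2$ (possibly depending on the vectors) and all sufficiently small $\varepsilon>0$.
   Formalization: The equivalence ''≃1/ε if and only if E_0=0'' is stated only for nonzero v_a and v_b: for a zero vector the sum vanishes identically, so it fails when E_0=0. The asymptotic formula is stated for all vectors. *)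

(* Defs.v *)
From HB Require Import structures.
From mathcomp Require Import all_boot all_order all_algebra.
From mathcomp Require Import complex finmap.
From mathcomp Require Import all_classical all_reals all_analysis.

Set Implicit Arguments.
Unset Strict Implicit.
Unset Printing Implicit Defensive.

Import Order.TTheory GRing.Theory Num.Theory.
Import numFieldNormedType.Exports.

(** * The free group on [k] generators *)

(** [(i, false)] is the i-th free generator and [(i, true)] its inverse, so
    that [letter k] is the symmetric set A. *)
Definition letter (k : nat) : Type := 'I_k * bool.
HB.instance Definition _ k := Finite.on (letter k).

Definition linv k (a : letter k) : letter k := (a.1, ~~ a.2).

Lemma linvK k : involutive (@linv k).
Proof. by case=> i b; rewrite /linv /= negbK. Qed.

Definition reduced k (w : seq (letter k)) : bool :=
  sorted (fun a b => b != linv a) w.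

Record freegroup k :=
  FreeGroup { word : seq (letter k); word_reduced : reduced word }.

HB.instance Definition _ k := [isSub for @word k].
HB.instance Definition _ k := [Countable of freegroup k by <:].

Section FreeGroup.
Variable k : nat.
Implicit Types (a b : letter k) (u v w : seq (letter k)) (x y : freegroup k).

Let linvI : injective (@linv k) := inv_inj (@linvK k).

(** Left multiplication of a reduced word by a letter. *)
Definition lmul a w :=
  if w is b :: w' then if b == linv a then w' else a :: w else [:: a].

Definition wmul u w := foldr lmul w u.

Definition winv w := rev (map (@linv k) w).

Lemma reduced_behead a w : reduced (a :: w) -> reduced w.
Proof. by case: w => //= b w /andP[]. Qed.

Lemma reduced_lmul a w : reduced w -> reduced (lmul a w).
Proof.
case: w => //= b w rw; case: ifPn => [_|ba]; first exact: (@reduced_behead b).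
by rewrite /= ba.
Qed.

Lemma reduced_wmul u w : reduced w -> reduced (wmul u w).
Proof. by move=> rw; elim: u => //= a u; exact: reduced_lmul. Qed.

Lemma reduced_winv w : reduced w -> reduced (winv w).
Proof.
rewrite /winv /reduced rev_sorted sorted_map; apply: sub_sorted => a b /=.
by apply: contraNN => /eqP ->; rewrite linvK.
Qed.

Lemma lmulK a w : reduced w -> lmul a (lmul (linv a) w) = w.
Proof.
case: w => [|b w] /=; first by rewrite eqxx.
rewrite linvK; case: eqP => [->|_ _] /=; last by rewrite eqxx.
by case: w => //= c w /andP[/negPf ->].
Qed.

Lemma wmul_lmul a u w : reduced w -> wmul (lmul a u) w = lmul a (wmul u w).
Proof.
case: u => //= b u rw; case: eqP => //= ->.
by rewrite lmulK// reduced_wmul.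
Qed.

Lemma wmulA u v w : reduced w -> wmul (wmul u v) w = wmul u (wmul v w).
Proof. by move=> rw; elim: u => //= a u IH; rewrite wmul_lmul// IH. Qed.

Lemma wmulw0 w : reduced w -> wmul w [::] = w.
Proof.
elim: w => //= a w IH raw; rewrite IH ?(reduced_behead raw)//.
by case: w raw {IH} => //= b w /andP[/negPf ->].
Qed.

Lemma wmulVw w : reduced w -> wmul (winv w) w = [::].
Proof.
elim: w => //= a w IH raw.
rewrite /winv map_cons rev_cons /wmul foldr_rcons /= linvK eqxx.
exact: IH (reduced_behead raw).
Qed.

Lemma winvK : involutive winv.
Proof.
by move=> w; rewrite /winv map_rev revK -map_comp map_id_in// => a _; exact: linvK.
Qed.

Definition fg_one : freegroup k := @FreeGroup k [::] isT.
Definition fg_mul x y := FreeGroup (reduced_wmul (word x) (word_reduced y)).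
Definition fg_inv x := FreeGroup (reduced_winv (word_reduced x)).

Fact fg_mulA : associative fg_mul.
Proof. by move=> x y z; apply: val_inj; rewrite /= wmulA// word_reduced. Qed.
Fact fg_mul1g : left_id fg_one fg_mul.
Proof. by move=> x; exact: val_inj. Qed.
Fact fg_mulg1 : right_id fg_one fg_mul.
Proof. by move=> x; apply: val_inj; rewrite /= wmulw0// word_reduced. Qed.
Fact fg_mulVg : left_inverse fg_one fg_inv fg_mul.
Proof. by move=> x; apply: val_inj; rewrite /= wmulVw// word_reduced. Qed.
Fact fg_mulgV : right_inverse fg_one fg_inv fg_mul.
Proof.
move=> x; apply: val_inj; rewrite /= -[X in wmul X _]winvK wmulVw//.
by rewrite reduced_winv// word_reduced.
Qed.

HB.instance Definition _ := isGroup.Build (freegroup k)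
  fg_mulA fg_mul1g fg_mulg1 fg_mulVg fg_mulgV.

(** The free generators and their inverses, as elements of the group. *)
Definition gen a : freegroup k := @FreeGroup k [:: a] isT.

Definition wlen x : nat := size (word x).

Definition wdist x y : nat := wlen (x^-1 * y)%g.

Lemma gen_linv a : gen (linv a) = ((gen a)^-1)%g.
Proof. exact: val_inj. Qed.

Lemma gen_mul_eq1 b a : (gen b * gen a == 1)%g = (a == linv b).
Proof. by rewrite -val_eqE /=; case: (a == _). Qed.

Lemma word_prod x : x = (\prod_(a <- word x) gen a)%g.
Proof.
have prodE w : reduced w -> word (\prod_(a <- w) gen a)%g = w.
  elim: w => [|a w IH] raw; first by rewrite big_nil.
  rewrite big_cons /= IH ?(reduced_behead raw)//.
  by case: w raw {IH} => //= b w /andP[/negPf ->].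
by apply: val_inj; exact/esym/prodE/word_reduced.
Qed.

Lemma word_mul x y : word (x * y)%g = wmul (word x) (word y).
Proof. by []. Qed.

Lemma wlenV x : wlen (x^-1)%g = wlen x.
Proof. by rewrite /wlen /= /winv size_rev size_map. Qed.

Lemma wdistC x y : wdist x y = wdist y x.
Proof. by rewrite /wdist -wlenV invgM invgK. Qed.

Lemma word_mulgen y b :
  word (y * gen b)%g = rcons (word y) b \/
  word y = rcons (word (y * gen b)%g) (linv b).
Proof.
have e : (y * gen b)%g = ((gen (linv b) * y^-1)^-1)%g.
  by rewrite invgM invgK gen_linv invgK.
have ey : word y = winv (word y^-1)%g by rewrite /= winvK.
rewrite ey e -[word _]/(winv (lmul (linv b) (word y^-1)%g)).
case: (word y^-1)%g => [|c w] /=; first by left; rewrite /winv /= linvK.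
rewrite linvK; case: eqP => [->|_]; [right|left].
  by rewrite /winv map_cons rev_cons.
by rewrite /winv map_cons rev_cons linvK.
Qed.

Lemma wlen_mulgen_le y b : (wlen (y * gen b)%g <= (wlen y).+1)%N.
Proof.
rewrite /wlen; case: (word_mulgen y b) => ->; first by rewrite size_rcons.
by rewrite size_rcons !leqW.
Qed.

Lemma word_mulgenS y b :
  wlen (y * gen b)%g = (wlen y).+1 -> word (y * gen b)%g = rcons (word y) b.
Proof.
case: (word_mulgen y b) => // /(congr1 size); rewrite size_rcons -!/(wlen _).
by move=> + yb; rewrite yb => /eqP; rewrite -addn2 -[X in X == _]addn0 eqn_add2l.
Qed.

Lemma wlen_mulgen2 y b c :
  wlen (y * gen b * gen c)%g = (wlen y).+2 -> wlen (y * gen b)%g = (wlen y).+1.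
Proof.
move=> ybc; apply/eqP; rewrite eqn_leq wlen_mulgen_le /=.
by have := wlen_mulgen_le (y * gen b)%g c; rewrite ybc ltnS.
Qed.

Lemma size_lmul a w : (size w <= (size (lmul a w)).+1)%N.
Proof. by case: w => //= b w; case: ifP => //= _; rewrite leqW. Qed.

Lemma size_wmul u w : (size w <= size u + size (wmul u w))%N.
Proof.
elim: u => //= a u IH; apply: (leq_trans IH); rewrite addSnnS leq_add2l.
exact: size_lmul.
Qed.

Lemma wmul_rcons u w b :
  (size u <= size w)%N -> wmul u (rcons w b) = rcons (wmul u w) b.
Proof.
elim: u => //= a u IH uw; rewrite IH ?(ltnW uw)//.
have := size_wmul u w; case: (wmul u w) => [|c r] /= H.
  by move: (leq_trans uw H); rewrite addn0 ltnn.
by case: ifP.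
Qed.

End FreeGroup.

Local Open Scope ring_scope.

(** * Antilinear duals *)

(** The conjugate space of [V]: the same additive group with scalars acting
    through complex conjugation, so that the linear maps [conjv V -> C] are
    exactly the antilinear functionals on [V]. *)
Definition conjv (V : Type) : Type := V.

Section ConjSpace.
Variable C : numClosedFieldType.

HB.instance Definition _ (V : lmodType C) := GRing.Zmodule.copy (conjv V) V.

Section ConjLmod.
Variable V : lmodType C.
Definition conjv_scale (c : C) (v : conjv V) : conjv V := (c^* *: (v : V)).
Fact conjv_scaleA c d v :
  conjv_scale c (conjv_scale d v) = conjv_scale (c * d) v.
Proof. by rewrite /conjv_scale scalerA rmorphM. Qed.
Fact conjv_scale1 : left_id 1 conjv_scale.
Proof. by move=> v; rewrite /conjv_scale rmorph1 scale1r. Qed.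
Fact conjv_scaleDr : right_distributive conjv_scale +%R.
Proof. by move=> c u v; rewrite /conjv_scale scalerDr. Qed.
Fact conjv_scaleDl v : {morph conjv_scale^~ v : c d / c + d}.
Proof. by move=> c d; rewrite /conjv_scale rmorphD scalerDl. Qed.
HB.instance Definition _ := GRing.Zmodule_isLmodule.Build C (conjv V)
  conjv_scaleA conjv_scale1 conjv_scaleDr conjv_scaleDl.

Lemma conjv_scaleE c (v : V) : c *: (v : conjv V) = (c^* *: v : V).
Proof. by []. Qed.
End ConjLmod.

Section ConjVect.
Import VectorInternalTheory.
Variable V : vectType C.
Fact conjv_vect : Vector.axiom (dim V) (conjv V).
Proof.
exists (fun v : conjv V => map_mx Num.conj (v2r (v : V))).
  by move=> c u v; rewrite conjv_scaleE linearP map_mxD map_mxZ /= conjCK.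
exists (fun r => r2v (map_mx Num.conj r)) => [v|r].
  by rewrite -[RHS]v2rK; congr r2v; apply/matrixP=> i j; rewrite !mxE conjCK.
by rewrite r2vK; apply/matrixP=> i j; rewrite !mxE conjCK.
Qed.
HB.instance Definition _ := Lmodule_hasFinDim.Build C (conjv V) conjv_vect.
End ConjVect.

(** The space V^* of antilinear functionals on [V]. *)
Definition adual (V : vectType C) : vectType C := 'Hom(conjv V, C^o).

Lemma dim_adual (V : vectType C) : dim (adual V) = dim V.
Proof. exact: muln1 (dim V). Qed.

(** A linear map [B : V -> adual V] is the same thing as a sesquilinear form,
    linear in the first variable; [sesq B] is that form. *)
Definition sesq (V : vectType C) (B : 'Hom(V, adual V)) (u v : V) : C :=
  (B u : 'Hom(conjv V, C^o)) (v : conjv V).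

Definition posdef_form (V : vectType C) (B : 'Hom(V, adual V)) : Prop :=
  forall v : V, v != 0 -> 0 < sesq B v v.

Section Adjoint.
Variables (V W : vectType C) (T : 'Hom(V, W)).

Definition conj_lfun : 'Hom(conjv V, conjv W) :=
  linfun (T : conjv V -> conjv W).

Lemma conj_lfunE v : conj_lfun v = T v.
Proof.
pose f : conjv V -> conjv W := T.
have lf : linear f by move=> c u w; rewrite /f !conjv_scaleE linearP.
pose F := GRing.isLinear.Build _ _ _ _ f lf.
pose G : {linear conjv V -> conjv W} := HB.pack f F.
exact: (lfunE G v).
Qed.

(** T^* f = f o T. *)
Definition adjoint : 'Hom(adual W, adual V) :=
  linfun (fun f : adual W => (f \o conj_lfun)%VF : adual V).

Lemma adjointE (f : adual W) (v : V) :
  (adjoint f : 'Hom(conjv V, C^o)) v = (f : 'Hom(conjv W, C^o)) (T v).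
Proof.
pose h (f : adual W) : adual V := (f \o conj_lfun)%VF.
have lh : linear h by move=> c u w; rewrite /h comp_lfunDl comp_lfunZl.
pose F := GRing.isLinear.Build _ _ _ _ h lh.
pose G : {linear adual W -> adual V} := HB.pack h F.
by rewrite [adjoint f](lfunE G f) comp_lfunE conj_lfunE.
Qed.
End Adjoint.

Section Bidual.
Variable V : vectType C.

Let conj_semilin (c x y : C) : (c^* * x + y)^* = c * x^* + y^*.
Proof. by rewrite rmorphD rmorphM /= conjCK. Qed.

Definition bidual_fun (v : V) : adual (adual V) :=
  linfun (fun f : conjv (adual V) =>
            ((f : 'Hom(conjv V, C^o)) (v : conjv V))^* : C^o).

(** The canonical map V -> V^**, which sends [v] to f |-> conj (f v). *)
Definition bidual : 'Hom(V, adual (adual V)) := linfun bidual_fun.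

Lemma bidual_funE v (f : adual V) :
  (bidual_fun v : 'Hom(conjv (adual V), C^o)) f =
  ((f : 'Hom(conjv V, C^o)) (v : conjv V))^*.
Proof.
pose h (f : conjv (adual V)) : C^o := ((f : 'Hom(conjv V, C^o)) (v : conjv V))^*.
have lh : linear h.
  move=> c u w; rewrite /h conjv_scaleE add_lfunE scale_lfunE.
  exact: conj_semilin.
pose F := GRing.isLinear.Build _ _ _ _ h lh.
pose G : {linear conjv (adual V) -> C^o} := HB.pack h F.
exact: (lfunE G f).
Qed.

Lemma bidualE (v : V) (f : adual V) :
  (bidual v : 'Hom(conjv (adual V), C^o)) f =
  ((f : 'Hom(conjv V, C^o)) (v : conjv V))^*.
Proof.
have lh : linear bidual_fun.
  move=> c u w; apply/lfunP => g; rewrite add_lfunE scale_lfunE !bidual_funE.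
  have -> : (c *: u + w : V) = (c^* *: (u : conjv V) + w : conjv V).
    by rewrite conjv_scaleE conjCK.
  rewrite linearP; exact: conj_semilin.
pose F := GRing.isLinear.Build _ _ _ _ bidual_fun lh.
pose G : {linear V -> adual (adual V)} := HB.pack bidual_fun F.
by rewrite [bidual v](lfunE G v) bidual_funE.
Qed.

Lemma bidual_lker0 : lker bidual == 0%VS.
Proof.
apply/lker0P => u v uv; apply/eqP; rewrite -subr_eq0; apply/eqP.
set w := u - v; have bw : bidual w = 0 by rewrite linearB /= uv subrr.
have {uv} w0 (f : adual V) :
    (f : 'Hom(conjv V, C^o)) (w : conjv V) = 0.
  apply: (can_inj (@conjCK C)); rewrite -bidualE bw rmorph0.
  by rewrite zero_lfunE.
pose X := vbasis {:conjv V}.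
have Xw := coord_vbasis (memvf (w : conjv V)).
rewrite [w]Xw big1// => i _.
suff -> : coord X i (w : conjv V) = 0 by rewrite scale0r.
by rewrite -[LHS](lfunE (coord X i : {linear conjv V -> C^o})) w0.
Qed.

Lemma bidual_limg : limg bidual = fullv.
Proof.
apply/eqP; rewrite eqEdim subvf /= limg_dim_eq; last first.
  by rewrite (eqP bidual_lker0) capv0.
by rewrite !dimvf !dim_adual.
Qed.

Lemma bidual_bij : bijective bidual.
Proof.
exists (bidual^-1)%VF; first exact: lker0_lfunK bidual_lker0.
by move=> z; rewrite limg_lfunVK// bidual_limg memvf.
Qed.

End Bidual.

End ConjSpace.

(** The trace of an endomorphism. *)
Definition lfun_tr (K : fieldType) (V : vectType K) (f : 'End(V)) : K :=
  \tr (passmx.mxof (vbasis {:V}) (vbasis {:V}) f).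

(** * Matrix systems *)

Record matrix_system (k : nat) (C : numClosedFieldType) := MatrixSystem {
  msV : letter k -> vectType C;
  msH : forall b a : letter k, 'Hom(msV a, msV b);
  msH0 : forall b a : letter k, (gen b * gen a = 1)%g -> msH b a = 0
}.

Section MatrixSystems.
Variables (k : nat) (C : numClosedFieldType).
Implicit Types (S T : matrix_system k C) (a b c : letter k) (x y : freegroup k).

Definition invariant_subsystem S (W : forall a, {vspace msV S a}) : Prop :=
  forall b a, (msH S b a @: W a <= W b)%VS.

Definition irreducible_system S : Prop :=
  (exists a, {:msV S a}%VS != 0%VS) /\
  (forall W : forall a, {vspace msV S a}, invariant_subsystem W ->
     (forall a, W a = fullv) \/ (forall a, W a = 0%VS)).

Definition equivalent_systems S T : Prop :=
  exists J : forall a, 'Hom(msV S a, msV T a),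
    (forall a, bijective (J a)) /\
    (forall b a, (msH T b a \o J a = J b \o msH S b a)%VF).

(** A tuple of sesquilinear forms, each seen as a linear map V_a -> V_a^*. *)
Definition form_tuple S : Type := forall a, 'Hom(msV S a, adual (msV S a)).

Definition normalized S (B : form_tuple S) : Prop :=
  (forall a, posdef_form (B a)) /\
  (forall a (v : msV S a),
     sesq (B a) v v = \sum_b sesq (B b) (msH S b a v) (msH S b a v)).

(** ** The twin system *)

Definition twinV S a : vectType C := adual (msV S (linv a)).

Definition twinH S b a : 'Hom(twinV S a, twinV S b) :=
  adjoint (msH S (linv a) (linv b)).

Fact twinH0 S b a : (gen b * gen a = 1)%g -> twinH S b a = 0.
Proof.
move/eqP; rewrite gen_mul_eq1 => /eqP ->; rewrite /twinH msH0.
  apply/lfunP => f; apply/lfunP => v.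
  by rewrite adjointE !zero_lfunE linear0.
by apply/eqP; rewrite gen_mul_eq1 linvK.
Qed.

Definition twin S : matrix_system k C := MatrixSystem (@twinH0 S).

Definition twin_forms S (Bh : form_tuple (twin S)) : Prop :=
  (forall a, posdef_form (Bh a)) /\
  (forall a, Bh a =
     \sum_b (adjoint (msH (twin S) b a) \o Bh b \o msH (twin S) b a)%VF).

(** [Bh a], seen as a map into V_(a^-1) through the identification of
    V_(a^-1)^** with V_(a^-1). *)
Definition hatB S (Bh : form_tuple (twin S)) a :
    'Hom(adual (msV S (linv a)), msV S (linv a)) :=
  ((bidual (msV S (linv a)))^-1 \o Bh a)%VF.

(** The map [hatB Bh (linv b)], whose type mentions [linv (linv b)], cast along
    [linvK b]. *)
Definition hatBV S (Bh : form_tuple (twin S)) b : 'Hom(adual (msV S b), msV S b) :=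
  ecast d ('Hom(adual (msV S d), msV S d)) (linvK b) (hatB Bh (linv b)).

Definition Emap S (B : form_tuple S) a b : 'Hom(msV S b, msV (twin S) a) :=
  if (gen a * gen b == 1)%g then 0 else
    \sum_(c | (c != a) && (c != linv b))
       (adjoint (msH S c (linv a)) \o B c \o msH S c b)%VF.

Definition is_Q S (B : form_tuple S) (Bh : form_tuple (twin S))
    (Q : forall b, 'Hom(msV S b, msV (twin S) b)) : Prop :=
  forall a,
    \sum_b ((msH (twin S) a b \o Q b \o hatBV Bh b \o adjoint (msH S a b))%VF
            + (Emap B a b \o hatBV Bh b \o adjoint (msH S a b))%VF)
    = (Q a \o hatBV Bh a)%VF.

Definition defectQ S (B : form_tuple S)
    (Q : forall b, 'Hom(msV S b, msV (twin S) b)) a b :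
    'Hom(msV S b, msV (twin S) a) :=
  (msH (twin S) a b \o Q b)%VF + Emap B a b - (Q a \o msH S a b)%VF.

(** The composite is an endomorphism of the antilinear dual of the a-th twin
    space, which is V_(a^-1) up to the canonical identification. *)
Definition E0 S (B : form_tuple S) (Bh : form_tuple (twin S))
    (Q : forall b, 'Hom(msV S b, msV (twin S) b)) : C :=
  \sum_a \sum_b
    lfun_tr (Bh a \o defectQ B Q a b \o hatBV Bh b
             \o adjoint (defectQ B Q a b))%VF.

Definition k0 S (B : form_tuple S) (Bh : form_tuple (twin S)) : C :=
  \sum_c lfun_tr (hatB Bh c \o B (linv c))%VF.

(** * Multiplicative functions *)

(** Functions from the group to the disjoint union of the V_a. *)
Definition groupfun S : Type := freegroup k -> {a : letter k & msV S a}.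

Definition multfun S (f : groupfun S) : Prop :=
  exists N : nat, forall x, (N <= wlen x)%N ->
    (forall a, wlen (x * gen a)%g = (wlen x).+1 ->
       exists v : msV S a, f (x * gen a)%g = Tagged (msV S) v) /\
    (forall a b, wlen (x * gen a * gen b)%g = (wlen x).+2 ->
       forall v : msV S a, f (x * gen a)%g = Tagged (msV S) v ->
         f (x * gen a * gen b)%g = Tagged (msV S) (msH S b a v)).

(** [piact y f] represents pi(y) f. *)
Definition piact S y (f : groupfun S) : groupfun S := fun x => f (y^-1 * x)%g.

(** The component in V_a of an element of the disjoint union. *)
Definition component S a (u : {c : letter k & msV S c}) : msV S a :=
  untag 0 (fun v : msV S a => v) u.

Definition sphere_product S (B : form_tuple S) (N : nat) (f g : groupfun S) : C :=
  \sum_(x \in [set x : freegroup k | wlen x = N]%classic)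
    \sum_(a | wlen (x * gen a)%g == N.+1)
      sesq (B a) (component a (f (x * gen a)%g)) (component a (g (x * gen a)%g)).

(** The inner product of the classes of two multiplicative functions is the
    eventual value of [sphere_product B N f g] as [N] grows; it exists by
    [innerE]. All the vectors used below are such classes, so the completion of
    their space plays no role. *)
Definition inner S (B : form_tuple S) (f g : groupfun S) : C :=
  xget 0 [set c | \forall N \near \oo, sphere_product B N f g = c]%classic.

(** Gamma(x, xa). *)
Definition cone x a : set (freegroup k) :=
  [set y | (wdist y (x * gen a)%g < wdist y x)%N]%classic.

(** Successive images of [v] in V_a along the letters of a word. *)
Fixpoint transport S a (v : msV S a) (w : seq (letter k)) :
    {c : letter k & msV S c} :=
  if w is b :: w' then transport (msH S b a v) w' else Tagged (msV S) v.

(** mu[x, xa, v]; see [muP] for its defining properties. *)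
Definition mu S x a (v : msV S a) : groupfun S := fun y =>
  match word (x^-1 * y)%g with
  | [::] => Tagged (msV S) (0 : msV S a)
  | c :: w =>
      if c == a then transport v w else Tagged (msV S) (0 : msV S (last c w))
  end.

Section MuSpec.
Variables (S : matrix_system k C).

Lemma coneP x a y : cone x a y <-> ohead (word (x^-1 * y)%g) = Some a.
Proof.
rewrite /cone /= wdistC [wdist y x]wdistC /wdist /wlen invgM -gen_linv -mulgA.
rewrite [word (gen _ * _)%g]word_mul /=.
case: (wmul _ _) => [|c w] //=; rewrite linvK.
by case: eqP => [->|ca] /=; [rewrite leqnn|rewrite ltnNge leqW//; split=> // -[]].
Qed.

Lemma tag_transport a (v : msV S a) w : tag (transport v w) = last a w.
Proof. by elim: w a v => //= b w IH a v. Qed.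

Lemma transport_rcons a (v : msV S a) w b :
  transport v (rcons w b) =
  Tagged (msV S) (msH S b (tag (transport v w)) (tagged (transport v w))).
Proof. by elim: w a v => //= c w IH a v. Qed.

Lemma transport_step a (v : msV S a) w b c (u : msV S b) :
  transport v w = Tagged (msV S) u ->
  transport v (rcons w c) = Tagged (msV S) (msH S c b u).
Proof. by move=> vu; rewrite transport_rcons vu. Qed.

Lemma Tagged_intro a (u : {c : letter k & msV S c}) :
  tag u = a -> exists v : msV S a, u = Tagged (msV S) v.
Proof. by case: u => b v /= <-; exists v. Qed.

Lemma mu_multfun x a (v : msV S a) : multfun (mu x v).
Proof.
exists (wlen x).+1 => y xy.
have rc b (z : freegroup k) : (wlen x <= wlen z)%N ->
    wlen (z * gen b)%g = (wlen z).+1 ->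
    word (x^-1 * (z * gen b))%g = rcons (word (x^-1 * z)%g) b.
  move=> xz zb; rewrite word_mul (word_mulgenS zb).
  by rewrite wmul_rcons// -/(wlen _) wlenV.
have nz (z : freegroup k) : (wlen x < wlen z)%N ->
    exists c w, word (x^-1 * z)%g = c :: w.
  move=> xz; have := size_wmul (word x^-1%g) (word z).
  rewrite -!/(wlen _) wlenV -word_mul; case: word => [|c w]; last by exists c, w.
  by rewrite addn0 leqNgt xz.
split=> [b yb|b c ybc u].
  have [d [w E]] := nz _ xy; have := rc b y (ltnW xy) yb; rewrite /mu E => ->.
  apply: Tagged_intro => /=; case: eqP => _ /=; rewrite ?tag_transport.
    by rewrite last_rcons.
  by rewrite last_rcons.
have yb := wlen_mulgen2 ybc.
have [d [w E]] := nz _ xy; have Eb := rc b y (ltnW xy) yb.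
have Ec : word (x^-1 * (y * gen b * gen c))%g
        = rcons (word (x^-1 * (y * gen b))%g) c.
  by apply: rc; rewrite ?ybc ?yb// leqW// ltnW.
rewrite /mu Ec Eb E /=; case: eqP => _; first exact: transport_step.
rewrite !last_rcons => /eqP; rewrite eq_Tagged /= => /eqP <-.
by rewrite linear0.
Qed.

(** The defining properties of mu[x, xa, v]. *)
Lemma muP x a (v : msV S a) :
  [/\ multfun (mu x v),
      forall y, ~ cone x a y -> tagged (mu x v y) = 0,
      mu x v (x * gen a)%g = Tagged (msV S) v &
      forall y b c, cone x a (y * gen b)%g -> cone x a (y * gen b * gen c)%g ->
        wdist (y * gen b * gen c)%g x = (wdist y x).+2 ->
        exists u : msV S b,
          mu x v (y * gen b)%g = Tagged (msV S) u /\
          mu x v (y * gen b * gen c)%g = Tagged (msV S) (msH S c b u)].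
Proof.
split; first exact: mu_multfun.
- move=> y; rewrite coneP /mu; case: word => [|c w] //= ca.
  by case: eqP => // e; case: ca; rewrite e.
- by rewrite /mu mulKg /= eqxx.
move=> y b c; rewrite !coneP !(wdistC _ x) /wdist !mulgA.
set z := (x^-1 * y)%g => zb zbc zl.
have zbl := wlen_mulgen2 zl.
have Eb := word_mulgenS zbl.
have Ec : word (z * gen b * gen c)%g = rcons (word (z * gen b)%g) c.
  by apply: word_mulgenS; rewrite zbl.
rewrite /mu !mulgA -/z Ec.
move: zb; rewrite Eb; case: (word z) => [|d w] /= [->]; rewrite eqxx.
  by exists v.
have [u e] : exists u : msV S b, transport v (rcons w b) = Tagged (msV S) u.
  by apply: Tagged_intro; rewrite tag_transport last_rcons.
by exists u; rewrite (transport_step c e).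
Qed.
End MuSpec.

End MatrixSystems.

(** ** The inner product is well defined *)

Section InnerSpec.
Variables (k : nat) (C : numClosedFieldType) (S : matrix_system k C).
Implicit Types (a b : letter k) (B : form_tuple S) (f g : groupfun S) (x y : freegroup k).

Lemma sesqDl (V : vectType C) (D : 'Hom(V, adual V)) u v w :
  sesq D (u + v) w = sesq D u w + sesq D v w.
Proof. by rewrite /sesq linearD add_lfunE. Qed.

Lemma sesqZl (V : vectType C) (D : 'Hom(V, adual V)) c u w :
  sesq D (c *: u) w = c * sesq D u w.
Proof. by rewrite /sesq linearZ scale_lfunE. Qed.

Lemma sesqDr (V : vectType C) (D : 'Hom(V, adual V)) u v w :
  sesq D u (v + w) = sesq D u v + sesq D u w.
Proof. exact: (linearD (D u : 'Hom(conjv V, C^o))). Qed.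

Lemma sesqZr (V : vectType C) (D : 'Hom(V, adual V)) c u v :
  sesq D u (c *: v) = c^* * sesq D u v.
Proof.
rewrite -[in LHS](conjCK c).
rewrite -[LHS]/((D u : 'Hom(conjv V, C^o)) (c^* *: (v : conjv V))).
by rewrite linearZ.
Qed.

Lemma normalized_sesq B a (u v : msV S a) : normalized B ->
  sesq (B a) u v = \sum_b sesq (B b) (msH S b a u) (msH S b a v).
Proof.
move=> [_ BN]; apply/eqP; rewrite -subr_eq0; apply/eqP.
pose D (u v : msV S a) :=
  sesq (B a) u v - \sum_b sesq (B b) (msH S b a u) (msH S b a v).
have D0 w : D w w = 0 by rewrite /D -BN subrr.
have DDl w w' z : D (w + w') z = D w z + D w' z.
  rewrite /D sesqDl addrACA -opprD -big_split /=; congr (_ - _).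
  by apply: eq_bigr => b _; rewrite linearD sesqDl.
have DDr w w' z : D z (w + w') = D z w + D z w'.
  rewrite /D sesqDr addrACA -opprD -big_split /=; congr (_ - _).
  by apply: eq_bigr => b _; rewrite linearD sesqDr.
have DZl c w z : D (c *: w) z = c * D w z.
  rewrite /D sesqZl mulrBr mulr_sumr; congr (_ - _).
  by apply: eq_bigr => b _; rewrite linearZ sesqZl.
have DZr c w z : D z (c *: w) = c^* * D z w.
  rewrite /D sesqZr mulrBr mulr_sumr; congr (_ - _).
  by apply: eq_bigr => b _; rewrite linearZ sesqZr.
have anti w z : D w z = - D z w.
  have := D0 (w + z); rewrite DDl !DDr !D0 add0r addr0.
  by move/eqP; rewrite addr_eq0 => /eqP.
have sym w z : D w z = D z w.
  have := anti w ('i *: z); rewrite DZl DZr conjCi mulNr => /oppr_inj.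
  exact: (mulfI (neq0Ci C)).
have := anti u v; rewrite (sym v u) => /eqP; rewrite -addr_eq0 -mulr2n.
by rewrite mulrn_eq0 => /eqP.
Qed.

Lemma finite_sphere N : finite_set [set x : freegroup k | wlen x = N]%classic.
Proof.
pose h (t : N.-tuple (letter k)) : freegroup k := insubd (fg_one k) (t : seq _).
apply: (@sub_finite_set _ _ (h @` setT)%classic); last exact: finite_image.
move=> x /= xN; have xs : size (word x) == N by apply/eqP.
exists (Tuple xs) => //; apply: val_inj.
exact: insubdK (word_reduced x).
Qed.

Let sph N := finmap.enum_fset (fset_set [set x : freegroup k | wlen x = N]%classic).

Let mem_sph N x : (x \in sph N) = (wlen x == N).
Proof.
rewrite -[LHS]/(x \in fset_set _) in_fset_set; last exact: finite_sphere.
by apply/idP/eqP; rewrite inE.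
Qed.

Lemma sphere_productE B N f g : sphere_product B N f g =
  \sum_(x <- sph N) \sum_(a | wlen (x * gen a)%g == N.+1)
    sesq (B a) (component a (f (x * gen a)%g)) (component a (g (x * gen a)%g)).
Proof. by rewrite /sphere_product fsbig_finite//; exact: finite_sphere. Qed.

Let sph_step N (K : freegroup k -> C) :
  \sum_(y <- sph N.+1) K y =
  \sum_(x <- sph N) \sum_(a | wlen (x * gen a)%g == N.+1) K (x * gen a)%g.
Proof.
under [RHS]eq_bigr do rewrite -big_filter.
rewrite -big_allpairs_dep; apply: perm_big; apply: uniq_perm.
- exact: fset_uniq.
- apply: allpairs_uniq_dep => [|x _|]; [exact: fset_uniq| |].
    by rewrite filter_uniq// index_enum_uniq.
  move=> [x a] [y b] /allpairsPdep[x' [a' [xs a's [-> ->]]]].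
  move=> /allpairsPdep[y' [b' [ys b's [-> ->]]]] /= e.
  have wx : wlen x' = N by apply/eqP; rewrite -mem_sph.
  have wy : wlen y' = N by apply/eqP; rewrite -mem_sph.
  move: a's b's; rewrite !mem_filter => /andP[/eqP xa _] /andP[/eqP yb _].
  rewrite -wx in xa; rewrite -wy in yb.
  have := congr1 (@word k) e; rewrite (word_mulgenS xa) (word_mulgenS yb).
  by move=> /rcons_inj[/val_inj -> ->].
move=> y; rewrite mem_sph; apply/eqP/allpairsPdep => [yN|].
  have [w [a wa]] : exists w a, word y = rcons w a.
    by move: yN; rewrite /wlen; case: (lastP (word y)) => // w a _; exists w, a.
  have rw : reduced w.
    by have := word_reduced y; rewrite wa /reduced -cats1 => /cat_sorted2[].
  have sw : size w = N by apply: succn_inj; rewrite -yN /wlen wa size_rcons.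
  have ye : y = (FreeGroup rw * gen a)%g.
    apply: val_inj; rewrite /= wa -[RHS]/(foldr (@lmul k) (lmul a [::]) w).
    by rewrite -foldr_rcons -/(wmul _ _) wmulw0// -wa word_reduced.
  exists (FreeGroup rw), a; split => //; first by rewrite mem_sph /wlen /= sw.
  by rewrite mem_filter mem_index_enum -ye yN eqxx.
by move=> [x [a [xs]]]; rewrite mem_filter => /andP[/eqP + _] ->.
Qed.

Lemma componentE a (v : msV S a) : component a (Tagged (msV S) v) = v.
Proof. by rewrite /component /untag; case: eqP => // e; rewrite (eq_axiomK e). Qed.

Lemma sphere_product_cst B f g : normalized B ->
  multfun f -> multfun g ->
  exists N, forall n, (N <= n)%N ->
    sphere_product B n f g = sphere_product B N f g.
Proof.
move=> BN [Nf fP] [Ng gP]; exists (maxn Nf Ng).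
suff step n : (maxn Nf Ng <= n)%N ->
    sphere_product B n.+1 f g = sphere_product B n f g.
  elim=> [|n IH]; first by rewrite leqn0 => /eqP ->.
  rewrite leq_eqVlt => /predU1P[<- //|]; rewrite ltnS => Nn.
  by rewrite step// IH.
rewrite geq_max => /andP[fn gn]; rewrite !sphere_productE sph_step.
rewrite big_seq [RHS]big_seq; apply: eq_bigr => x; rewrite mem_sph => /eqP xn.
apply: eq_bigr => a /eqP xa; rewrite -xn in fn gn xa.
have [/(_ a xa)[u fu] fS] := fP x fn; have [/(_ a xa)[v gv] gS] := gP x gn.
rewrite fu gv !componentE (normalized_sesq _ _ BN).
rewrite [RHS](bigID (fun b => wlen (x * gen a * gen b)%g == n.+2)) /=.
rewrite [X in _ + X]big1 ?addr0 => [|b nb]; last first.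
  suff -> : msH S b a = 0 by rewrite /sesq !zero_lfunE !linear0.
  apply: msH0; apply/eqP; rewrite gen_mul_eq1; apply/eqP.
  case: (word_mulgen (x * gen a)%g b) => [e|].
    by move: nb; rewrite {1}/wlen e size_rcons -/(wlen _) xa xn eqxx.
  by rewrite (word_mulgenS xa) => /rcons_inj[].
apply: eq_bigr => b /eqP xab; rewrite -xn in xab.
by rewrite (fS a b xab u fu) (gS a b xab v gv) !componentE.
Qed.

Lemma innerE B f g : normalized B ->
  multfun f -> multfun g ->
  exists N, forall n, (N <= n)%N -> sphere_product B n f g = inner B f g.
Proof.
move=> BN fm gm; have [N NP] := sphere_product_cst BN fm gm.
have : [set c | \forall n \near \oo, sphere_product B n f g = c]%classic
         (inner B f g).
  by apply: (@xgetPex _ 0); exists (sphere_product B N f g), N.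
by move=> [M _ MP]; exists M => n Mn; exact: MP.
Qed.

End InnerSpec.

(** * Square sums of matrix coefficients *)

Local Open Scope classical_set_scope.

Section Coefficients.
Variables (R : realType) (k : nat) (S : matrix_system k R[i]) (B : form_tuple S).

(** ||phi_eps^{va,vb}||_2^2, with values in the extended reals since the series
    is not known a priori to converge. *)
Definition phi_norm2 (eps : R) (a b : letter k) (va : msV S a) (vb : msV S b) :
    \bar R :=
  (\esum_(x in [set: freegroup k])
    ((ComplexField.Normc.normc
        (inner B (mu 1%g va) (piact x (mu 1%g vb)))) ^+ 2
     * expR (- eps * (wlen x)%:R))%:E)%E.

End Coefficients.

Definition simeq_inv (R : realType) (g : R -> \bar R) : Prop :=
  exists c1 c2 : R, [/\ 0 < c1, 0 < c2 &
    \forall eps \near (0 : R)^'+,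
      ((c1 / eps)%:E <= g eps <= (c2 / eps)%:E)%E].

(* Main.v *)
Require Import Defs.
From HB Require Import structures.
From mathcomp Require Import all_boot all_order all_algebra.
From mathcomp Require Import spectral complex finmap ring lra.
From mathcomp Require Import all_classical all_reals all_analysis.

(** Reading the letters of the word of [x] one by one, the matrix coefficient is
    the final value of a linear recursion [(t, psi) |-> (H t, Hhat psi + E t)]
    on [V_c (+) Vhat_c], plus terms of the form [B_a(v_a, H ... H v_b)]. The maps
    [Q] are chosen so that [chi = psi - Q t] satisfies the same recursion with
    [E] replaced by the defect [D = Hhat Q + E - Q H], which is orthogonal to
    the fixed tensor of [S]. The sums over the words of length [n] of the
    sesquilinear forms in [(t, t)], [(chi, t)] and [(chi, chi)] are then
    controlled by the transfer operator [pull]. A fixed point of [pull]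
    intertwines two systems (its Kadison-Schwarz defect pairs to zero with a
    faithful invariant tensor), so irreducibility makes the fixed forms multiples
    of [B], and inequivalence excludes mixed ones. By the Fredholm alternative
    each form is a multiple of the fixed one plus a coboundary, whose Abel sums
    telescope. With [z = exp(-eps)] and up to lower powers of [1 / (1 - z)], the
    forms in [(t, t)] give [c / (1 - z)], the mixed ones nothing, and those in
    [(chi, chi)], driven by [D], a multiple of [E_0 / (1 - z)^2]. *)

Set Implicit Arguments.
Unset Strict Implicit.
Unset Printing Implicit Defensive.

Import Order.TTheory GRing.Theory Num.Theory.
Import numFieldNormedType.Exports.

Local Open Scope ring_scope.

(** * Sesquilinear forms *)

Section Sesquilinear.
Variable C : numClosedFieldType.
Implicit Types U V W : vectType C.

(** The twin enters because the coefficient at x evaluates E of the current state on a vector read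
    backwards from the end of x; storing the functional psi and moving it by adjoints of H makes the
    recursion run forward only. The obstacle is that, unlike the B-norm of t, the norm of chi is not
    conserved, so no form containing chi is bounded beforehand. Young's inequality with weight
    proportional to 1 - z gives the crude order 3. Each use of the coboundary form of mixed forms
    gains one power of 1 - z, the orthogonality of D removing the mean drive that would stop the
    gain; three uses bring them to order 0. The increments of the chi-norm then have mean E_0
    B_a(v_a, v_a) / k_0, whence a double pole. The second factor 1 / k_0 appears when the final form
    |chi(v_b)|^2 is replaced by its multiple B_b(v_b, v_b) / k_0 of the fixed form of the twin. If
    E_0 = 0, the lower bound of order 1 / eps comes from the terms B_a(v_a, H ... H v_b), carried by
    the words that do not start with a. *)

Definition sesquilin U V (T : U -> V -> C) : Prop :=
  (forall c u u' v, T (c *: u + u') v = c * T u v + T u' v) /\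
  (forall c u v v', T u (c *: v + v') = c^* * T u v + T u v').

Section Theory.
Variables (U V : vectType C) (T : U -> V -> C).
Hypothesis hT : sesquilin T.

Lemma sesquilinDl u u' v : T (u + u') v = T u v + T u' v.
Proof. by rewrite -[u in LHS]scale1r hT.1 mul1r. Qed.

Lemma sesquilinDr u v v' : T u (v + v') = T u v + T u v'.
Proof. by rewrite -[v in LHS]scale1r hT.2 conjC1 mul1r. Qed.

Lemma sesquilin0l v : T 0 v = 0.
Proof. by apply: (addrI (T 0 v)); rewrite -sesquilinDl !addr0. Qed.

Lemma sesquilin0r u : T u 0 = 0.
Proof. by apply: (addrI (T u 0)); rewrite -sesquilinDr !addr0. Qed.

Lemma sesquilinZl c u v : T (c *: u) v = c * T u v.
Proof. by rewrite -[c *: u]addr0 hT.1 sesquilin0l addr0. Qed.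

Lemma sesquilinZr c u v : T u (c *: v) = c^* * T u v.
Proof. by rewrite -[c *: v]addr0 hT.2 sesquilin0r addr0. Qed.

Lemma sesquilinBl u u' v : T (u - u') v = T u v - T u' v.
Proof. by rewrite sesquilinDl -scaleN1r sesquilinZl mulN1r. Qed.

Lemma sesquilinBr u v v' : T u (v - v') = T u v - T u v'.
Proof. by rewrite sesquilinDr -scaleN1r sesquilinZr conjCN1 mulN1r. Qed.

Lemma sesquilin_suml (I : Type) (s : seq I) (P : pred I) (f : I -> U) v :
  T (\sum_(i <- s | P i) f i) v = \sum_(i <- s | P i) T (f i) v.
Proof.
apply: (big_morph (fun u => T u v)) => [u u'|]; [exact: sesquilinDl|].
exact: sesquilin0l.
Qed.

Lemma sesquilin_sumr (I : Type) (s : seq I) (P : pred I) u (f : I -> V) :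
  T u (\sum_(i <- s | P i) f i) = \sum_(i <- s | P i) T u (f i).
Proof.
apply: (big_morph (T u)) => [v v'|]; [exact: sesquilinDr|].
exact: sesquilin0r.
Qed.

End Theory.

Lemma sesquilin_conj U V (T : U -> V -> C) :
  sesquilin T -> sesquilin (fun v u => (T u v)^*).
Proof.
move=> hT; split=> [c v v' u|c v u u'].
  by rewrite hT.2 rmorphD rmorphM /= conjCK.
by rewrite hT.1 rmorphD rmorphM.
Qed.

Lemma sesquilinD U V (T T' : U -> V -> C) : sesquilin T -> sesquilin T' ->
  sesquilin (fun u v => T u v + T' u v).
Proof.
move=> hT hT'; split=> [c u u' v|c u v v'].
  by rewrite hT.1 hT'.1 mulrDr addrACA.
by rewrite hT.2 hT'.2 mulrDr addrACA.
Qed.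

Lemma sesquilinZ U V (T : U -> V -> C) d : sesquilin T ->
  sesquilin (fun u v => d * T u v).
Proof.
move=> hT; split=> [c u u' v|c u v v'].
  by rewrite hT.1 mulrDr mulrCA.
by rewrite hT.2 mulrDr mulrCA.
Qed.

Lemma sesquilinB U V (T T' : U -> V -> C) : sesquilin T -> sesquilin T' ->
  sesquilin (fun u v => T u v - T' u v).
Proof.
move=> hT hT'; split=> [c u u' v|c u v v'].
  by rewrite hT.1 hT'.1 opprD mulrBr addrACA.
by rewrite hT.2 hT'.2 opprD mulrBr addrACA.
Qed.

Lemma sesquilin_sum (I : finType) U V (T : I -> U -> V -> C) :
  (forall i, sesquilin (T i)) -> sesquilin (fun u v => \sum_i T i u v).
Proof.
move=> hT; split=> [c u u' v|c u v v']; rewrite mulr_sumr -big_split /=;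
by apply: eq_bigr => i _; rewrite ?(hT i).1 ?(hT i).2.
Qed.

Lemma sesquilin_comp U V U' V' (T : U -> V -> C) (f : 'Hom(U', U))
    (g : 'Hom(V', V)) :
  sesquilin T -> sesquilin (fun u v => T (f u) (g v)).
Proof.
move=> hT; split=> [c u u' v|c u v v']; rewrite linearP.
  by rewrite hT.1.
by rewrite hT.2.
Qed.

Lemma sesquilin_sesq V (D : 'Hom(V, adual V)) : sesquilin (sesq D).
Proof.
by split=> [c u u' v|c u v v']; rewrite ?sesqDl ?sesqZl ?sesqDr ?sesqZr.
Qed.

(** Polarization makes [T] antisymmetric; replacing z by iz, where conjugation flips a sign, makes
    it symmetric as well. *)
Lemma sesquilin_alt0 V (T : V -> V -> C) :
  sesquilin T -> (forall w, T w w = 0) -> forall u v, T u v = 0.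
Proof.
move=> hT D0 u v.
have anti w z : T w z = - T z w.
  have := D0 (w + z); rewrite (sesquilinDl hT) !(sesquilinDr hT) !D0 add0r addr0.
  by move/eqP; rewrite addr_eq0 => /eqP.
have sym w z : T w z = T z w.
  have := anti w ('i *: z); rewrite (sesquilinZl hT) (sesquilinZr hT) conjCi.
  by rewrite mulNr => /oppr_inj; exact: (mulfI (neq0Ci C)).
have := anti u v; rewrite (sym v u) => /eqP; rewrite -addr_eq0 -mulr2n.
by rewrite mulrn_eq0 => /eqP.
Qed.

Lemma adual_of U V (T : U -> V -> C) (u : U) : sesquilin T ->
  exists f : adual V, forall v, (f : 'Hom(conjv V, C^o)) v = T u v.
Proof.
move=> hT; pose h (v : conjv V) : C^o := T u v.
have lh : linear h.
  by move=> c v w; rewrite /h conjv_scaleE hT.2 conjCK.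
pose F := GRing.isLinear.Build _ _ _ _ h lh.
pose G : {linear conjv V -> C^o} := HB.pack h F.
by exists (linfun G) => v; rewrite (lfunE G).
Qed.

Lemma adual_eq0 V (v : V) :
  (forall f : adual V, (f : 'Hom(conjv V, C^o)) v = 0) -> v = 0.
Proof.
move=> fv; apply/eqP; rewrite -[_ == _]memv0 -(eqP (bidual_lker0 V)) memv_ker.
apply/eqP/lfunP => f; rewrite (bidualE v f) fv rmorph0.
by rewrite zero_lfunE.
Qed.

(** [sum_i x_i (x) conj y_i] is determined by its action on the antilinear
    functionals of the second factor. *)
Lemma eq_sum_sesquilin U V (W : U -> V -> C) (I J : Type) (s : seq I)
    (s' : seq J) (x : I -> U) (y : I -> V) (x' : J -> U) (y' : J -> V) :
  sesquilin W ->
  (forall f : adual V,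
     \sum_(i <- s) (f : 'Hom(conjv V, C^o)) (y i) *: x i =
     \sum_(j <- s') (f : 'Hom(conjv V, C^o)) (y' j) *: x' j) ->
  \sum_(i <- s) W (x i) (y i) = \sum_(j <- s') W (x' j) (y' j).
Proof.
move=> hW eqs.
have key (K : Type) (r : seq K) (p : K -> U) (q : K -> V) :
    \sum_(k <- r) W (p k) (q k) =
    \sum_(i < \dim {:U}) \sum_(k <- r)
      coord (vbasis {:U}) i (p k) * W (vbasis {:U})`_i (q k).
  rewrite exchange_big; apply: eq_bigr => k _.
  rewrite [in LHS](coord_vbasis (memvf (p k))) (sesquilin_suml hW).
  by apply: eq_bigr => i _; rewrite (sesquilinZl hW).
rewrite !key; apply: eq_bigr => i _.
have [f fE] := adual_of (vbasis {:U})`_i hW.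
have /(congr1 (coord (vbasis {:U}) i)) := eqs f; rewrite !linear_sum /=.
under eq_bigr do rewrite linearZ /= fE mulrC.
under [in X in _ = X -> _]eq_bigr do rewrite linearZ /= fE mulrC.
by [].
Qed.

(** The index type depends on i because each letter carries a list of vectors in its own space;
    flattening reduces to a single sequence. *)
Lemma eq_dsum_sesquilin U V (W : U -> V -> C) (I : finType) (X : I -> Type)
    (P : forall i, seq (X i)) (x : forall i, X i -> U) (y : forall i, X i -> V)
    (J : Type) (s : seq J) (x' : J -> U) (y' : J -> V) :
  sesquilin W ->
  (forall f : adual V,
     \sum_i \sum_(p <- P i) (f : 'Hom(conjv V, C^o)) (y i p) *: x i p =
     \sum_(j <- s) (f : 'Hom(conjv V, C^o)) (y' j) *: x' j) ->
  \sum_i \sum_(p <- P i) W (x i p) (y i p) = \sum_(j <- s) W (x' j) (y' j).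
Proof.
move=> hW eqs.
pose r := flatten [seq [seq (x i p, y i p) | p <- P i] | i <- index_enum I].
have flat (Z : zmodType) (F : U -> V -> Z) :
    \sum_i \sum_(p <- P i) F (x i p) (y i p) = \sum_(z <- r) F z.1 z.2.
  by rewrite big_flatten big_map; apply: eq_bigr => i _; rewrite big_map.
rewrite flat; apply: eq_sum_sesquilin => // f.
by rewrite -eqs (flat _ (fun u v => (f : 'Hom(conjv V, C^o)) v *: u)).
Qed.

(** * Positive definite forms and Parseval frames *)

Section PosDef.
Variables (V : vectType C) (B : 'Hom(V, adual V)).
Hypothesis Bpos : posdef_form B.

Let hB := sesquilin_sesq B.

Lemma posdef_ge0 v : 0 <= sesq B v v.
Proof.
have [->|v0] := eqVneq v 0; first by rewrite (sesquilin0l hB).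
exact/ltW/Bpos.
Qed.

Lemma posdef_eq0 v : sesq B v v = 0 -> v = 0.
Proof.
by move=> Bv; apply/eqP/negPn/negP => /Bpos; rewrite Bv ltxx.
Qed.

(** Positivity makes the diagonal real, so the defect of symmetry is a sesquilinear form vanishing
    on the diagonal. *)
Lemma posdef_herm u v : (sesq B u v)^* = sesq B v u.
Proof.
apply/eqP; rewrite -subr_eq0; apply/eqP.
apply: (sesquilin_alt0 (T := fun v u => (sesq B u v)^* - sesq B v u)).
  apply: (sesquilinB _ hB).
  exact: (sesquilin_conj hB).
by move=> w; rewrite conj_Creal ?subrr// ger0_real// posdef_ge0.
Qed.

(** The Gram-Schmidt process. *)
Lemma posdef_frame :
  exists q : seq V, forall v, v = \sum_(p <- q) sesq B v p *: p.
Proof.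
pose exp_in q v := v = \sum_(p <- q) sesq B v p *: p.
(* Invariant of the process: [q] reproduces its own members and the basis vectors already treated.
   The first half is what makes the residual [r] orthogonal to [q]. *)
suff [q qP] : exists q, {in q, forall v, exp_in q v} /\
    {in tval (vbasis {:V}), forall v, exp_in q v}.
  exists q => v; rewrite [LHS](coord_vbasis (memvf v)).
  rewrite [in RHS](coord_vbasis (memvf v)).
  transitivity (\sum_(i < \dim {:V}) coord (vbasis {:V}) i v *:
      \sum_(p <- q) sesq B (vbasis {:V})`_i p *: p).
    by apply: eq_bigr => i _; rewrite -qP.2// mem_nth// size_tuple.
  under [RHS]eq_bigr do rewrite (sesquilin_suml hB) scaler_suml.
  rewrite [RHS]exchange_big; apply: eq_bigr => i _.
  rewrite scaler_sumr; apply: eq_bigr => p _.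
  by rewrite (sesquilinZl hB) scalerA.
elim: (tval (vbasis {:V})) => [|v s [q [qq qs]]]; first by exists [::].
pose r := v - \sum_(p <- q) sesq B v p *: p.
have [r0|r0] := eqVneq r 0.
  exists q; split=> // w; rewrite inE => /predU1P[->|/qs//].
  by apply/eqP; rewrite -subr_eq0 -/r r0.
have rq p : p \in q -> sesq B r p = 0.
  move=> pq; rewrite /r (sesquilinBl hB); apply/eqP; rewrite subr_eq0; apply/eqP.
  rewrite -posdef_herm {1}[p]qq// (sesquilin_suml hB) rmorph_sum /=.
  rewrite (sesquilin_suml hB); apply: eq_bigr => p' _.
  rewrite !(sesquilinZl hB) rmorphM /= !posdef_herm mulrC.
  by rewrite mulrC.
have rr : 0 < sesq B r r := Bpos r0.
pose e := (sqrtC (sesq B r r))^-1 *: r.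
have cs : (sqrtC (sesq B r r))^* = sqrtC (sesq B r r).
  by rewrite conj_Creal// ger0_real// sqrtC_ge0 ltW.
have s0 : sqrtC (sesq B r r) != 0 by rewrite sqrtC_eq0 gt_eqF.
have eE w : sesq B w e *: e = (sesq B w r / sesq B r r) *: r.
  rewrite /e (sesquilinZr hB) scalerA fmorphV /= cs mulrAC -invfM -expr2 sqrtCK.
  by rewrite mulrC.
exists (e :: q).
have inq w : exp_in q w -> exp_in (e :: q) w.
  move=> wq; rewrite /exp_in big_cons -wq eE.
  suff -> : sesq B w r = 0 by rewrite mul0r scale0r add0r.
  rewrite wq (sesquilin_suml hB) big_seq big1// => p pq.
  by rewrite (sesquilinZl hB) -(posdef_herm r p) rq// rmorph0 mulr0.
have inr : exp_in (e :: q) r.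
  rewrite /exp_in big_cons eE divff ?gt_eqF// scale1r big_seq big1 ?addr0//.
  by move=> p pq; rewrite rq// scale0r.
have lin c u w : exp_in (e :: q) u -> exp_in (e :: q) w ->
    exp_in (e :: q) (c *: u + w).
  move=> uq wq; rewrite /exp_in {1}uq {1}wq scaler_sumr -big_split /=.
  by apply: eq_bigr => p _; rewrite hB.1 scalerDl scalerA.
have e0 : exp_in (e :: q) 0.
  by rewrite /exp_in big1// => p _; rewrite (sesquilin0l hB) scale0r.
have linD u w : exp_in (e :: q) u -> exp_in (e :: q) w -> exp_in (e :: q) (u + w).
  by move=> uq wq; have := lin 1 _ _ uq wq; rewrite scale1r.
have linZ c u : exp_in (e :: q) u -> exp_in (e :: q) (c *: u).
  by move=> uq; have := lin c _ _ uq e0; rewrite addr0.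
split=> w; rewrite inE => /predU1P[->|wq].
- exact: linZ.
- by apply/inq/qq.
- have -> : v = r + \sum_(p <- q) sesq B v p *: p by rewrite subrK.
  apply: (@linD r) => //; rewrite big_seq.
  apply: (big_ind (exp_in (e :: q))) => [|u u'|p pq]; first exact: e0.
    exact: linD.
  by apply/linZ/inq/qq.
- by apply/inq/qs.
Qed.

Lemma posdef_lker0 : lker B == 0%VS.
Proof.
rewrite -subv0; apply/subvP => v; rewrite memv_ker memv0 => /eqP Bv.
by apply/eqP/posdef_eq0; rewrite /sesq Bv zero_lfunE.
Qed.

Lemma posdef_limg : limg B = fullv.
Proof.
apply/eqP; rewrite eqEdim subvf /= limg_dim_eq ?(eqP posdef_lker0) ?capv0//.
by rewrite !dimvf dim_adual.
Qed.

End PosDef.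

(** Turns the traces in [k0] and [E0] into pairings over frames. *)
Lemma lfun_tr_rank1s V (f : 'End(V)) (I : Type) (s : seq I)
    (phi : I -> V -> C) (y : I -> V) :
  (forall i, scalar (phi i)) ->
  (forall x, f x = \sum_(i <- s) phi i x *: y i) ->
  lfun_tr f = \sum_(i <- s) phi i (y i).
Proof.
move=> lphi fE; rewrite /lfun_tr.
have -> : \tr (passmx.mxof (vbasis {:V}) (vbasis {:V}) f) =
    \sum_j coord (vbasis {:V}) j (f (vbasis {:V})`_j).
  apply: eq_bigr => j _.
  by rewrite !(mxE, lfunE) /= passmx.vecof_delta.
under eq_bigr do rewrite fE linear_sum /=.
rewrite exchange_big; apply: eq_bigr => i _ /=.
pose F := GRing.isLinear.Build _ _ _ _ (phi i) (lphi i).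
pose G : {scalar V} := HB.pack (phi i) F.
rewrite [in RHS](coord_vbasis (memvf (y i))) -[RHS]/(G _) linear_sum.
by apply: eq_bigr => j _; rewrite !linearZ /= mulrC.
Qed.

End Sesquilinear.

(** * Transfer operators and fixed tensors *)

(** Moves a goal to a letter [linv a], where the casts along [linvK] disappear by [linv_castE]. *)
Lemma linv_ind k (P : letter k -> Prop) : (forall a, P (linv a)) -> forall b, P b.
Proof. by move=> h b; rewrite -(linvK b). Qed.

Lemma sum_linv k (V : nmodType) (F : letter k -> V) :
  \sum_b F b = \sum_b F (linv b).
Proof. by rewrite (reindex_inj (inv_inj (@linvK k))). Qed.

Definition linv_cast k (X : letter k -> Type) (F : forall a, X (linv a)) c : X c :=
  ecast d (X d) (linvK c) (F (linv c)).

Lemma linv_castE k (X : letter k -> Type) (F : forall a, X (linv a)) a :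
  linv_cast F (linv a) = F a.
Proof.
rewrite /linv_cast; have := linvK (linv a).
(* The endpoint [linv (linv a)] is generalized to [a'], so that [e'] can be eliminated; uniqueness
   of identity proofs on letters then removes [e]. *)
have -> // : forall a' (e' : a' = a) (e : linv a' = linv a),
    ecast d (X d) e (F a') = F a.
  by move=> a' e'; case: _ / (esym e') => e; rewrite eq_axiomK.
exact: linvK.
Qed.

Section Systems.
Variables (k : nat) (C : numClosedFieldType).
Implicit Types (S T : matrix_system k C) (a b c : letter k).

Definition form_family S1 S2 : Type := forall a, msV S1 a -> msV S2 a -> C.

Definition sesq_family S1 S2 (T : form_family S1 S2) : Prop :=
  forall a, sesquilin (T a).

Definition pull S1 S2 (T : form_family S1 S2) : form_family S1 S2 :=
  fun a u v => \sum_b T b (msH S1 b a u) (msH S2 b a v).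

Definition frames S : Type := forall a, seq (msV S a).

(** The tensors [sum_(p <- P a) p (x) conj p] span the fixed line of the
    pushforward dual to [pull]. *)
Definition fixed_frame S (P : frames S) : Prop :=
  (forall a, <<P a>>%VS = fullv) /\
  forall a (T : msV S a -> msV S a -> C), sesquilin T ->
    \sum_b \sum_(p <- P b) T (msH S a b p) (msH S a b p) = \sum_(p <- P a) T p p.

Definition pairing S (P : frames S) (T : form_family S S) : C :=
  \sum_a \sum_(p <- P a) T a p p.

Lemma sesq_family_pull S1 S2 (T : form_family S1 S2) :
  sesq_family T -> sesq_family (pull T).
Proof. by move=> hT a; apply: sesquilin_sum => b; exact: sesquilin_comp. Qed.

(** [pull] is dual to the pushforward of tensors, which fixes [P]: after exchanging the sums, each
    [T a] serves as a test form. *)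
Lemma pairing_pull S (P : frames S) (T : form_family S S) :
  fixed_frame P -> sesq_family T -> pairing P (pull T) = pairing P T.
Proof.
move=> hP hT; rewrite /pairing /pull.
under eq_bigr do rewrite exchange_big.
rewrite exchange_big; apply: eq_bigr => a _.
exact: hP.2.
Qed.

Lemma pairing_ge0 S (P : frames S) (T : form_family S S) :
  (forall a v, 0 <= T a v v) -> 0 <= pairing P T.
Proof. by move=> T0; apply: sumr_ge0 => a _; apply: sumr_ge0. Qed.

Lemma pairing_eq0 S (P : frames S) (T : form_family S S) :
  (forall a v, 0 <= T a v v) -> pairing P T = 0 ->
  forall a p, p \in P a -> T a p p = 0.
Proof.
move=> T0 /eqP; rewrite psumr_eq0; last by move=> a _; apply: sumr_ge0.
move=> /allP /(_ _ (mem_index_enum _)) + a => /(_ a) /=.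
rewrite psumr_eq0// => /allP h p pa.
by apply/eqP/(h _ pa).
Qed.

Lemma fixed_frame_eq0 S (P : frames S) a (W : vectType C) (f : 'Hom(msV S a, W)) :
  fixed_frame P -> {in P a, forall p, f p = 0} -> f = 0.
Proof.
move=> hP f0.
have /subvP fv : (fullv <= lker f)%VS.
  by rewrite -(hP.1 a); apply/span_subvP => p /f0 fp; rewrite memv_ker fp.
by apply/lfunP => v; rewrite zero_lfunE; apply/eqP; rewrite -memv_ker fv ?memvf.
Qed.

Lemma normalized_pull S (B : form_tuple S) : normalized B ->
  forall a u v, pull (fun a => sesq (B a)) u v = sesq (B a) u v.
Proof. by move=> BN a u v; rewrite (normalized_sesq _ _ BN). Qed.

Section Twin.
Variables (S : matrix_system k C) (B : form_tuple S) (Bh : form_tuple (twin S)).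
Hypotheses (BN : normalized B) (Bh_twin : twin_forms Bh).

Lemma twin_normalized : normalized Bh.
Proof.
split=> [a|a v]; first exact: Bh_twin.1.
rewrite {1}/sesq Bh_twin.2 !sum_lfunE; apply: eq_bigr => b _.
by rewrite !comp_lfunE adjointE.
Qed.

Lemma hatBE a (f g : adual (msV S (linv a))) :
  (g : 'Hom(conjv _, C^o)) (hatB Bh a f) = (sesq (Bh a) f g)^*.
Proof.
rewrite /hatB comp_lfunE -[LHS]conjCK -bidualE limg_lfunVK//.
by rewrite bidual_limg memvf.
Qed.

Lemma hatBV_linv a : hatBV Bh (linv a) = hatB Bh a.
Proof. exact: (linv_castE (X := fun d => 'Hom(adual (msV S d), msV S d))). Qed.

Lemma hatB_surj a (v : msV S (linv a)) : exists f, v = hatB Bh a f.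
Proof.
have : bidual _ v \in limg (Bh a).
  by rewrite (posdef_limg (Bh_twin.1 a)) memvf.
move=> /memv_imgP[f _ fE]; exists f; rewrite /hatB comp_lfunE -fE.
by rewrite lker0_lfunK// bidual_lker0.
Qed.

(** Expand f in a Parseval frame of [Bh] and map it by [hatB]; the images span because [Bh] is
    nondegenerate. *)
Lemma hatBV_frame b : exists q : seq (msV S b),
  <<q>>%VS = fullv /\
  forall f : adual (msV S b),
    hatBV Bh b f = \sum_(p <- q) (f : 'Hom(conjv _, C^o)) p *: p.
Proof.
elim/linv_ind: b => a; rewrite hatBV_linv.
have [g gP] := posdef_frame (Bh_twin.1 a).
exists (map (hatB Bh a) g).
have E (f : adual (msV S (linv a))) : hatB Bh a f =
    \sum_(p <- map (hatB Bh a) g) (f : 'Hom(conjv _, C^o)) p *: p.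
  rewrite big_map {1}(gP f) linear_sum; apply: eq_bigr => p _.
  by rewrite linearZ /= hatBE (posdef_herm (Bh_twin.1 a)).
split=> //; apply/eqP; rewrite eqEsubv subvf /=; apply/subvP => v _.
have [f ->] := hatB_surj v; rewrite E big_seq; apply: rpred_sum => p pg.
by rewrite rpredZ// memv_span.
Qed.

(** The twin equation for [Bh], tested on functionals: up to the identification with the bidual, the
    adjoint of a twin map is the original map. *)
Lemma hatBV_fixed a (f : adual (msV S a)) :
  \sum_b msH S a b (hatBV Bh b (adjoint (msH S a b) f)) = hatBV Bh a f.
Proof.
elim/linv_ind: a f => a f.
apply/eqP; rewrite -subr_eq0; apply/eqP/adual_eq0 => g.
rewrite [LHS](linearB (g : 'Hom(conjv _, C^o))) /=.
rewrite (linear_sum (g : 'Hom(conjv _, C^o))) /= hatBV_linv hatBE.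
apply/eqP; rewrite subr_eq0; apply/eqP.
rewrite /sesq Bh_twin.2 !sum_lfunE rmorph_sum sum_linv.
apply: eq_bigr => b _; rewrite !comp_lfunE adjointE hatBV_linv -adjointE.
by rewrite hatBE.
Qed.

Definition frame_of (P : frames S) : Prop :=
  (forall a, <<P a>>%VS = fullv) /\
  forall a (f : adual (msV S a)),
    hatBV Bh a f = \sum_(p <- P a) (f : 'Hom(conjv _, C^o)) p *: p.

Lemma exists_frame_of : exists P, frame_of P.
Proof.
exists (fun a => projT1 (cid (hatBV_frame a))).
by split=> a; case: (projT2 (cid (hatBV_frame a))).
Qed.

Lemma frame_of_fixed P : frame_of P -> fixed_frame P.
Proof.
move=> [Ps PE]; split=> // a T hT.
apply: (eq_dsum_sesquilin hT (x := fun b p => msH S a b p)) => f.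
rewrite -PE -hatBV_fixed; apply: eq_bigr => b _; rewrite PE linear_sum.
by apply: eq_bigr => p _; rewrite linearZ /= adjointE.
Qed.

Lemma exists_parseval_frames : exists q : frames S,
  forall a v, v = \sum_(p <- q a) sesq (B a) v p *: p.
Proof.
exists (fun a => projT1 (cid (posdef_frame (BN.1 a)))) => a.
by case: (cid _).
Qed.

(** For a Parseval frame [q], its tensor is [B] itself seen in the twin spaces, so that
    normalization of [B] becomes invariance of a tensor for the twin: [B] and [Bh] exchange
    roles. *)
Definition twin_frame (q : frames S) : frames (twin S) :=
  fun a => map (B (linv a)) (q (linv a)).

Lemma parseval (q : frames S) a u v :
  (forall a v, v = \sum_(p <- q a) sesq (B a) v p *: p) ->
  sesq (B a) u v = \sum_(p <- q a) sesq (B a) u p * sesq (B a) p v.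
Proof.
move=> qP; rewrite {1}(qP a u) (sesquilin_suml (sesquilin_sesq _)).
by apply: eq_bigr => p _; rewrite sesqZl.
Qed.

Lemma twin_frame_fixed (q : frames S) :
  (forall a v, v = \sum_(p <- q a) sesq (B a) v p *: p) ->
  fixed_frame (twin_frame q).
Proof.
move=> qP; split=> [a|a T hT].
  apply/eqP; rewrite eqEsubv subvf /=; apply/subvP => f _.
  have : f \in limg (B (linv a)) by rewrite (posdef_limg (BN.1 _)) memvf.
  move=> /memv_imgP[v _ ->]; rewrite {1}(qP _ v) linear_sum big_seq.
  apply: rpred_sum => p pq.
  by rewrite linearZ rpredZ// memv_span//; apply: map_f.
apply: (eq_dsum_sesquilin hT (x := fun b p => msH (twin S) a b p)) => F.
(* By reflexivity the test functional is evaluation at some v; evaluated at w, the identity becomes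
   the polarized normalization of [B] at (v, w). *)
have := memvf F; rewrite -bidual_limg => /memv_imgP[v _ ->{F}].
under eq_bigr do rewrite big_map.
rewrite big_map; apply/lfunP => w.
have ev (x : adual (msV S (linv a))) (c : C) :
    (c *: x : 'Hom(conjv _, C^o)) w = c * (x : 'Hom(conjv _, C^o)) w.
  by rewrite scale_lfunE.
transitivity (sesq (B (linv a)) v w); last first.
  rewrite sum_lfunE (parseval _ _ qP); apply: eq_bigr => p _.
  by rewrite ev bidualE -(posdef_herm (BN.1 _)).
rewrite sum_lfunE (normalized_sesq _ _ BN) [RHS]sum_linv; apply: eq_bigr => b _.
rewrite sum_lfunE (parseval _ _ qP); apply: eq_bigr => p _.
by rewrite ev bidualE !adjointE -(posdef_herm (BN.1 _)).
Qed.

End Twin.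
End Systems.

(** * Fixed forms and the Fredholm alternative *)

Section Schur.
Variables (k : nat) (C : numClosedFieldType).
Implicit Types (S T : matrix_system k C) (a b c : letter k).

Definition intertwiner S1 S2 (J : forall a, 'Hom(msV S1 a, msV S2 a)) : Prop :=
  forall b a, (msH S2 b a \o J a = J b \o msH S1 b a)%VF.

Lemma intertwinerE S1 S2 (J : forall a, 'Hom(msV S1 a, msV S2 a)) b a v :
  intertwiner J -> msH S2 b a (J a v) = J b (msH S1 b a v).
Proof. by move=> hJ; rewrite -[LHS]comp_lfunE hJ comp_lfunE. Qed.

Lemma riesz (U V : vectType C) (D : 'Hom(V, adual V)) (T : U -> V -> C) :
  posdef_form D -> sesquilin T ->
  exists J : 'Hom(U, V), forall u v, T u v = sesq D (J u) v.
Proof.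
move=> Dpos hT; have [q qP] := posdef_frame Dpos.
pose h u := \sum_(p <- q) T u p *: p.
have lh : linear h.
  move=> c u u'; rewrite /h scaler_sumr -big_split /=; apply: eq_bigr => p _.
  by rewrite hT.1 scalerDl scalerA.
pose F := GRing.isLinear.Build _ _ _ _ h lh.
pose G : {linear U -> V} := HB.pack h F.
exists (linfun G) => u v; rewrite (lfunE G) {1}(qP v) (sesquilin_sumr hT).
rewrite -[G u]/(h u) (sesquilin_suml (sesquilin_sesq D)).
apply: eq_bigr => p _.
by rewrite (sesquilinZr hT) sesqZl mulrC (posdef_herm Dpos).
Qed.

(** The Kadison-Schwarz defect of [J] is a sum of squares whose pairing with
    the faithful fixed tensor [P] vanishes. *)
Lemma fixed_form_intertwiner S1 S2 (P : frames S1) (B : form_tuple S2)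
    (T : form_family S1 S2) :
  fixed_frame P -> normalized B -> sesq_family T ->
  (forall a u v, pull T u v = T a u v) ->
  exists J : forall a, 'Hom(msV S1 a, msV S2 a),
    intertwiner J /\ forall a u v, T a u v = sesq (B a) (J a u) v.
Proof.
move=> hP BN hT fixT.
pose J a := projT1 (cid (riesz (BN.1 a) (hT a))).
have JE a u v : T a u v = sesq (B a) (J a u) v.
  exact: (projT2 (cid (riesz (BN.1 a) (hT a))) u v).
clearbody J; exists J; split=> //.
pose G : form_family S1 S1 := fun a u v => sesq (B a) (J a u) (J a v).
have hG : sesq_family G.
  by move=> a; apply: sesquilin_comp; exact: sesquilin_sesq.
pose D b a := ((J b \o msH S1 b a) - (msH S2 b a \o J a))%VF.
pose K : form_family S1 S1 :=
  fun a u v => \sum_b sesq (B b) (D b a u) (D b a v).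
(* Expand the square: each cross term is G because [T] is fixed by [pull], and the last term is G
   because [B] is normalized. The pairing with [P] then kills pull G - G. *)
have KE a u : K a u u = pull G u u - G a u u.
  have cross : \sum_b sesq (B b) (J b (msH S1 b a u)) (msH S2 b a (J a u)) = G a u u.
    by rewrite /G -JE -fixT; apply: eq_bigr => b _; rewrite JE.
  have cross' : \sum_b sesq (B b) (msH S2 b a (J a u)) (J b (msH S1 b a u)) = G a u u.
    have -> : G a u u = (G a u u)^* by rewrite posdef_herm//; exact: BN.1.
    rewrite -cross rmorph_sum; apply: eq_bigr => b _.
    by rewrite -(posdef_herm (BN.1 b)).
  have last : \sum_b sesq (B b) (msH S2 b a (J a u)) (msH S2 b a (J a u)) = G a u u.
    by rewrite /G [in RHS](normalized_sesq _ _ BN).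
  transitivity (pull G u u
      - \sum_b sesq (B b) (J b (msH S1 b a u)) (msH S2 b a (J a u))
      - \sum_b sesq (B b) (msH S2 b a (J a u)) (J b (msH S1 b a u))
      + \sum_b sesq (B b) (msH S2 b a (J a u)) (msH S2 b a (J a u))).
    rewrite -!sumrB -big_split; apply: eq_bigr => b _ /=.
    have hB := sesquilin_sesq (B b).
    rewrite /D add_lfunE opp_lfunE !comp_lfunE (sesquilinBl hB) !(sesquilinBr hB).
    by rewrite /G opprD opprK !addrA.
  by rewrite cross cross' last subrK.
have K0 : pairing P K = 0.
  have -> : pairing P K = pairing P (pull G) - pairing P G.
    rewrite /pairing -sumrB; apply: eq_bigr => a _.
    by rewrite -sumrB; apply: eq_bigr => p _; rewrite KE.
  by rewrite pairing_pull// subrr.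
move=> b a; apply/esym/eqP; rewrite -subr_eq0; apply/eqP.
rewrite -/(D b a); apply: (fixed_frame_eq0 hP) => p pP.
have Bge c v w : w = v -> 0 <= sesq (B c) v w.
  by move=> ->; exact/posdef_ge0/BN.1.
have K_ge0 a' v : 0 <= K a' v v by apply: sumr_ge0 => c _; exact: Bge.
have /eqP := pairing_eq0 K_ge0 K0 pP.
rewrite /K psumr_eq0 => [/allP /(_ b (mem_index_enum _)) /eqP|c _].
  exact: (posdef_eq0 (BN.1 b)).
exact: Bge.
Qed.

(** Irreducibility is used through this consequence because it passes to the twin by transposing
    intertwiners. *)
Definition schurian S : Prop :=
  forall J : forall a, 'End(msV S a), intertwiner J ->
    exists l : C, forall a, J a = l *: \1%VF.

(** The eigenspaces of [J] for one eigenvalue of [J a0] form an invariant subsystem that is nonzero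
    at [a0]. *)
Lemma irreducible_schurian S : irreducible_system S -> schurian S.
Proof.
move=> [[a0 Va0] irr] J hJ.
pose E := vbasis {:msV S a0}.
have dim_gt0 : (0 < \dim {:msV S a0})%N by rewrite lt0n dimv_eq0.
have [l lP] := eigenvalue_closed (passmx.mxof E E (J a0)) dim_gt0.
exists l; pose W a := passmx.leigenspace (J a) l.
have memW a v : (v \in W a) = (J a v == l *: v).
  by rewrite memv_ker add_lfunE opp_lfunE scale_lfunE id_lfunE subr_eq0.
have [|Wfull|W0] := irr W.
- move=> b a; apply/subvP => _ /memv_imgP[v vW ->].
  move: vW; rewrite !memW -intertwinerE// => /eqP ->.
  by rewrite linearZ.
- move=> a; apply/lfunP => v; rewrite scale_lfunE id_lfunE.
  by apply/eqP; rewrite -memW Wfull memvf.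
- have := W0 a0; rewrite /W (passmx.leigenspaceE (vbasisP _)) => /eqP.
  by rewrite (passmx.vsof_eq0 (vbasisP _)) (negPf lP).
Qed.

Lemma schurian_fixed_form S (P : frames S) (B : form_tuple S)
    (T : form_family S S) :
  schurian S -> fixed_frame P -> normalized B -> sesq_family T ->
  (forall a u v, pull T u v = T a u v) ->
  exists l : C, forall a u v, T a u v = l * sesq (B a) u v.
Proof.
move=> hS hP BN hT fixT.
have [J [hJ JE]] := fixed_form_intertwiner hP BN hT fixT.
have [l lE] := hS J hJ; exists l => a u v.
by rewrite JE lE scale_lfunE id_lfunE sesqZl.
Qed.

Section Twin.
Variable S : matrix_system k C.

Lemma predual_endo (V : vectType C) (J : 'End(adual V)) :
  exists J' : 'End(V), forall (f : adual V) v,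
    (f : 'Hom(conjv V, C^o)) (J' v) = (J f : 'Hom(conjv V, C^o)) v.
Proof.
exists ((bidual V)^-1 \o adjoint J \o bidual V)%VF => f v.
rewrite -[LHS]conjCK -bidualE !comp_lfunE limg_lfunVK ?bidual_limg ?memvf//.
by rewrite adjointE bidualE conjCK.
Qed.

(** Transposing [J] gives an intertwiner of [S], hence a scalar l; antilinearity of the functionals
    makes the scalar of [J] the conjugate of l. *)
Lemma twin_schurian : schurian S -> schurian (twin S).
Proof.
move=> hS J hJ.
pose J' a : 'End(msV S (linv a)) :=
  projT1 (cid (@predual_endo (msV S (linv a)) (J a))).
have J'E a (f : adual (msV S (linv a))) v :
    (f : 'Hom(conjv _, C^o)) (J' a v) = (J a f : 'Hom(conjv _, C^o)) v.
  exact: (projT2 (cid (@predual_endo (msV S (linv a)) (J a))) f v).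
clearbody J'.
pose J2 := linv_cast (X := fun d => 'End(msV S d)) J'.
have J2E a : J2 (linv a) = J' a := linv_castE (X := fun d => 'End(msV S d)) J' a.
have hJ2 : intertwiner J2.
  move=> b a; elim/linv_ind: b => b; elim/linv_ind: a => a; rewrite !J2E.
  apply/lfunP => v; rewrite !comp_lfunE; apply/eqP; rewrite -subr_eq0; apply/eqP.
  apply: adual_eq0 => f; rewrite [LHS](linearB (f : 'Hom(conjv _, C^o))) /=.
  rewrite -adjointE !J'E -adjointE.
  by rewrite -[J a _](@intertwinerE (twin S) (twin S) J a b f hJ) subrr.
have [l lE] := hS J2 hJ2; exists l^* => a.
apply/lfunP => f; apply/lfunP => v.
rewrite -J'E -J2E lE !scale_lfunE !id_lfunE.
rewrite -[in LHS](conjCK l).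
rewrite -[LHS]/((f : 'Hom(conjv (msV S (linv a)), C^o))
  (l^* *: (v : conjv (msV S (linv a))))).
by rewrite linearZ.
Qed.

(** The conjugate transpose of [T] comes from an intertwiner from [S] to its twin. Its kernels are
    an invariant subsystem, so it is zero or injective, and in the latter case it is an
    equivalence. *)
Lemma mixed_fixed_form (P : frames S) (Bh : form_tuple (twin S))
    (T : form_family (twin S) S) :
  irreducible_system S -> ~ equivalent_systems S (twin S) ->
  fixed_frame P -> normalized Bh -> sesq_family T ->
  (forall a u v, pull T u v = T a u v) ->
  forall a u v, T a u v = 0.
Proof.
move=> [_ irr] neq hP BN hT fixT.
pose T' : form_family S (twin S) := fun a v u => (T a u v)^*.
have [||J [hJ JE]] := @fixed_form_intertwiner _ _ P Bh T' hP BN.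
- by move=> a; exact: sesquilin_conj.
- by move=> a v u; rewrite /T' -fixT rmorph_sum.
have [|kf|k0] := irr (fun a => lker (J a)).
- move=> b a; apply/subvP => _ /memv_imgP[v + ->].
  by rewrite !memv_ker -intertwinerE// => /eqP ->; rewrite linear0.
- move=> a u v; apply/eqP; rewrite -conjC_eq0 -/(T' a v u) JE.
  suff -> : J a v = 0 by rewrite /sesq linear0 zero_lfunE.
  by apply/eqP; rewrite -memv_ker kf memvf.
case: neq; exists J; split=> // a.
have k0' b : lker (J b) = 0%VS := k0 b.
(* The twin space at b has the dimension of the space at b^-1, so applying this at b and at b^-1
   gives equality and surjectivity. *)
have dle b : (dim (msV S b) <= dim (msV S (linv b)))%N.
  rewrite -[X in (_ <= X)%N]dim_adual -[X in (X <= _)%N]dimvf -dimvf.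
  by rewrite -(limg_dim_eq (f := J b)) ?dimvS ?subvf// k0' capv0.
have full : limg (J a) = fullv.
  apply/eqP; rewrite eqEdim subvf /= limg_dim_eq ?k0' ?capv0// !dimvf.
  by rewrite [X in (X <= _)%N]dim_adual -[X in (_ <= dim (msV S X))%N]linvK dle.
exists (J a)^-1%VF => [v|u]; first by rewrite lker0_lfunK// k0'.
by rewrite limg_lfunVK// full memvf.
Qed.

End Twin.

(** The Fredholm alternative for [1 - pull], with kernel spanned by [beta]. *)
Lemma fredholm S1 S2 (beta : form_family S1 S2) :
  sesq_family beta ->
  (forall T : form_family S1 S2, sesq_family T ->
     (forall a u v, pull T u v = T a u v) ->
     exists l : C, forall a u v, T a u v = l * beta a u v) ->
  (forall W : form_family S1 S2, sesq_family W ->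
     (forall a u v, beta a u v = W a u v - pull W u v) ->
     forall a u v, beta a u v = 0) ->
  forall T : form_family S1 S2, sesq_family T ->
    exists l : C, exists2 W : form_family S1 S2, sesq_family W &
      forall a u v, T a u v = l * beta a u v + (W a u v - pull W u v).
Proof.
move=> hbeta ker_beta im_beta.
(* Form families are encoded by their coordinates, which makes 1 - pull an endomorphism of a
   finite-dimensional space. *)
pose I := {a : letter k & ('I_(\dim {:msV S1 a}) * 'I_(\dim {:msV S2 a}))%type}.
pose X := {ffun I -> C^o}.
pose enc (T : form_family S1 S2) : X :=
  [ffun i : I => T (tag i) (vbasis {:msV S1 (tag i)})`_(tagged i).1
                           (vbasis {:msV S2 (tag i)})`_(tagged i).2].
pose dec (x : X) : form_family S1 S2 := fun a u v =>
  \sum_i \sum_j coord (vbasis {:msV S1 a}) i u * (coord (vbasis {:msV S2 a}) j v)^*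
     * x (Tagged (fun a => ('I_(\dim {:msV S1 a}) * 'I_(\dim {:msV S2 a}))%type) (i, j)).
have dec_sesq x : sesq_family (dec x).
  move=> a; apply: sesquilin_sum => i; apply: sesquilin_sum => j.
  split=> [c u u' v|c u v v']; rewrite linearP; first by rewrite !mulrDl -!mulrA.
  by rewrite rmorphD rmorphM /= mulrDr mulrDl !mulrA [_ * c^*]mulrC.
have decK (T : form_family S1 S2) : sesq_family T ->
    forall a u v, dec (enc T) a u v = T a u v.
  move=> hT a u v; rewrite [in RHS](coord_vbasis (memvf u)) (sesquilin_suml (hT a)).
  apply: eq_bigr => i _; rewrite (sesquilinZl (hT a)).
  rewrite [in RHS](coord_vbasis (memvf v)) (sesquilin_sumr (hT a)) mulr_sumr.
  by apply: eq_bigr => j _; rewrite (sesquilinZr (hT a)) ffunE /= mulrA.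
have encK x : enc (dec x) = x.
  apply/ffunP => -[a [i j]]; rewrite ffunE /=.
  have cd (V : vectType C) (i' j' : 'I_(\dim {:V})) :
      coord (vbasis {:V}) i' (vbasis {:V})`_j' = (i' == j')%:R.
    by rewrite coord_free ?(basis_free (vbasisP _))// eq_sym.
  rewrite /dec (bigD1 i)//= (bigD1 j)//= !cd !eqxx conjC1 !mul1r.
  rewrite big1 => [|j' /negPf jj]; last by rewrite !cd jj conjC0 mulr0 mul0r.
  rewrite addr0 big1 ?addr0// => i' /negPf ii.
  by rewrite big1// => j' _; rewrite !cd ii !mul0r.
have decP (c : C) (x y : X) a u v :
    dec (c *: x + y) a u v = c * dec x a u v + dec y a u v.
  rewrite mulr_sumr -big_split; apply: eq_bigr => i _.
  rewrite mulr_sumr -big_split; apply: eq_bigr => j _ /=.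
  by rewrite !ffunE mulrDr mulrCA.
pose g (x : X) : X := x - enc (pull (dec x)).
have lg : linear g.
  move=> c x y; rewrite /g scalerBr addrACA -opprD; congr (_ - _).
  apply/ffunP => i; rewrite !ffunE /pull scaler_sumr -big_split /=.
  by apply: eq_bigr => b _; rewrite decP.
pose F := GRing.isLinear.Build _ _ _ _ g lg.
pose G : {linear X -> X} := HB.pack g F.
have GE x : linfun G x = g x by rewrite (lfunE G).
have gZ (c : C) (x : X) : g (c *: x) = c *: g x.
  have g0 : g 0 = 0 := linear0 G.
  by have := lg c x 0; rewrite addr0 g0 addr0.
have dec_g x a u v : dec (g x) a u v = dec x a u v - pull (dec x) u v.
  have -> : g x = (-1) *: enc (pull (dec x)) + x by rewrite scaleN1r addrC.
  by rewrite decP decK ?mulN1r 1?addrC//; exact: sesq_family_pull.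
have ker_sub : (lker (linfun G) <= <[enc beta]>)%VS.
  apply/subvP => x; rewrite memv_ker GE => /eqP gx.
  have [//|a u v|l lE] := ker_beta (dec x).
    apply/esym/eqP; rewrite -subr_eq0 -dec_g gx.
    have -> : (0 : X) = (-1) *: 0 + 0 by rewrite scaler0 addr0.
    by rewrite decP mulN1r addNr.
  apply/vlineP; exists l; rewrite -[x]encK; apply/ffunP => i.
  by rewrite !ffunE lE.
have cap0 : (<[enc beta]> :&: limg (linfun G) = 0)%VS.
  apply/eqP; rewrite -subv0; apply/subvP => _ /memv_capP[/vlineP[l ->]].
  move=> /memv_imgP[w _]; rewrite GE memv0 => lw.
  have [->|l0] := eqVneq l 0; first by rewrite scale0r.
  suff -> : enc beta = 0 by rewrite scaler0.
  apply/ffunP => i; rewrite !ffunE.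
  apply: (im_beta (dec (l^-1 *: w))) => // a u v.
  by rewrite -dec_g gZ -lw scalerA mulVf// scale1r decK.
(* Rank-nullity: the line of [beta] contains the kernel and meets the image trivially, so the two
   together fill the space. *)
have full : (<[enc beta]> + limg (linfun G) = fullv)%VS.
  apply/eqP; rewrite eqEdim subvf /= dimv_disjoint_sum//.
  rewrite -(limg_ker_dim (linfun G) fullv) leq_add2r.
  by rewrite (leq_trans (dimvS (capvSr _ _)))// dimvS.
move=> T hT; have := memvf (enc T); rewrite -full.
move=> /memv_addP[_ /vlineP[l ->] [_ /memv_imgP[w _ ->] TE]].
exists l; exists (dec w) => // a u v.
by rewrite -(decK _ hT) TE decP decK// GE dec_g.
Qed.

End Schur.

(** * Decomposition of forms, and the constants k_0 and E_0 as pairings *)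

Section Decomposition.
Variables (k : nat) (C : numClosedFieldType).
Implicit Types (S T : matrix_system k C) (a b c : letter k).

(** A coboundary pairs to zero with [P], whereas [B] pairs positively unless all the spaces vanish.
    So [B] is no nonzero coboundary, and pairing with [P] determines l. *)
Lemma form_decomposition S (P : frames S) (B : form_tuple S) (T : form_family S S) :
  schurian S -> fixed_frame P -> normalized B -> sesq_family T ->
  exists l : C, pairing P T = l * pairing P (fun a => sesq (B a)) /\
  exists2 W : form_family S S, sesq_family W &
    forall a u v, T a u v = l * sesq (B a) u v + (W a u v - pull W u v).
Proof.
move=> hS hP BN hT; pose beta : form_family S S := fun a => sesq (B a).
have hbeta : sesq_family beta by move=> a; exact: sesquilin_sesq.
have [||l [W hW TE]] := fredholm hbeta _ _ hT.
- by move=> T' hT' fixT; exact: (schurian_fixed_form hS hP BN hT' fixT).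
- move=> W hW betaE.
  have beta_ge0 a v : 0 <= beta a v v by exact/posdef_ge0/BN.1.
  have pair0 : pairing P beta = 0.
    have -> : pairing P beta = pairing P W - pairing P (pull W).
      rewrite /pairing -sumrB; apply: eq_bigr => a _.
      by rewrite -sumrB; apply: eq_bigr => p _.
    by rewrite pairing_pull// subrr.
  move=> a u v; suff -> : u = 0 by exact: sesquilin0l.
  have id0 : (\1%VF : 'End(msV S a)) = 0.
    apply: (fixed_frame_eq0 hP) => p pP; rewrite id_lfunE.
    exact/(posdef_eq0 (BN.1 a))/(pairing_eq0 beta_ge0 pair0 pP).
  by rewrite -[u]id_lfunE id0 zero_lfunE.
exists l; split; last by exists W.
rewrite -[RHS]addr0 -(subrr (pairing P W)) -{2}(pairing_pull hP hW).
rewrite /pairing mulr_sumr -sumrB -big_split; apply: eq_bigr => a _ /=.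
rewrite mulr_sumr -sumrB -big_split; apply: eq_bigr => p _ /=.
exact: TE.
Qed.

Section Twin.
Variables (S : matrix_system k C) (B : form_tuple S).
Hypotheses (BN : normalized B) (S_irr : irreducible_system S).
Variable (Bh : form_tuple (twin S)).
Hypotheses (Bh_twin : twin_forms Bh) (S_neq : ~ equivalent_systems S (twin S)).

(** The Fredholm alternative with [beta] = 0, mixed fixed forms being zero. *)
Lemma mixed_decomposition (T : form_family (twin S) S) : sesq_family T ->
  exists2 W : form_family (twin S) S, sesq_family W &
    forall a u v, T a u v = W a u v - pull W u v.
Proof.
move=> hT; have [P /frame_of_fixed hP] := exists_frame_of Bh_twin.
have hBh := twin_normalized Bh_twin.
have [|||l [W hW TE]] := @fredholm _ _ (twin S) S (fun _ _ _ => 0) _ _ _ T hT.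
- by move=> a; split=> *; rewrite mulr0 addr0.
- move=> T' hT' fixT; exists 0 => a u v; rewrite mulr0.
  exact: (mixed_fixed_form S_irr S_neq (hP Bh_twin) hBh hT' fixT).
- by [].
by exists W => // a u v; rewrite TE mulr0 add0r.
Qed.

Variables (P q : frames S).
Hypotheses (hP : frame_of Bh P)
  (hq : forall a v, v = \sum_(p <- q a) sesq (B a) v p *: p).

Lemma k0_pairing : k0 B Bh = pairing P (fun a => sesq (B a)).
Proof.
rewrite /k0 /pairing [RHS]sum_linv; apply: eq_bigr => c _.
apply: (lfun_tr_rank1s (phi := fun p v => sesq (B (linv c)) v p)).
  by move=> p l u v; rewrite sesqDl sesqZl.
by move=> v; rewrite comp_lfunE -hatBV_linv hP.2.
Qed.

(** With [k0_pairing], this gives one normalizing constant for both [S] and its twin, the source of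
    the square of k_0 in the final formula. *)
Lemma k0_twin_pairing :
  k0 B Bh = pairing (twin_frame B q) (fun a => sesq (Bh a)).
Proof.
rewrite /k0 /pairing; apply: eq_bigr => c _; rewrite big_map.
rewrite (lfun_tr_rank1s (s := q (linv c)) (y := fun p => hatB Bh c (B (linv c) p))
           (phi := fun p v => sesq (B (linv c)) v p)).
- apply: eq_bigr => p _; rewrite -(posdef_herm (BN.1 _)) {1}/sesq hatBE conjCK.
  by [].
- by move=> p l u v; rewrite sesqDl sesqZl.
move=> v; rewrite comp_lfunE {1}(hq v) !linear_sum.
by apply: eq_bigr => p _; rewrite !linearZ.
Qed.

Lemma k0_gt0 : 0 < k0 B Bh.
Proof.
have Bge a v : 0 <= sesq (B a) v v by exact/posdef_ge0/BN.1.
rewrite k0_pairing lt_neqAle pairing_ge0// andbT eq_sym; apply/eqP => p0.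
have [[a /eqP Va] _] := S_irr; apply: Va; apply/eqP; rewrite -subv0 -(hP.1 a).
apply/span_subvP => p pP; rewrite memv0; apply/eqP.
by apply: (posdef_eq0 (BN.1 a)); exact: (pairing_eq0 Bge p0 pP).
Qed.

Variable Q : forall b, 'Hom(msV S b, msV (twin S) b).
Hypothesis Q_def : is_Q B Bh Q.

(** E_0 is the mean, against the fixed tensor of [S], of the squared norm of the defect; in
    particular it is nonnegative. *)
Lemma E0_pairing : E0 B Bh Q =
  pairing P (fun b u v =>
    \sum_a sesq (Bh a) (defectQ B Q a b u) (defectQ B Q a b v)).
Proof.
rewrite /E0 /pairing exchange_big; apply: eq_bigr => b _ /=.
rewrite exchange_big; apply: eq_bigr => a _ /=.
apply: (lfun_tr_rank1s
  (phi := fun p (F : adual (msV (twin S) a)) =>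
     (F : 'Hom(conjv _, C^o)) (defectQ B Q a b p))).
  by move=> p l F G; rewrite add_lfunE scale_lfunE.
move=> F; rewrite !comp_lfunE hP.2 !linear_sum; apply: eq_bigr => p _.
by rewrite !linearZ /= adjointE.
Qed.

Lemma E0_ge0 : 0 <= E0 B Bh Q.
Proof.
rewrite E0_pairing; apply: pairing_ge0 => b v; apply: sumr_ge0 => a _.
exact/posdef_ge0/Bh_twin.1.
Qed.

(** By [hatBV_fixed], the right side Q_a hatB_a of the equation defining [Q] is the sum over b of
    Q_a H_ab hatB_b H_ab^*. The equation then says that D_ab hatB_b H_ab^* sums to zero. *)
Lemma defectQ_orthogonal a (W : msV (twin S) a -> msV S a -> C) :
  sesquilin W ->
  \sum_b \sum_(p <- P b) W (defectQ B Q a b p) (msH S a b p) = 0.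
Proof.
move=> hW; rewrite (eq_dsum_sesquilin (s := [::] : seq unit) hW
  (x := fun b p => defectQ B Q a b p) (y := fun b p => msH S a b p)
  (x' := fun _ => 0) (y' := fun _ => 0)); first by rewrite big_nil.
move=> f; rewrite big_nil.
transitivity (\sum_b defectQ B Q a b (hatBV Bh b (adjoint (msH S a b) f))).
  apply: eq_bigr => b _; rewrite hP.2 linear_sum; apply: eq_bigr => p _.
  by rewrite linearZ /= adjointE.
have := congr1 (fun g : 'Hom(_, _) => g f) (Q_def a).
rewrite sum_lfunE comp_lfunE -(hatBV_fixed Bh_twin) linear_sum.
move=> /eqP; rewrite -subr_eq0 -sumrB => /eqP sum0.
rewrite -[RHS]sum0; apply: eq_bigr => b _.
by rewrite /defectQ !(add_lfunE, opp_lfunE, comp_lfunE).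
Qed.

End Twin.
End Decomposition.

(** * Matrix coefficients as sums over words *)

Section Words.
Variable k : nat.
Implicit Types (a b c d : letter k) (s w X : seq (letter k)).

(** The words [s] of length [n] such that [d :: s] is reduced. *)
Fixpoint words n d : seq (seq (letter k)) :=
  if n is n'.+1 then
    [seq c :: s | c <- [seq c <- index_enum (letter k) | c != linv d], s <- words n' c]
  else [:: [::]].

Definition reduced_words n : seq (seq (letter k)) :=
  if n is n'.+1 then [seq c :: s | c <- index_enum (letter k), s <- words n' c]
  else [:: [::]].

Lemma reduced_cons d s : reduced (d :: s) = path (fun a b => b != linv a) d s.
Proof. by []. Qed.

Lemma mem_words n d s : (s \in words n d) = (size s == n) && reduced (d :: s).
Proof.
elim: n d s => [|n IH] d [|c s]; rewrite ?inE//.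
  by apply/negbTE/allpairsPdep => -[c [s [_ _]]].
apply/allpairsPdep/idP => [[e [r [+ + [-> ->]]]]|/= /andP[sn /andP[cd cs]]].
  by rewrite mem_filter -/(words n e) IH eqSS reduced_cons /= => /andP[-> _] /andP[-> ->].
by exists c, s; rewrite mem_filter cd mem_index_enum IH; split=> //; apply/andP.
Qed.

Lemma mem_reduced_words n w : (w \in reduced_words n) = (size w == n) && reduced w.
Proof.
case: n w => [|n] [|c s]; rewrite ?inE//.
  by apply/negbTE/allpairsPdep => -[c [s [_ _]]].
apply/allpairsPdep/idP => [[e [r [_ + [-> ->]]]]|h].
  by rewrite mem_words.
by exists c, s; rewrite mem_index_enum mem_words; split.
Qed.

Lemma words_uniq n d : uniq (words n d).
Proof.
elim: n d => //= n IH d; apply: allpairs_uniq_dep => //.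
  by rewrite filter_uniq// index_enum_uniq.
by move=> [? ?] [? ?] _ _ /= [-> ->].
Qed.

Lemma reduced_words_uniq n : uniq (reduced_words n).
Proof.
case: n => //= n; apply: allpairs_uniq_dep => [|c _|].
- exact: index_enum_uniq.
- exact: words_uniq.
by move=> [? ?] [? ?] _ _ /= [-> ->].
Qed.

Lemma big_words (V : nmodType) n d (F : seq (letter k) -> V) :
  \sum_(s <- words n.+1 d) F s =
  \sum_(c | c != linv d) \sum_(s <- words n c) F (c :: s).
Proof. by rewrite big_allpairs_dep /= big_filter. Qed.

Lemma big_reduced_words (V : nmodType) n (F : seq (letter k) -> V) :
  \sum_(w <- reduced_words n.+1) F w = \sum_c \sum_(s <- words n c) F (c :: s).
Proof. by rewrite big_allpairs_dep. Qed.

(** [words] grows at the front, whereas the inner product extends words on the right. *)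
Lemma big_words_rcons (V : nmodType) n d (F : seq (letter k) -> V) :
  \sum_(s <- words n d) \sum_(a | a != linv (last d s)) F (rcons s a) =
  \sum_(s <- words n.+1 d) F s.
Proof.
elim: n d F => [|n IH] d F; rewrite [RHS]big_words.
  by rewrite /= big_seq1; apply: eq_bigr => c _; rewrite big_seq1.
rewrite [LHS]big_words; apply: eq_bigr => c _ /=.
exact: (IH c (fun s => F (c :: s))).
Qed.

Lemma big_reduced_words_winv (V : nmodType) n (F : seq (letter k) -> V) :
  \sum_(w <- reduced_words n) F (winv w) = \sum_(w <- reduced_words n) F w.
Proof.
rewrite -(big_map (@winv k) xpredT F); apply: perm_big.
apply: uniq_perm; rewrite ?map_inj_uniq ?reduced_words_uniq//.
  exact: (can_inj (@winvK k)).
have winv_size w : size (winv w) = size w by rewrite /winv size_rev size_map.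
move=> w; apply/mapP/idP => [[v + ->]|]; rewrite !mem_reduced_words.
  by move=> /andP[vn vr]; rewrite winv_size vn reduced_winv.
move=> /andP[wn wr]; exists (winv w); last by rewrite winvK.
by rewrite mem_reduced_words winv_size wn reduced_winv.
Qed.

Lemma big_sphere (V : nmodType) n (F : seq (letter k) -> V) :
  \sum_(x <- finmap.enum_fset (fset_set [set x : freegroup k | wlen x = n]%classic))
     F (word x) = \sum_(w <- reduced_words n) F w.
Proof.
rewrite -(big_map (@word k) xpredT F); apply: perm_big.
apply: uniq_perm; rewrite ?map_inj_uniq ?fset_uniq ?reduced_words_uniq//.
  exact: val_inj.
have memx (x : freegroup k) : (x \in finmap.enum_fset
    (fset_set [set x : freegroup k | wlen x = n]%classic)) = (wlen x == n).
  rewrite -[LHS]/(x \in fset_set _) in_fset_set; last exact: finite_sphere.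
  by apply/idP/eqP; rewrite inE.
move=> w; rewrite mem_reduced_words; apply/mapP/idP => [[x + ->]|/andP[wn wr]].
  by rewrite memx word_reduced andbT.
by exists (FreeGroup wr) => //; rewrite memx.
Qed.

Lemma wmul_cat u w : reduced (u ++ w) -> wmul u w = u ++ w.
Proof.
elim: u => //= a u IH raw; rewrite IH; last exact: (reduced_behead raw).
by case: (u ++ w) raw => //= b v /andP[/negPf ->].
Qed.

Lemma wmul_winv_cancel c X s : wmul (winv (c :: X)) (c :: s) = wmul (winv X) s.
Proof. by rewrite /winv map_cons rev_cons /wmul foldr_rcons /= linvK eqxx. Qed.

Lemma wmul_winv_cat c e X s : reduced (c :: X) -> reduced (e :: s) -> e != c ->
  wmul (winv (c :: X)) (e :: s) = winv (c :: X) ++ e :: s.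
Proof.
move=> rX rs ec; apply: wmul_cat.
have := reduced_winv rX; rewrite /winv map_cons rev_cons.
case: (rev _) => [|h r] /=; first by rewrite linvK ec.
rewrite /reduced /= => rr; rewrite cat_path rr last_rcons /= linvK ec.
exact: rs.
Qed.

Lemma wlen_mulgen_rcons (x : freegroup k) c s a : word x = c :: s ->
  (wlen (x * gen a)%g == (wlen x).+1) = (a != linv (last c s)).
Proof.
move=> xE; apply/eqP/idP => [/word_mulgenS e|al].
  have := word_reduced (x * gen a)%g; rewrite e xE rcons_cons reduced_cons.
  by rewrite rcons_path => /andP[].
case: (word_mulgen x a) => [e|]; first by rewrite /wlen e size_rcons.
rewrite xE => /(congr1 (last c)); rewrite last_rcons /= => e.
by rewrite e linvK eqxx in al.
Qed.

End Words.

Arguments reduced_words {k} n.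

(** * Evaluation of the inner product *)

Section Coefficient.
Variables (k : nat) (C : numClosedFieldType) (S : matrix_system k C).
Variables (B : form_tuple S) (BN : normalized B).
Implicit Types (a b c d : letter k) (s w X : seq (letter k)).

Local Notation tvec := {c : letter k & msV S c}.

Definition tsesq c (u v : tvec) : C := sesq (B c) (component c u) (component c v).

(** [mu] at the identity, as a function of reduced words. *)
Definition muw a (v : msV S a) w : tvec :=
  if w is c :: s then
    if c == a then transport v s else Tagged (msV S) (0 : msV S (last c s))
  else Tagged (msV S) (0 : msV S a).

Lemma muE a (v : msV S a) x : mu 1%g v x = muw v (word x).
Proof. by rewrite /mu invg1 mul1g. Qed.

Lemma transport0 d s : transport (0 : msV S d) s = Tagged (msV S) (0 : msV S (last d s)).
Proof. by elim: s d => //= c s IH d; rewrite linear0 IH. Qed.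

Lemma component0 c d : component c (Tagged (msV S) (0 : msV S d)) = 0.
Proof.
rewrite /component /untag; case: eqP => // e.
by case: _ / e.
Qed.

Lemma component_neq c d (v : msV S d) : d != c -> component c (Tagged (msV S) v) = 0.
Proof. by rewrite /component /untag /=; case: eqP. Qed.

(** Normalization of [B] telescopes along the levels of the cone; the excluded backtracking letter
    contributes zero because its [H] vanishes. *)
Lemma cone_sum n d (t r : msV S d) :
  \sum_(s <- words n d) tsesq (last d s) (transport t s) (transport r s) =
  sesq (B d) t r.
Proof.
elim: n d t r => [|n IH] d t r; first by rewrite /= big_seq1 /tsesq !componentE.
rewrite big_words (normalized_sesq _ _ BN) [RHS](bigID (fun c => c != linv d)) /=.
rewrite [X in _ + X]big1 ?addr0 => [|c]; first by apply: eq_bigr => c _; exact: IH.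
rewrite negbK => /eqP ->; rewrite msH0.
  by rewrite zero_lfunE (sesquilin0l (sesquilin_sesq _)).
by apply/eqP; rewrite gen_mul_eq1 linvK.
Qed.

Variables (b : letter k) (vb : msV S b).

(** The vector carried by [mu[x, xb, vb]] along the inverse of the word
    [c :: X] of [x]; it is zero unless that word ends with [b^-1]. *)
Fixpoint back X c : msV S (linv c) :=
  if X is d :: X' then msH S (linv c) (linv d) (back X' d)
  else component (linv c) (Tagged (msV S) vb).

Lemma muw_back c X s :
  muw vb (winv (c :: X) ++ s) = transport (back X c) s.
Proof.
elim: X c s => [|d X IH] c s /=.
  case: eqP => [cb|cb].
    by case: _ / cb (vb) => v /=; rewrite componentE.
  by rewrite component_neq ?transport0// eq_sym; apply/eqP.
have -> : winv [:: c, d & X] ++ s = winv (d :: X) ++ linv c :: s.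
  by rewrite {1}/winv map_cons rev_cons cat_rcons.
by rewrite IH.
Qed.

(** The matrix coefficient at the word [a :: X], as a function of the state [t]
    reached from [va] at the letter [d] preceding [X]. *)
Fixpoint coef X d (t : msV S d) : C :=
  if X is c :: X' then
    coef X' (msH S c d t) +
      ((Emap B c d t : adual (msV S (linv c))) : 'Hom(conjv _, C^o)) (back X' c)
  else sesq (B b) (msH S b d t) vb.

(** If s and [X] share their first letter, it cancels and the recursion continues. Otherwise nothing
    cancels, [cone_sum] collapses the cone of each other letter, and together these cones give the
    [Emap] term. *)
Lemma coef_sum n X d (t : msV S d) : (size X < n)%N -> reduced (d :: X) ->
  \sum_(s <- words n d)
    tsesq (last d s) (transport t s) (muw vb (wmul (winv X) s)) = coef X t.
Proof.
elim: X n d t => [|c X IH] [//|n] d t Xn rX; rewrite big_words /=.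
  have term c : \sum_(s <- words n c)
      tsesq (last c s) (transport (msH S c d t) s)
        (if c == b then transport vb s else Tagged (msV S) (0 : msV S (last c s))) =
      if c == b then sesq (B b) (msH S b d t) vb else 0.
    case: eqP => [->|_]; first exact: cone_sum.
    by rewrite big1// => s _; rewrite /tsesq component0 /sesq linear0.
  rewrite (eq_bigr _ (fun c _ => term c)) -big_mkcondr /=.
  have [bd|bd] := eqVneq b (linv d).
    rewrite big1 => [|c _]; last first.
      rewrite msH0 ?zero_lfunE ?(sesquilin0l (sesquilin_sesq _))//.
      by apply/eqP; rewrite gen_mul_eq1 bd linvK.
    rewrite msH0 ?zero_lfunE ?(sesquilin0l (sesquilin_sesq _))//.
    by apply/eqP; rewrite gen_mul_eq1 bd linvK.
  rewrite (big_pred1 b)// => c /=.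
  by case: (c =P b) => [->|_]; rewrite ?andbF ?bd.
have [cd cX] : c != linv d /\ reduced (c :: X) by move: rX => /= /andP[].
rewrite (bigD1 c)//=; congr (_ + _).
  under eq_bigr do rewrite wmul_winv_cancel.
  exact: IH.
rewrite /Emap gen_mul_eq1 ifN; last by apply: contraNN cd => /eqP ->; rewrite linvK.
rewrite !sum_lfunE (eq_bigl _ _ (fun e => andbC _ _)).
apply: eq_bigr => e /andP[ec ed].
rewrite !comp_lfunE adjointE -[RHS]/(sesq _ _ _) -(cone_sum n).
rewrite big_seq [RHS]big_seq; apply: eq_bigr => s; rewrite mem_words => /andP[_ rs].
by rewrite wmul_winv_cat// muw_back.
Qed.

Variables (a : letter k) (va : msV S a).

(** When the word starts with a letter other than [a], nothing cancels on the cone of [a], which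
    collapses to a single product at its apex. *)
Definition coefw X : C :=
  match X with
  | [::] => sesq (B a) va (component a (Tagged (msV S) vb))
  | c :: X' => if c == a then coef X' va
               else sesq (B a) va (msH S a (linv c) (back X' c))
  end.

Lemma coefw_sum n X : (size X < n)%N -> reduced X ->
  \sum_(w <- reduced_words n.+1)
    tsesq (last a w) (muw va w) (muw vb (wmul (winv X) w)) = coefw X.
Proof.
move=> Xn rX; rewrite big_reduced_words (bigD1 a)//= [X in _ + X]big1 ?addr0.
  rewrite eqxx; case: X Xn rX => [|c X] Xn rX /=.
    case: eqP => [ab|ab].
      by case: _ / ab (vb) => v; rewrite componentE cone_sum.
    rewrite component_neq; last by rewrite eq_sym; apply/eqP.
    rewrite (sesquilin0r (sesquilin_sesq _)) big1// => s _.
    by rewrite /tsesq component0 (sesquilin0r (sesquilin_sesq _)).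
  case: eqP => [ca|/eqP ca].
    subst c; under eq_bigr do rewrite wmul_winv_cancel.
    by apply: coef_sum => //; exact: ltnW.
  rewrite -(cone_sum n) big_seq [RHS]big_seq; apply: eq_bigr => s.
  rewrite mem_words => /andP[_ rs].
  by rewrite wmul_winv_cat 1?eq_sym// muw_back.
move=> c /negPf ca; rewrite big1// => s _; rewrite ca /tsesq component0.
exact: (sesquilin0l (sesquilin_sesq _)).
Qed.

Lemma innerE_coefw (x : freegroup k) :
  inner B (mu 1%g va) (piact x (mu 1%g vb)) = coefw (word x).
Proof.
have piactE y : piact x (mu 1%g vb) y = muw vb (wmul (winv (word x)) (word y)).
  by rewrite /piact muE word_mul.
have pm : multfun (piact x (mu 1%g vb)).
  have -> : piact x (mu 1%g vb) = mu x vb; last exact: mu_multfun.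
  by apply/funext => y; rewrite /piact /mu invg1 mul1g.
have [N NP] := innerE BN (mu_multfun 1%g va) pm.
(* Radius n + 1 is past stabilization, exceeds the length of x so that [coefw_sum] applies, and
   makes the words on the sphere nonempty, so that they have a last letter. *)
pose n := maxn N (size (word x)).
rewrite -(NP n.+1); last by rewrite ltnW// ltnS leq_maxl.
rewrite sphere_productE -(@coefw_sum n.+1 (word x)); last 2 first.
- by rewrite ltnS leq_maxr.
- exact: word_reduced.
rewrite big_reduced_words.
under [RHS]eq_bigr => c _ do rewrite -big_words_rcons.
rewrite -(big_reduced_words n (fun w => \sum_(d | d != linv (last a w))
  tsesq (last a (rcons w d)) (muw va (rcons w d))
    (muw vb (wmul (winv (word x)) (rcons w d))))) -big_sphere.
rewrite big_seq [RHS]big_seq; apply: eq_bigr => y yn.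
have {yn} yn : wlen y = n.+1.
  move: yn; rewrite -[_ \in _]/(y \in fset_set _) in_fset_set; last exact: finite_sphere.
  by rewrite inE.
have [c [s ys]] : exists c s, word y = c :: s.
  by move: yn; rewrite /wlen; case: (word y) => // c s _; exists c, s.
apply: eq_big => [d|d /eqP yd]; first by rewrite -yn (wlen_mulgen_rcons d ys) ys.
rewrite muE piactE (word_mulgenS (_ : _ = (wlen y).+1)); last by rewrite yn.
by rewrite /tsesq last_rcons.
Qed.

End Coefficient.

Local Open Scope classical_set_scope.

(** * Abel sums *)

Section AbelSums.
Variable R : realType.
Implicit Types (f g h : nat -> R) (z : R) (m : R -> R).

Definition abel z N f : R := \sum_(0 <= n < N) z ^+ n * f n.

(** [abelO p f m]: the Abel sums of [f] are [m z + O((1 - z)^-p)] as [z]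
    increases to 1; the bound is on partial sums, whose length may depend
    on [z], so that convergence need not be discussed. *)
Definition abelO p f m : Prop :=
  exists K : R, forall z, 2^-1 <= z -> z < 1 ->
    \forall N \near \oo, `|abel z N f - m z| <= K / (1 - z) ^+ p.

(** Controls the boundary term of summation by parts. *)
Definition abel_tail f : Prop :=
  exists K : R, forall z, 2^-1 <= z -> z < 1 ->
    \forall N \near \oo, `|z ^+ N * f N| <= K.

Lemma abelD z N f g c :
  abel z N (fun n => c * f n + g n) = c * abel z N f + abel z N g.
Proof.
rewrite /abel mulr_sumr -big_split; apply: eq_bigr => n _ /=.
by rewrite mulrDr mulrCA.
Qed.

Lemma abel_shift z N f :
  z * abel z N (fun n => f n.+1) = abel z N f - f 0%N + z ^+ N * f N.
Proof.
elim: N => [|N IH]; first by rewrite /abel !big_nil expr0; ring.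
have E (g : nat -> R) : abel z N.+1 g = abel z N g + z ^+ N * g N.
  by rewrite /abel big_nat_recr.
by rewrite !E mulrDr IH exprS; ring.
Qed.

Lemma abel_le z N f g : 0 <= z -> (forall n, f n <= g n) -> abel z N f <= abel z N g.
Proof. by move=> z0 fg; apply: ler_sum => n _; rewrite ler_wpM2l// exprn_ge0. Qed.

Lemma abel_ge0 z N f : 0 <= z -> (forall n, 0 <= f n) -> 0 <= abel z N f.
Proof. by move=> z0 f0; apply: sumr_ge0 => n _; rewrite mulr_ge0// exprn_ge0. Qed.

Lemma abel_cst z N (c : R) : (1 - z) * abel z N (fun=> c) = c * (1 - z ^+ N).
Proof.
have := abel_shift z N (fun=> c); rewrite mulrBl mul1r => ->; ring.
Qed.

Lemma abelO_ext p f f' m m' :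
  (forall n, f n = f' n) -> (forall z, 2^-1 <= z -> z < 1 -> m z = m' z) ->
  abelO p f m -> abelO p f' m'.
Proof.
move=> ff mm [K hK]; exists K => z z2 z1; rewrite -mm//.
have -> : f' = f by apply/funext => n.
exact: hK.
Qed.

Lemma div_pow_le z p q (K : R) : 0 < z < 1 -> 0 <= K -> (p <= q)%N ->
  K / (1 - z) ^+ p <= K / (1 - z) ^+ q.
Proof.
move=> /andP[z0 z1] K0 pq; rewrite ler_wpM2l// lef_pV2 ?posrE ?exprn_gt0 ?subr_gt0//.
by rewrite ler_wiXn2l//; lra.
Qed.

Lemma ge_half_gt0 z : 2^-1 <= z -> 0 < z.
Proof. lra. Qed.

Lemma abelO_nneg p f m : abelO p f m -> exists2 K : R, 0 <= K &
  forall z, 2^-1 <= z -> z < 1 ->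
    \forall N \near \oo, `|abel z N f - m z| <= K / (1 - z) ^+ p.
Proof.
move=> [K hK]; exists `|K| => // z z2 z1.
near=> N; apply: le_trans (_ : K / (1 - z) ^+ p <= _).
  by near: N; exact: hK.
by rewrite ler_wpM2r ?ler_norm// invr_ge0 exprn_ge0//; lra.
Unshelve. all: end_near. Qed.

Lemma abelO_weaken p q f m : (p <= q)%N -> abelO p f m -> abelO q f m.
Proof.
move=> pq /abelO_nneg[K K0 hK]; exists K => z z2 z1.
near=> N; apply: le_trans (div_pow_le _ K0 pq).
  by near: N; exact: hK.
by rewrite ge_half_gt0.
Unshelve. all: end_near. Qed.

Lemma abelO_lin p f g m m' c : abelO p f m -> abelO p g m' ->
  abelO p (fun n => c * f n + g n) (fun z => c * m z + m' z).
Proof.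
move=> [K hK] [K' hK']; exists (`|c| * K + K') => z z2 z1.
near=> N.
have h : `|abel z N f - m z| <= K / (1 - z) ^+ p by near: N; exact: hK.
have h' : `|abel z N g - m' z| <= K' / (1 - z) ^+ p by near: N; exact: hK'.
rewrite abelD.
have -> : c * abel z N f + abel z N g - (c * m z + m' z) =
  c * (abel z N f - m z) + (abel z N g - m' z) by ring.
apply: le_trans (ler_normD _ _) _; rewrite normrM mulrDl lerD// -mulrA.
by rewrite ler_wpM2l.
Unshelve. all: end_near. Qed.

Lemma abelO_dominated p f g c : (forall n, `|f n| <= c * g n) ->
  abelO p g (fun=> 0) -> abelO p f (fun=> 0).
Proof.
move=> fg [K hK]; exists (`|c| * K) => z z2 z1; near=> N.
have h : `|abel z N g - 0| <= K / (1 - z) ^+ p by near: N; exact: hK.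
have z0 := ge_half_gt0 z2; rewrite !subr0 in h *.
have fc : `|abel z N f| <= c * abel z N g.
  apply: le_trans (ler_norm_sum _ _ _) _; rewrite /abel mulr_sumr.
  apply: ler_sum => n _; rewrite normrM ger0_norm ?exprn_ge0 ?(ltW z0)// mulrCA.
  by rewrite ler_wpM2l// exprn_ge0// ltW.
apply: le_trans fc _; apply: le_trans (ler_norm _) _.
by rewrite normrM -mulrA ler_wpM2l.
Unshelve. all: end_near. Qed.

Lemma abel_tail_dominated f g c : (forall n, `|f n| <= c * g n) ->
  abel_tail g -> abel_tail f.
Proof.
move=> fg [K hK]; exists (`|c| * K) => z z2 z1; near=> N.
have h : `|z ^+ N * g N| <= K by near: N; exact: hK.
have z0 := ge_half_gt0 z2.
rewrite normrM; apply: le_trans (_ : `|z ^+ N| * (c * g N) <= _).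
  by rewrite ler_wpM2l.
rewrite mulrCA ger0_norm ?exprn_ge0 ?(ltW z0)//; apply: le_trans (ler_norm _) _.
by rewrite normrM ler_wpM2l.
Unshelve. all: end_near. Qed.

Lemma near_pow_le z (e : R) : 0 <= z < 1 -> 0 < e -> \forall N \near \oo, z ^+ N <= e.
Proof.
move=> /andP[z0 z1] e0.
have /(cvgr0_norm_le _)/(_ _ e0) : (fun n => z ^+ n : R^o) @ \oo --> (0 : R^o).
  by apply: cvg_expr; rewrite ger0_norm.
by apply: filterS => N; rewrite ger0_norm ?exprn_ge0.
Qed.

Lemma abelO_cst c : abelO 0 (fun=> c) (fun z => c / (1 - z)).
Proof.
exists `|c| => z z2 z1; have z0 := ge_half_gt0 z2; near=> N.
have zN : z ^+ N <= 1 - z by near: N; apply: near_pow_le; lra.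
have zN0 : 0 <= z ^+ N by rewrite exprn_ge0 ?ltW.
have d0 : 1 - z != 0 by lra.
rewrite expr0 divr1.
have -> : abel z N (fun=> c) - c / (1 - z) = - (c * (z ^+ N / (1 - z))).
  apply: (mulfI d0); rewrite mulrBr abel_cst; field; exact: d0.
rewrite normrN normrM ler_piMr// ger0_norm ?divr_ge0//; last by lra.
by rewrite ler_pdivrMr ?mul1r//; lra.
Unshelve. all: end_near. Qed.

Lemma abelO_simple_pole f (c : R) :
  abelO 0 f (fun z => c / (1 - z)) -> abelO 1 f (fun=> 0).
Proof.
move=> [K hK]; exists (`|K| + `|c|) => z z2 z1; near=> N.
have : `|abel z N f - c / (1 - z)| <= K / (1 - z) ^+ 0 by near: N; exact: hK.
rewrite expr0 divr1 expr1 subr0 => h.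
have d0 : 0 < 1 - z by lra.
have z0 := ge_half_gt0 z2.
rewrite -[abel _ _ _](subrK (c / (1 - z))).
apply: le_trans (ler_normD _ _) _; rewrite mulrDl lerD//.
  apply: le_trans h _; apply: le_trans (ler_norm _) _.
  by rewrite ler_pdivlMr// ler_piMr//; lra.
by rewrite normrM (ger0_norm (_ : 0 <= (1 - z)^-1))// invr_ge0 ltW.
Unshelve. all: end_near. Qed.

Lemma abelO_cst1 c : abelO 1 (fun=> c) (fun=> 0).
Proof. exact: abelO_simple_pole (abelO_cst c). Qed.

Lemma abel_tail_cst c : abel_tail (fun=> c).
Proof.
exists `|c| => z z2 z1; near=> N; have z0 := ge_half_gt0 z2.
rewrite normrM ler_piMl// ger0_norm ?exprn_ge0 ?(ltW z0)//.
by rewrite exprn_ile1// ltW.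
Unshelve. all: end_near. Qed.

(** Summation by parts multiplies the Abel sum of [h] by 1 - z, which gains one power; the factor 2
    pays for the division by z. *)
Lemma abelO_coboundary p h : abelO p.+1 h (fun=> 0) -> abel_tail h ->
  abelO p (fun n => h n - h n.+1) (fun=> 0).
Proof.
move=> /abelO_nneg[K K0 hK] [K' hK'].
exists (2 * (K + `|h 0%N| + `|K'|)) => z z2 z1.
have z0 := ge_half_gt0 z2; have d0 : 0 < 1 - z by lra.
near=> N.
have bA : `|abel z N h - 0| <= K / (1 - z) ^+ p.+1 by near: N; exact: hK.
have bT : `|z ^+ N * h N| <= K' by near: N; exact: hK'.
rewrite !subr0 in bA *.
have E : z * abel z N (fun n => h n - h n.+1) =
    h 0%N - (1 - z) * abel z N h - z ^+ N * h N.
  have -> : abel z N (fun n => h n - h n.+1) =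
      (-1) * abel z N (fun n => h n.+1) + abel z N h.
    by rewrite -abelD; apply: eq_bigr => n _; congr (_ * _); ring.
  by rewrite mulrDr mulrCA abel_shift; ring.
have bz : `|z * abel z N (fun n => h n - h n.+1)| <=
    (K + `|h 0%N| + `|K'|) / (1 - z) ^+ p.
  have one_le : 1 <= ((1 - z) ^+ p)^-1.
    by rewrite invf_ge1 ?exprn_gt0// exprn_ile1//; lra.
  rewrite E; apply: le_trans (ler_normB _ _) _.
  apply: le_trans (lerD (ler_normB _ _) (le_refl _)) _.
  rewrite [leRHS]mulrDl [X in _ <= X + _]mulrDl; apply: lerD; last first.
    apply: le_trans bT _; apply: le_trans (ler_norm _) _.
    by rewrite ler_peMr.
  rewrite addrC; apply: lerD; last by rewrite ler_peMr.
  rewrite normrM (ger0_norm (ltW d0)); apply: le_trans (ler_wpM2l (ltW d0) bA) _.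
  by rewrite exprS invfM mulrCA mulVKf ?gt_eqF.
rewrite normrM (ger0_norm (ltW z0)) in bz.
rewrite -mulrA; apply: le_trans (ler_wpM2l _ bz); last by [].
by rewrite mulrA ler_peMl//; lra.
Unshelve. all: end_near. Qed.

(** The Abel sums of [X] and [y] are related by
    [(1 - z) A(X) = X 0 + z A(y)], up to a tail. *)
Lemma abelO_increment X y (m : R) : abel_tail X ->
  (forall n, X n.+1 = X n + y n) ->
  abelO 0 y (fun z => m / (1 - z)) -> abelO 1 X (fun z => m / (1 - z) ^+ 2).
Proof.
move=> [K' hK'] XS /abelO_nneg[K K0 hK].
exists (K + `|X 0%N| + `|K'| + `|m|) => z z2 z1.
have z0 := ge_half_gt0 z2; have d0 : 0 < 1 - z by lra.
near=> N.
have bY : `|abel z N y - m / (1 - z)| <= K / (1 - z) ^+ 0 by near: N; exact: hK.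
have bT : `|z ^+ N * X N| <= K' by near: N; exact: hK'.
rewrite expr0 divr1 in bY.
have E : (1 - z) * (abel z N X - m / (1 - z) ^+ 2) =
    X 0%N - z ^+ N * X N + z * (abel z N y - m / (1 - z)) - m.
  have : z * abel z N (fun n => X n.+1) = z * abel z N X + z * abel z N y.
    rewrite -mulrDr; congr (_ * _); rewrite -[abel z N X]mul1r -abelD.
    by apply: eq_bigr => n _; rewrite XS mul1r.
  rewrite abel_shift => e.
  have -> : (1 - z) * (abel z N X - m / (1 - z) ^+ 2) =
      abel z N X - z * abel z N X - m / (1 - z) by field; lra.
  have -> : abel z N X - z * abel z N X = X 0%N - z ^+ N * X N + z * abel z N y.
    by lra.
  by field; lra.
rewrite expr1 ler_pdivlMr// mulrC.
have -> : (1 - z) * `|abel z N X - m / (1 - z) ^+ 2| =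
    `|(1 - z) * (abel z N X - m / (1 - z) ^+ 2)| by rewrite normrM (ger0_norm (ltW d0)).
rewrite E.
apply: le_trans (ler_normB _ _) _; rewrite lerD2r.
apply: le_trans (ler_normD _ _) _.
have bz : `|z * (abel z N y - m / (1 - z))| <= K.
  rewrite normrM (ger0_norm (ltW z0)); apply: le_trans bY.
  by rewrite ler_piMl// ltW.
have := ler_normB (X 0%N) (z ^+ N * X N); have := ler_norm K'.
by lra.
Unshelve. all: end_near. Qed.

Lemma crude_abel (s : nat -> R) (c : R) : (forall n, 0 <= s n) -> 0 <= c ->
  (forall (d : R) n, 0 < d -> s n.+1 <= (1 + d) * s n + (1 + d^-1) * c) ->
  abelO 3 s (fun=> 0) /\ abel_tail s.
Proof.
move=> s0 c0 hs.
have bound z N : 2^-1 <= z -> z < 1 ->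
    abel z N s <= (2 * s 0%N + 6 * c) / (1 - z) ^+ 3.
  move=> z2 z1; have z0 := ge_half_gt0 z2; have d0 : 0 < 1 - z by lra.
  (* With this weight z (1 + d) <= 1 - (1 - z) / 2, so the growth is absorbed at the cost of one
     power of 1 / (1 - z); the constant term, with its d^-1, costs two more. *)
  pose d := (1 - z) / 2; have dp : 0 < d by rewrite /d; lra.
  have A0 : 0 <= abel z N s by rewrite abel_ge0// ltW.
  have le1 : z * abel z N (fun n => s n.+1) <=
      z * ((1 + d) * abel z N s + abel z N (fun=> (1 + d^-1) * c)).
    rewrite ler_wpM2l ?(ltW z0)// -abelD; apply: abel_le; first exact: ltW.
    by move=> n; exact: hs.
  have cst : (1 - z) * abel z N (fun=> (1 + d^-1) * c) <= (1 + d^-1) * c.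
    rewrite abel_cst ler_piMr// ?mulr_ge0//.
      by rewrite addr_ge0// invr_ge0 ltW.
    by rewrite lerBlDr lerDl exprn_ge0// ltW.
  have zN : 0 <= z ^+ N * s N by rewrite mulr_ge0// exprn_ge0// ltW.
  rewrite abel_shift in le1.
  have dinv : d^-1 * (1 - z) = 2 by rewrite /d; field; lra.
  set A := abel z N s in le1 A0 *; set Z := abel z N _ in le1 cst.
  have Z0 : 0 <= Z.
    by apply: abel_ge0 => [|n]; rewrite ?mulr_ge0 ?addr_ge0 ?invr_ge0 ?(ltW z0) ?(ltW dp).
  have h1 : A * (1 - z) / 2 <= s 0%N + Z.
    have : z * (1 + d) * A <= (1 - (1 - z) / 2) * A.
      by rewrite ler_wpM2r// /d; nra.
    have : z * Z <= Z by rewrite ler_piMl// ltW.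
    lra.
  have h2 : Z * (1 - z) ^+ 2 <= 3 * c.
    have : (1 - z) * ((1 - z) * Z) <= (1 - z) * ((1 + d^-1) * c).
      by rewrite ler_wpM2l// ltW.
    have -> : (1 - z) * ((1 + d^-1) * c) = (1 - z + d^-1 * (1 - z)) * c by ring.
    rewrite dinv; have : (1 - z + 2) * c <= 3 * c by rewrite ler_wpM2r//; lra.
    lra.
  rewrite ler_pdivlMr ?exprn_gt0//.
  have h3 : A * (1 - z) * (1 - z) ^+ 2 <= (2 * s 0%N + 2 * Z) * (1 - z) ^+ 2.
    by rewrite ler_wpM2r ?exprn_ge0 ?(ltW d0)//; lra.
  have h4 : s 0%N * (1 - z) ^+ 2 <= s 0%N.
    by rewrite ler_piMr// exprn_ile1//; lra.
  have -> : A * (1 - z) ^+ 3 = A * (1 - z) * (1 - z) ^+ 2 by ring.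
  lra.
split.
  exists (2 * s 0%N + 6 * c) => z z2 z1; near=> N.
  rewrite subr0 ger0_norm ?bound// abel_ge0// ltW//; exact: ge_half_gt0.
(* The partial sums of this nonnegative series are bounded, so its terms tend to 0 and are
   eventually below 1. *)
exists 1 => z z2 z1; have z0 := ge_half_gt0 z2.
have t0 n : 0 <= z ^+ n * s n by rewrite mulr_ge0// exprn_ge0// ltW.
have /cvg_series_cvg_0 : cvgn (series (fun n => z ^+ n * s n : R^o)).
  apply: nondecreasing_is_cvgn.
    by apply/nondecreasing_seqP => n; rewrite /series /= big_nat_recr//= lerDl.
  exists ((2 * s 0%N + 6 * c) / (1 - z) ^+ 3) => _ [N _ <-].
  exact: bound.
by move=> /cvgr0_norm_le; apply.
Unshelve. all: end_near. Qed.

(** The word recursion describes spheres of radius n + 1; the shift changes a double pole only by a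
    simple one. *)
Lemma abelO_cons (s : nat -> R) (m : R) :
  abelO 1 (fun n => s n.+1) (fun z => m / (1 - z) ^+ 2) ->
  abelO 1 s (fun z => m / (1 - z) ^+ 2).
Proof.
move=> /abelO_nneg[K K0 hK]; exists (K + `|s 0%N| + `|m|) => z z2 z1.
have z0 := ge_half_gt0 z2; have d0 : 0 < 1 - z by lra.
have [N _ hN] := hK z z2 z1; exists N.+1 => // -[//|n] /= Nn.
have {hN} := hN n Nn; rewrite expr1.
have -> : abel z n.+1 s = s 0%N + z * abel z n (fun n => s n.+1).
  rewrite /abel big_nat_recl// expr0 mul1r mulr_sumr; congr (_ + _).
  by apply: eq_bigr => j _; rewrite exprS mulrA.
set A := abel _ _ _ => hA.
have -> : s 0%N + z * A - m / (1 - z) ^+ 2 =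
    z * (A - m / (1 - z) ^+ 2) + (s 0%N - m / (1 - z)) by field; lra.
apply: le_trans (ler_normD _ _) _; rewrite -addrA mulrDl; apply: lerD.
  rewrite normrM (ger0_norm (ltW z0)); apply: le_trans hA.
  by rewrite ler_piMl// ltW.
apply: le_trans (ler_normB _ _) _; rewrite mulrDl; apply: lerD.
  by rewrite ler_peMr// invf_ge1//; lra.
by rewrite normrM (ger0_norm (_ : 0 <= (1 - z)^-1))// invr_ge0 ltW.
Qed.

End AbelSums.

(** * Forms summed along the recursion *)

Section ComplexParts.
Variable R : realType.
Local Notation C := R[i].
Local Notation Re := (@complex.Re R).
Implicit Types x y : C.

Lemma ReD x y : Re (x + y) = Re x + Re y.
Proof. by case: x; case: y. Qed.

Lemma ReB x y : Re (x - y) = Re x - Re y.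
Proof. by case: x; case: y. Qed.

Lemma Re_sum (I : Type) (s : seq I) (P : pred I) (F : I -> C) :
  Re (\sum_(i <- s | P i) F i) = \sum_(i <- s | P i) Re (F i).
Proof. by apply: (big_morph Re) => // x y; exact: ReD. Qed.

Lemma Re_ge0 x : 0 <= x -> 0 <= Re x.
Proof. by rewrite lecE => /andP[]. Qed.

Lemma le_Re x y : x <= y -> Re x <= Re y.
Proof. by rewrite lecE => /andP[]. Qed.

Lemma Re_mulr x y : 0 <= y -> Re (x * y) = Re x * Re y.
Proof. by move/ger0_Im; case: x y => a b [c d] /= ->; rewrite mulr0 subr0. Qed.

Lemma Re_conj x : Re x^* = Re x.
Proof.
have -> : x^* = conjc x; last by case: x.
by [].
Qed.

Lemma Re_le_norm x : `|Re x| <= Re `|x|.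
Proof. by have := normc_ge_Re x => /le_Re. Qed.

End ComplexParts.

(** Expand both arguments in Parseval frames, whose coefficients are bounded by the norms, and use
    xy <= x^2 + y^2. *)
Lemma sesquilin_bound (R : realType) (U V : vectType R[i])
    (B1 : 'Hom(U, adual U)) (B2 : 'Hom(V, adual V)) (T : U -> V -> R[i]) :
  posdef_form B1 -> posdef_form B2 -> sesquilin T ->
  exists2 K : R, 0 <= K & forall u v,
    `|complex.Re (T u v)| <=
      K * (complex.Re (sesq B1 u u) + complex.Re (sesq B2 v v)).
Proof.
move=> h1 h2 hT; have [q1 q1P] := posdef_frame h1; have [q2 q2P] := posdef_frame h2.
have coefle (W : vectType R[i]) (B : 'Hom(W, adual W)) (q : seq W) w p :
    posdef_form B -> (forall v, v = \sum_(p <- q) sesq B v p *: p) ->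
    p \in q -> `|sesq B w p| ^+ 2 <= sesq B w w.
  move=> hB qP pq.
  have E : sesq B w w = \sum_(p <- q) `|sesq B w p| ^+ 2.
    rewrite {1}(qP w) (sesquilin_suml (sesquilin_sesq B)).
    by apply: eq_bigr => r _; rewrite sesqZl normCK (posdef_herm hB).
  rewrite E (big_rem p)//= lerDl; apply: sumr_ge0 => r _.
  by rewrite exprn_ge0.
pose K := \sum_(p <- q1) \sum_(r <- q2) `|T p r|.
have K0 : 0 <= K by apply: sumr_ge0 => p _; exact: sumr_ge0.
exists (complex.Re K) => [|u v]; first exact: Re_ge0.
have b1 := posdef_ge0 h1 u; have b2 := posdef_ge0 h2 v.
rewrite -ReD -Re_mulr ?addr_ge0//.
apply: le_trans (Re_le_norm _) _; apply: le_Re.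
rewrite {1}(q1P u) (sesquilin_suml hT).
apply: le_trans (ler_norm_sum _ _ _) _.
rewrite /K mulr_suml big_seq [leRHS]big_seq; apply: ler_sum => p pq.
rewrite (sesquilinZl hT) {1}(q2P v) (sesquilin_sumr hT) normrM.
apply: le_trans (ler_wpM2l _ (ler_norm_sum _ _ _)) _ => //.
rewrite mulr_sumr mulr_suml big_seq [leRHS]big_seq; apply: ler_sum => r rq.
rewrite (sesquilinZr hT) normrM norm_conjC mulrA mulrC ler_wpM2l//.
apply: le_trans (lerD (coefle _ _ _ u p h1 q1P pq) (coefle _ _ _ v r h2 q2P rq)).
set x := `|_|; set y := `|_|.
have : 0 <= (x - y) ^+ 2 by rewrite real_exprn_even_ge0// realB// normr_real.
rewrite sqrrB addrAC subr_ge0 => h.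
by apply: le_trans h; rewrite mulr2n lerDl mulr_ge0// normr_ge0.
Qed.

(** * Abel asymptotics of quadratic observables of a driven pair *)

Section Orbits.
Variables (R : realType) (k : nat).
Local Notation C := R[i].
Local Notation Re := (@complex.Re R).
Variables (S T : matrix_system k C) (B : form_tuple S) (Bt : form_tuple T).
Hypotheses (BN : normalized B) (BtN : normalized Bt).
Variable D : forall c d : letter k, 'Hom(msV S d, msV T c).

(** Real observables of a pair of states, the second one driven by the first
    through [D]. *)
Definition observable : Type := forall d : letter k, msV S d -> msV T d -> R.

Definition step (F : observable) : observable := fun d t x =>
  \sum_c F c (msH S c d t) (msH T c d x + D c d t).

Lemma iter_step_lin n c (F G : observable) d t x :
  iter n step (fun d t x => c * F d t x + G d t x) d t x =
  c * iter n step F d t x + iter n step G d t x.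
Proof.
elim: n d t x => //= n IH d t x; rewrite /step mulr_sumr -big_split.
by apply: eq_bigr => e _ /=; rewrite IH.
Qed.

Lemma iter_step_le n (F G : observable) :
  (forall d t x, F d t x <= G d t x) ->
  forall d t x, iter n step F d t x <= iter n step G d t x.
Proof.
by move=> FG; elim: n => //= n IH d t x; apply: ler_sum => c _; exact: IH.
Qed.

Lemma iter_step_ext n (F G : observable) :
  (forall d t x, F d t x = G d t x) ->
  forall d t x, iter n step F d t x = iter n step G d t x.
Proof.
by move=> FG; elim: n => //= n IH d t x; apply: eq_bigr => c _; exact: IH.
Qed.

Variables (a0 : letter k) (t0 : msV S a0) (x0 : msV T a0).

(** The sum of [F] over the states reached by the words of length [n]. *)
Definition orb (F : observable) (n : nat) : R := iter n step F a0 t0 x0.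

Lemma orb_lin c (F G : observable) n :
  orb (fun d t x => c * F d t x + G d t x) n = c * orb F n + orb G n.
Proof. exact: iter_step_lin. Qed.

Lemma orb_le (F G : observable) n :
  (forall d t x, F d t x <= G d t x) -> orb F n <= orb G n.
Proof. by move=> FG; exact: iter_step_le. Qed.

Lemma orb_ext (F G : observable) n :
  (forall d t x, F d t x = G d t x) -> orb F n = orb G n.
Proof. by move=> FG; exact: iter_step_ext. Qed.

Lemma orb0 n : orb (fun _ _ _ => 0) n = 0.
Proof.
by rewrite /orb; elim: n (a0) (t0) (x0) => //= n IH d t x; rewrite /step big1.
Qed.

Lemma orbZ c (F : observable) n : orb (fun d t x => c * F d t x) n = c * orb F n.
Proof.
rewrite -[RHS]addr0 -[X in _ = _ + X](orb0 n) -orb_lin.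
by apply: orb_ext => d t x; rewrite addr0.
Qed.

Lemma orbD (F G : observable) n :
  orb (fun d t x => F d t x + G d t x) n = orb F n + orb G n.
Proof.
by rewrite -[orb F n]mul1r -orb_lin; apply: orb_ext => d t x; rewrite mul1r.
Qed.

Lemma orb_ge0 (F : observable) n :
  (forall d t x, 0 <= F d t x) -> 0 <= orb F n.
Proof. by move=> F0; rewrite -(orb0 n); exact: orb_le. Qed.

Lemma orb_step (F : observable) n : orb (step F) n = orb F n.+1.
Proof. by rewrite /orb iterSr. Qed.

Lemma orb_coboundary (F : observable) n :
  orb F n - orb F n.+1 = orb (fun d t x => F d t x - step F t x) n.
Proof.
rewrite -orb_step addrC -mulN1r -orb_lin; apply: orb_ext => d t x.
by rewrite mulN1r addrC.
Qed.

Lemma orb_dominated (F G : observable) c n :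
  (forall d t x, `|F d t x| <= c * G d t x) -> `|orb F n| <= c * orb G n.
Proof.
move=> FG; rewrite -orbZ ler_norml -[- _]mulN1r -orbZ.
by apply/andP; split; apply: orb_le => d t x; have := FG d t x;
  rewrite ler_norml => /andP[]; rewrite ?mulN1r.
Qed.

Definition obs1 (U : form_family S S) : observable := fun d t _ => Re (U d t t).
Definition obs2 (U : form_family T S) : observable := fun d t x => Re (U d x t).
Definition obs3 (U : form_family T T) : observable := fun d _ x => Re (U d x x).

Definition normB : observable := obs1 (fun a => sesq (B a)).
Definition normBt : observable := obs3 (fun a => sesq (Bt a)).

Lemma normB_ge0 d t x : 0 <= @normB d t x.
Proof. exact/Re_ge0/posdef_ge0/BN.1. Qed.

Lemma normBt_ge0 d t x : 0 <= @normBt d t x.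
Proof. exact/Re_ge0/posdef_ge0/BtN.1. Qed.

Lemma step_obs1 (U : form_family S S) d t x :
  @step (obs1 U) d t x = obs1 (pull U) t x.
Proof. by rewrite /step /obs1 /pull Re_sum. Qed.

Definition drive2 (U : form_family T S) : form_family S S :=
  fun d u v => \sum_c U c (D c d u) (msH S c d v).

Definition drive3 (U : form_family T T) : form_family S S :=
  fun d u v => \sum_c U c (D c d u) (D c d v).

(** The second cross term is conjugated so that it too is linear in x and antilinear in t; its real
    part does not change. *)
Definition cross3 (U : form_family T T) : form_family T S :=
  fun d x t => \sum_c (U c (msH T c d x) (D c d t)
                     + (U c (D c d t) (msH T c d x))^*).

Lemma drive2_sesq U : sesq_family U -> sesq_family (drive2 U).
Proof. by move=> hU d; apply: sesquilin_sum => c; exact: sesquilin_comp. Qed.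

Lemma drive3_sesq U : sesq_family U -> sesq_family (drive3 U).
Proof. by move=> hU d; apply: sesquilin_sum => c; exact: sesquilin_comp. Qed.

Lemma cross3_sesq U : sesq_family U -> sesq_family (cross3 U).
Proof.
move=> hU d; apply: sesquilin_sum => c; apply: sesquilinD.
  exact: sesquilin_comp.
exact: (sesquilin_comp _ _ (sesquilin_conj (hU c))).
Qed.

Lemma step_obs2 U d t x : sesq_family U ->
  @step (obs2 U) d t x = obs2 (pull U) t x + obs1 (drive2 U) t x.
Proof.
move=> hU; rewrite /step /obs2 /obs1 /pull /drive2 !Re_sum -big_split.
by apply: eq_bigr => c _ /=; rewrite (sesquilinDl (hU c)) ReD.
Qed.

Lemma step_obs3 U d t x : sesq_family U ->
  @step (obs3 U) d t x =
  obs3 (pull U) t x + (obs2 (cross3 U) t x + obs1 (drive3 U) t x).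
Proof.
move=> hU; rewrite /step /obs3 /obs2 /obs1 /pull /drive3 /cross3 !Re_sum.
rewrite -!big_split; apply: eq_bigr => c _ /=.
rewrite (sesquilinDl (hU c)) !(sesquilinDr (hU c)) !ReD Re_conj.
by rewrite -!addrA.
Qed.

Lemma orb_normB n : orb normB n = normB t0 x0.
Proof.
elim: n => // n IH; rewrite -orb_step -[RHS]IH; apply: orb_ext => d t x.
by rewrite step_obs1 /obs1 normalized_pull.
Qed.

Lemma observable_bound (F G : observable) : (forall d t x, 0 <= G d t x) ->
  (forall d, exists2 K, 0 <= K & forall t x, `|F d t x| <= K * G d t x) ->
  exists2 K, 0 <= K & forall d t x, `|F d t x| <= K * G d t x.
Proof.
move=> G0 hK; pose K d := projT1 (cid2 (hK d)).
have K0 d : 0 <= K d by rewrite /K; case: cid2.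
have KP d : forall t x, `|F d t x| <= K d * G d t x by rewrite /K; case: cid2.
exists (\sum_d K d) => [|d t x]; first exact: sumr_ge0.
apply: le_trans (KP d t x) _; rewrite ler_wpM2r//.
by rewrite (bigD1 d)//= lerDl; exact: sumr_ge0.
Qed.

Lemma obs1_bound U : sesq_family U ->
  exists2 K, 0 <= K & forall d t x, `|obs1 U t x| <= K * @normB d t x.
Proof.
move=> hU; apply: observable_bound => [|d]; first exact: normB_ge0.
have [K K0 hK] := sesquilin_bound (BN.1 d) (BN.1 d) (hU d).
exists (K * 2) => [|t x]; first by rewrite mulr_ge0.
by apply: le_trans (hK t t) _; rewrite -mulrA ler_wpM2l// mulr2n mulrDl mul1r.
Qed.

Lemma obs2_bound U : sesq_family U ->
  exists2 K, 0 <= K & forall d t x, `|obs2 U t x| <= K * (@normB d t x + normBt t x).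
Proof.
move=> hU; apply: (observable_bound (G := fun d t x => normB t x + normBt t x)).
  by move=> d t x; rewrite addr_ge0 ?normB_ge0 ?normBt_ge0.
move=> d; have [K K0 hK] := sesquilin_bound (BtN.1 d) (BN.1 d) (hU d).
by exists K => // t x; apply: le_trans (hK x t) _; rewrite addrC.
Qed.

Lemma obs3_bound U : sesq_family U ->
  exists2 K, 0 <= K & forall d t x, `|obs3 U t x| <= K * @normBt d t x.
Proof.
move=> hU; apply: observable_bound => [|d]; first exact: normBt_ge0.
have [K K0 hK] := sesquilin_bound (BtN.1 d) (BtN.1 d) (hU d).
exists (K * 2) => [|t x]; first by rewrite mulr_ge0.
by apply: le_trans (hK x x) _; rewrite -mulrA ler_wpM2l// mulr2n mulrDl mul1r.
Qed.

(** From [|u + v|^2 <= (1 + d) |u|^2 + (1 + d^-1) |v|^2] for every [d > 0]. *)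
Lemma normBt_crude : abelO 3 (orb normBt) (fun=> 0) /\ abel_tail (orb normBt).
Proof.
have hBt : sesq_family (fun a => sesq (Bt a)) by move=> a; exact: sesquilin_sesq.
have [K K0 hK] := obs1_bound (drive3_sesq hBt).
apply: (@crude_abel _ _ (K * normB t0 x0)).
- by move=> n; apply: orb_ge0 => d t x; exact: normBt_ge0.
- by rewrite mulr_ge0// normB_ge0.
move=> e n e0; rewrite -orb_step.
have -> : (1 + e) * orb normBt n + (1 + e^-1) * (K * normB t0 x0) =
    orb (fun d t x => (1 + e) * normBt t x + (1 + e^-1) * K * normB t x) n.
  by rewrite orb_lin orbZ orb_normB mulrA.
apply: orb_le => d t x.
have {hK} := hK d t x; rewrite /obs1 => /(le_trans (ler_norm _)) hK.
apply: le_trans (_ : (1 + e) * normBt t x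
    + (1 + e^-1) * Re (drive3 (fun a => sesq (Bt a)) t t) <= _); last first.
  by rewrite lerD2l -mulrA ler_wpM2l// addr_ge0// invr_ge0 ltW.
rewrite /normBt /obs3 -(normalized_pull BtN) /pull /drive3 !Re_sum !mulr_sumr.
rewrite -big_split; apply: ler_sum => c _ /=.
set u := msH T c d x; set v := D c d t; pose b := sesq (Bt c).
(* Young's inequality is positivity at e u - v, divided by e. *)
have := Re_ge0 (posdef_ge0 (BtN.1 c) ((e%:C)%C *: u - v)).
rewrite (sesquilinBl (hBt c)) !(sesquilinBr (hBt c)) !(sesquilinZl (hBt c)).
rewrite !(sesquilinZr (hBt c)) (sesquilinDl (hBt c)) !(sesquilinDr (hBt c)).
rewrite -[sesq _ v u](posdef_herm (BtN.1 c)).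
have -> : ((e%:C)%C : C)^* = (e%:C)%C by exact: conjc_real.
rewrite !(ReB, ReD) Re_conj.
have ReZ (r : R) (y : C) : Re ((r%:C)%C * y) = r * Re y.
  by case: y => y1 y2 /=; rewrite mul0r subr0.
rewrite !ReZ Re_conj => h.
set uu := Re (sesq _ u u) in h *; set uv := Re (sesq _ u v) in h *.
set vv := Re (sesq _ v v) in h *.
suff : 0 <= e * uu - 2 * uv + e^-1 * vv by lra.
have -> : e * uu - 2 * uv + e^-1 * vv =
    e^-1 * (e * (e * uu) - e * uv - (e * uv - vv)) by field; rewrite gt_eqF.
by rewrite mulr_ge0// invr_ge0 ltW.
Qed.

Variables (P : frames S) (Pt : frames T) (kap : C).
Hypotheses (hP : fixed_frame P) (hPt : fixed_frame Pt)
  (hS : schurian S) (hT : schurian T) (kap_gt0 : 0 < kap)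
  (kapS : pairing P (fun a => sesq (B a)) = kap)
  (kapT : pairing Pt (fun a => sesq (Bt a)) = kap).
Hypothesis mixed : forall U : form_family T S, sesq_family U ->
  exists2 W : form_family T S, sesq_family W &
    forall a u v, U a u v = W a u v - pull W u v.
Hypothesis orthogonal : forall a (W : msV T a -> msV S a -> C), sesquilin W ->
  \sum_b \sum_(p <- P b) W (D a b p) (msH S a b p) = 0.

Local Notation energy := (normB t0 x0).

(** The [B] part of the form is conserved along the orbit, and the coboundary part is bounded by it,
    so its Abel sums telescope to O(1). *)
Lemma abel_obs1 (U : form_family S S) : sesq_family U ->
  abelO 0 (orb (obs1 U)) (fun z => Re (pairing P U / kap) * energy / (1 - z)).
Proof.
move=> hU; have [l [lE [W hW UE]]] := form_decomposition hS hP BN hU.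
rewrite kapS in lE; have -> : pairing P U / kap = l by rewrite lE mulfK ?gt_eqF.
have [K K0 hK] := obs1_bound hW.
have bW n : `|orb (obs1 W) n| <= K * energy.
  by rewrite -(orb_normB n); apply: orb_dominated => d t x; exact: hK.
have cob : abelO 0 (fun n => orb (obs1 W) n - orb (obs1 W) n.+1) (fun=> 0).
  apply: abelO_coboundary; first exact: abelO_dominated (abelO_cst1 _).
  exact: abel_tail_dominated (abel_tail_cst _).
apply: abelO_ext (abelO_lin (Re l) (abelO_cst energy) cob) => [n|z _ _].
  rewrite -(orb_normB n) orb_coboundary -orb_lin; apply: orb_ext => d t x.
  rewrite step_obs1 /normB /obs1 UE ReD ReB Re_mulr ?mulN1r//.
  exact/posdef_ge0/BN.1.
by rewrite addr0 mulrA.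
Qed.

Lemma abel_obs1_0 (U : form_family S S) : sesq_family U ->
  pairing P U = 0 -> abelO 0 (orb (obs1 U)) (fun=> 0).
Proof.
move=> hU U0; apply: abelO_ext (abel_obs1 hU) => // z _ _.
by rewrite U0 mul0r !mul0r.
Qed.

Lemma pairing_drive2 U : sesq_family U -> pairing P (drive2 U) = 0.
Proof.
move=> hU; rewrite /pairing /drive2.
under eq_bigr do rewrite exchange_big.
rewrite exchange_big big1// => c _; exact: orthogonal.
Qed.

(** Bootstrap: if all mixed forms are [O((1 - z)^-(p+1))], then, being
    coboundaries up to a form in [(t, t)] of zero pairing, they are
    [O((1 - z)^-p)]. *)
Lemma abel_obs2 (U : form_family T S) : sesq_family U ->
  abelO 0 (orb (obs2 U)) (fun=> 0).
Proof.
(* The exponent 3 is the crude order of [normBt_crude]; p counts the powers gained. *)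
suff H p : (p <= 3)%N -> forall U, sesq_family U ->
    abelO (3 - p) (orb (obs2 U)) (fun=> 0) by exact: (H 3%N).
have [cr tl] := normBt_crude.
have cr' : abelO 3 (fun n => orb normB n + orb normBt n) (fun=> 0).
  have h : abelO 3 (orb normB) (fun=> 0).
    apply: abelO_ext (abelO_weaken (isT : (1 <= 3)%N) (abelO_cst1 energy)) => // n.
    by rewrite orb_normB.
  apply: abelO_ext (abelO_lin 1 h cr) => [n|z _ _]; rewrite mul1r//.
  by rewrite addr0.
have tl' : abel_tail (fun n => orb normB n + orb normBt n).
  have [K hK] := tl; exists (`|energy| + K) => z z2 z1; near=> N.
  have h : `|z ^+ N * orb normBt N| <= K by near: N; exact: hK.
  have z0 := ge_half_gt0 z2.
  rewrite mulrDr; apply: le_trans (ler_normD _ _) _; apply: lerD => //.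
  rewrite orb_normB normrM ler_piMl// ger0_norm ?exprn_ge0 ?(ltW z0)//.
  by rewrite exprn_ile1// ltW.
have dom (W : form_family T S) : sesq_family W -> exists K, forall n,
    `|orb (obs2 W) n| <= K * (orb normB n + orb normBt n).
  move=> hW; have [K K0 hK] := obs2_bound hW; exists K => n.
  by rewrite -orbD; apply: orb_dominated => d t x; exact: hK.
elim: p => [_ {}U hU|p IH p3 {}U hU].
  have [K hK] := dom U hU; exact: abelO_dominated hK cr'.
have [W hW UE] := mixed hU.
have cob : abelO (3 - p.+1) (fun n => orb (obs2 W) n - orb (obs2 W) n.+1)
    (fun=> 0).
  apply: abelO_coboundary; first by rewrite -subSn//; exact: IH (ltnW p3) _ hW.
  have [K hK] := dom W hW; exact: abel_tail_dominated hK tl'.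
have dr := abel_obs1_0 (drive2_sesq hW) (pairing_drive2 hW).
apply: abelO_ext (abelO_lin 1 (abelO_weaken (leq0n _) dr) cob) => [n|z _ _].
  rewrite mul1r orb_coboundary -!orbD; apply: orb_ext => d t x.
  by rewrite step_obs2// /obs2 UE ReB; ring.
by rewrite mulr0 addr0.
Unshelve. all: end_near. Qed.

Local Notation noise := (Re (pairing P (drive3 (fun a => sesq (Bt a))) / kap)).

(** One step adds a mixed form, whose Abel sums are O(1), and the drive, whose pairing gives the
    pole; summing the increments doubles the pole. *)
Lemma abel_normBt :
  abelO 1 (orb normBt) (fun z => noise * energy / (1 - z) ^+ 2).
Proof.
have hBt : sesq_family (fun a => sesq (Bt a)) by move=> a; exact: sesquilin_sesq.
have incr : abelO 0 (fun n => orb (obs2 (cross3 (fun a => sesq (Bt a)))) n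
      + orb (obs1 (drive3 (fun a => sesq (Bt a)))) n)
    (fun z => noise * energy / (1 - z)).
  have := abelO_lin 1 (abel_obs2 (cross3_sesq hBt)) (abel_obs1 (drive3_sesq hBt)).
  by apply: abelO_ext => [n|z _ _]; rewrite mul1r ?add0r.
apply: (abelO_increment normBt_crude.2 _ incr) => n.
rewrite -!orbD -orb_step; apply: orb_ext => d t x.
by rewrite step_obs3// /normBt /obs3 normalized_pull.
Qed.

Lemma abel_obs3 (U : form_family T T) : sesq_family U ->
  abelO 1 (orb (obs3 U))
    (fun z => Re (pairing Pt U / kap) * (noise * energy) / (1 - z) ^+ 2).
Proof.
move=> hU; have [l [lE [W hW UE]]] := form_decomposition hT hPt BtN hU.
rewrite kapT in lE; have -> : pairing Pt U / kap = l by rewrite lE mulfK ?gt_eqF.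
have [K K0 hK] := obs3_bound hW.
have bW n : `|orb (obs3 W) n| <= K * orb normBt n.
  by apply: orb_dominated => d t x; exact: hK.
(* The sharp order 2, in place of the crude 3, is what brings the coboundary of [W] down to order
   1. *)
have crude2 : abelO 2 (orb normBt) (fun=> 0).
  have [K' hK'] := abelO_weaken (isT : (1 <= 2)%N) abel_normBt.
  exists (K' + `|noise * energy|) => z z2 z1; near=> N.
  have h : `|abel z N (orb normBt) - noise * energy / (1 - z) ^+ 2| <= K' / (1 - z) ^+ 2.
    by near: N; exact: hK'.
  have d0 : 0 < 1 - z by lra.
  rewrite subr0 -[abel _ _ _](subrK (noise * energy / (1 - z) ^+ 2)).
  apply: le_trans (ler_normD _ _) _; rewrite mulrDl lerD//.
  rewrite normrM (ger0_norm (_ : 0 <= ((1 - z) ^+ 2)^-1))//.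
  by rewrite invr_ge0 exprn_ge0// ltW.
have cob : abelO 1 (fun n => orb (obs3 W) n - orb (obs3 W) n.+1) (fun=> 0).
  apply: abelO_coboundary; first exact: abelO_dominated crude2.
  exact: abel_tail_dominated normBt_crude.2.
have dr : abelO 1 (orb (obs1 (drive3 W))) (fun=> 0).
  have [K1 K10 hK1] := obs1_bound (drive3_sesq hW).
  apply: (abelO_dominated _ (abelO_cst1 energy)) => n.
  by rewrite -(orb_normB n); apply: orb_dominated => d t x; exact: hK1.
have cr := abelO_weaken (leq0n 1) (abel_obs2 (cross3_sesq hW)).
have := abelO_lin 1 cr (abelO_lin 1 dr cob).
move=> /(abelO_lin (Re l) abel_normBt); apply: abelO_ext => [n|z _ _].
  rewrite !mul1r orb_coboundary -!orbD -orb_lin; apply: orb_ext => d t x.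
  rewrite step_obs3// /normBt /obs3 UE ReD ReB Re_mulr; first by ring.
  exact/posdef_ge0/BtN.1.
by rewrite !mulr0 !addr0 mulrA.
Unshelve. all: end_near. Qed.

End Orbits.

(** * Asymptotics *)

Lemma sesquilin_rank1 (C : numClosedFieldType) (U V : vectType C)
    (l : U -> C) (m : V -> C) :
  scalar l -> scalar m -> sesquilin (fun u v => l u * (m v)^*).
Proof.
move=> hl hm; split=> [c u u' v|c u v v'].
  by rewrite hl mulrDl -mulrA.
by rewrite hm rmorphD rmorphM /= mulrDr mulrCA.
Qed.

(** * Sphere sums of the coefficients as iterated observables *)

Section Sums.
Variables (R : realType) (k : nat).
Local Notation C := R[i].
Local Notation Re := (@complex.Re R).
Variables (S : matrix_system k C) (B : form_tuple S) (BN : normalized B).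
Local Notation T := (twin S).

Definition sqnorm (z : C) : R := ComplexField.Normc.normc z ^+ 2.

Lemma sqnormE z : sqnorm z = Re (z * z^*).
Proof.
have -> : z^* = conjc z by [].
case: z => x y; rewrite /sqnorm /= sqr_sqrtr ?addr_ge0 ?sqr_ge0//.
by rewrite mulrN opprK !expr2.
Qed.

Lemma sqnormD (x y : C) :
  sqnorm (x + y) = Re (x * x^*) + (Re (2 * (y * x^*)) + Re (y * y^*)).
Proof.
have conjE (z : C) : z^* = conjc z by [].
by rewrite sqnormE !conjE; case: x => a b; case: y => c d /=; ring.
Qed.

Lemma sqnorm_ge0 z : 0 <= sqnorm z.
Proof. exact: sqr_ge0. Qed.

Lemma sqnorm0 : sqnorm 0 = 0.
Proof. by rewrite sqnormE mul0r. Qed.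

Local Notation ev f v := ((f : 'Hom(conjv _, C^o)) v : C).

Lemma iter_step_zero (D : forall c d : letter k, 'Hom(msV S d, msV T c)) n
    (F : observable S T) :
  (forall d, F d 0 0 = 0) -> forall d, iter n (step D) F d 0 0 = 0.
Proof.
move=> F0; elim: n => //= n IH d; rewrite /step big1// => c _.
by rewrite !linear0 addr0.
Qed.

Section Coefficients.
Variables (a b : letter k) (va : msV S a) (vb : msV S b).

Local Notation w d := (component (linv d) (Tagged (msV S) vb)).

Definition final_obs : observable S T := fun d t psi =>
  sqnorm (sesq (B b) (msH S b d t) vb + ev psi (w d)).

(** Evaluating psi on H of the later [back] vector is evaluating the twin map of psi on that vector,
    so psi collects all the [Emap] terms while the word is read forward. *)
Lemma coef_iter n d (t : msV S d) (psi : msV T d) :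
  \sum_(X <- words n d) sqnorm (coef B vb X t + ev psi (back vb X d)) =
  iter n (step (Emap B)) final_obs d t psi.
Proof.
elim: n d t psi => [|n IH] d t psi; first by rewrite /= big_seq1.
rewrite big_words iterS {2}/step [RHS](bigID (fun c => c != linv d)) /=.
rewrite [X in _ = _ + X]big1 ?addr0 => [|c]; last first.
  rewrite negbK => /eqP ->.
  have e : (gen (linv d) * gen d = 1)%g by apply/eqP; rewrite gen_mul_eq1 linvK.
  rewrite /Emap e eqxx msH0// (twinH0 S e) !zero_lfunE addr0 iter_step_zero//.
  move=> c'; rewrite /final_obs linear0 (sesquilin0l (sesquilin_sesq _)).
  by rewrite zero_lfunE addr0 sqnorm0.
apply: eq_bigr => c _; rewrite -IH; apply: eq_bigr => X _; congr sqnorm.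
by rewrite /= add_lfunE adjointE -addrA [X in _ = _ + X]addrC.
Qed.

Definition start_obs : observable S T := fun d t _ =>
  sqnorm (sesq (B a) va (msH S a d t)).

Local Notation g u := (sesq (B a) va (msH S a (tag u) (tagged u))).

(** Stated for every drive [D], so that these terms can be put on orbits driven by [defectQ B Q],
    like the others. *)
Lemma start_iter (D : forall c d : letter k, 'Hom(msV S d, msV T c)) n d
    (t : msV S d) (x : msV T d) :
  \sum_(s <- words n d) sqnorm (g (transport t s)) =
  iter n (step D) start_obs d t x.
Proof.
have indep m d' (t' : msV S d') x1 x2 :
    iter m (step D) start_obs d' t' x1 = iter m (step D) start_obs d' t' x2.
  elim: m d' t' x1 x2 => //= m IH d' t' x1 x2; rewrite /step.
  by apply: eq_bigr => c _; exact: IH.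
elim: n d t x => [|n IH] d t x; first by rewrite /= big_seq1.
rewrite big_words iterS {2}/step [RHS](bigID (fun c => c != linv d)) /=.
rewrite [X in _ = _ + X]big1 ?addr0 => [|c]; first by apply: eq_bigr => c _; exact: IH.
rewrite negbK => /eqP ->.
rewrite msH0; last by apply/eqP; rewrite gen_mul_eq1 linvK.
rewrite zero_lfunE (indep _ _ _ _ 0) iter_step_zero// => c'.
by rewrite /start_obs linear0 (sesquilin0r (sesquilin_sesq _)) sqnorm0.
Qed.

Lemma coefw_sphere (D : forall c d : letter k, 'Hom(msV S d, msV T c)) n :
  \sum_(X <- reduced_words n.+1) sqnorm (coefw B vb va X) =
  iter n (step (Emap B)) final_obs a va 0 + iter n (step D) start_obs b vb 0.
Proof.
rewrite -(coef_iter n va 0) -(start_iter D n vb 0) big_reduced_words (bigD1 a)//=.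
rewrite eqxx; congr (_ + _).
  by apply: eq_bigr => X _; rewrite zero_lfunE addr0.
(* Words starting with [a] can be added because H from a^-1 to a vanishes; inverting all words then
   leaves those that start with [b]. *)
transitivity (\sum_(X <- reduced_words n.+1) sqnorm (g (muw vb (winv X)))).
  rewrite big_reduced_words [RHS](bigD1 a)//= [X in _ = X + _]big1 => [|X _].
    rewrite add0r; apply: eq_bigr => c /negPf ca; apply: eq_bigr => X _.
    by rewrite ca -[winv _]cats0 muw_back.
  rewrite -[winv _]cats0 muw_back /= msH0.
    by rewrite zero_lfunE (sesquilin0r (sesquilin_sesq _)) sqnorm0.
  by apply/eqP; rewrite gen_mul_eq1.
rewrite (big_reduced_words_winv _ (fun X => sqnorm (g (muw vb X)))).
rewrite big_reduced_words (bigD1 b)//= eqxx [X in _ + X]big1 ?addr0// => c.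
move=> /negPf cb; rewrite big1// => s _; rewrite cb /= linear0.
by rewrite (sesquilin0r (sesquilin_sesq _)) sqnorm0.
Qed.

End Coefficients.

(** The change of variable psi = chi + Q t: Hhat (chi + Q t) + E t = (Hhat chi + D t) + Q (H t). *)
Lemma defect_iter (Q : forall b, 'Hom(msV S b, msV T b)) n (F : observable S T)
    d (t : msV S d) (chi : msV T d) :
  iter n (step (Emap B)) F d t (chi + Q d t) =
  iter n (step (defectQ B Q)) (fun d t chi => F d t (chi + Q d t)) d t chi.
Proof.
elim: n d t chi => //= n IH d t chi; rewrite /step; apply: eq_bigr => c _.
rewrite -IH; congr (iter _ _ _ _ _ _).
rewrite /defectQ !(add_lfunE, opp_lfunE, comp_lfunE) linearD /= !addrA.
by rewrite subrK.
Qed.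

End Sums.

(** * From the sum over the group to a power series in exp(-eps) *)

Section EsumSpheres.
Variables (R : realType) (k : nat).

Lemma esum_spheres (h : freegroup k -> R) (F : seq (letter k) -> R) :
  (forall x, 0 <= h x) -> (forall x, h x = F (word x)) ->
  (\esum_(x in [set: freegroup k]) (h x)%:E =
   \sum_(0 <= n <oo) (\sum_(w <- reduced_words n) F w)%:E)%E.
Proof.
move=> h0 hF.
have -> : [set: freegroup k] = \bigcup_n [set x : freegroup k | wlen x = n].
  by apply/seteqP; split=> // x _; exists (wlen x).
rewrite nneseries_sum_bigcup; last by move=> x; rewrite lee_fin.
  apply: eq_eseriesr => n _; rewrite esum_fset; last by move=> x _; rewrite lee_fin.
    rewrite fsbig_finite/=; last exact: finite_sphere.
    rewrite sumEFin -big_sphere; congr EFin; apply: eq_bigr => x _; exact: hF.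
  exact: finite_sphere.
by move=> i j _ _ [x [<- <-]].
Qed.

Lemma nneseries_bounds (u : nat -> R) (lo hi : R) : (forall n, 0 <= u n) ->
  (\forall N \near \oo, lo <= \sum_(0 <= n < N) u n <= hi) ->
  (lo%:E <= \sum_(0 <= n <oo) (u n)%:E <= hi%:E)%E.
Proof.
move=> u0 [N _ hN].
have cv := @is_cvg_nneseries R (fun n => (u n)%:E) xpredT 0%N
  (fun n _ _ => u0 n : (0 <= (u n)%:E)%E).
apply/andP; split.
  apply: lime_ge => //; exists N => // n /hN /andP[h _].
  by rewrite sumEFin lee_fin.
apply: lime_le => //; exists N => // n /hN /andP[_ h].
by rewrite sumEFin lee_fin.
Qed.

End EsumSpheres.

(** Both bounds follow from 1 - eps <= exp(-eps) <= 1 / (1 + eps). *)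
Lemma exp_pole (R : realType) (eps : R) : 0 < eps -> eps <= 2^-1 ->
  [/\ 2^-1 <= expR (- eps), expR (- eps) < 1,
      eps^-1 <= (1 - expR (- eps))^-1 &
      (1 - expR (- eps))^-1 <= eps^-1 + 1].
Proof.
move=> e0 e2; have l1 := expR_ge1Dx (- eps); have l2 := expR_ge1Dx eps.
have u : expR (- eps) <= (1 + eps)^-1.
  by rewrite expRN lef_pV2 ?posrE ?expR_gt0//; lra.
have u1 : (1 + eps)^-1 < 1 by rewrite invf_lt1; lra.
have d0 : 0 < 1 - expR (- eps) by lra.
split; [lra|lra| |].
  by rewrite lef_pV2 ?posrE//; lra.
have -> : eps^-1 + 1 = (eps / (1 + eps))^-1 by field; lra.
rewrite lef_pV2 ?posrE ?divr_gt0//; last by lra.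
have -> : eps / (1 + eps) = 1 - (1 + eps)^-1 by field; lra.
lra.
Qed.

(** * Abel asymptotics of the sphere sums *)

Section Asymptotics.
Variables (R : realType) (k : nat).
Local Notation C := R[i].
Local Notation Re := (@complex.Re R).
Variables (S : matrix_system k C) (B : form_tuple S).
Hypotheses (BN : normalized B) (S_irr : irreducible_system S).
Variable (Bh : form_tuple (twin S)).
Hypotheses (Bh_twin : twin_forms Bh) (S_neq : ~ equivalent_systems S (twin S)).
Variable Q : forall b, 'Hom(msV S b, msV (twin S) b).
Hypothesis Q_def : is_Q B Bh Q.
Variables (a b : letter k) (va : msV S a) (vb : msV S b).

Local Notation T := (twin S).
Local Notation ev f v := ((f : 'Hom(conjv _, C^o)) v : C).
Local Notation w d := (component (linv d) (Tagged (msV S) vb)).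
Local Notation energy := (Re (sesq (B a) va va)).

Let BhN := twin_normalized Bh_twin.
Let S_schur := irreducible_schurian S_irr.
Let T_schur := twin_schurian S_schur.
Let k0_pos : 0 < k0 B Bh.
Proof.
by have [P hP] := exists_frame_of Bh_twin; exact: (k0_gt0 BN S_irr hP).
Qed.

Lemma real_nneg (x : C) : 0 <= x -> ((Re x)%:C)%C = x.
Proof. by move=> x0; rewrite RRe_real// ger0_real. Qed.

Definition main_coef : R :=
  Re (sesq (B b) vb vb / k0 B Bh) * (Re (E0 B Bh Q / k0 B Bh) * energy).

Definition sphere_sum n : R := \sum_(X <- reduced_words n) sqnorm (coefw B vb va X).

Lemma sphere_sum_ge0 n : 0 <= sphere_sum n.
Proof. by apply: sumr_ge0 => X _; exact: sqnorm_ge0. Qed.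

Let Lf d (u : msV S d) : C := sesq (B b) (msH S b d u) vb + ev (Q d u) (w d).

Let Lf_scalar d : scalar (@Lf d).
Proof.
move=> c u v; rewrite /Lf !linearP /= sesqDl sesqZl add_lfunE scale_lfunE.
by rewrite mulrDr addrACA.
Qed.

Let ev_scalar d : scalar (fun x : msV T d => ev x (w d)).
Proof. by move=> c x y; rewrite add_lfunE scale_lfunE. Qed.

Definition final_form1 : form_family S S := fun d u v => Lf u * (Lf v)^*.

Definition final_form2 : form_family T S :=
  fun d x t => 2 * (ev x (w d) * (Lf t)^*).

Definition final_form3 : form_family T T :=
  fun d x y => ev x (w d) * (ev y (w d))^*.

Definition start_form : form_family S S := fun d u v =>
  sesq (B a) (msH S a d u) va * (sesq (B a) (msH S a d v) va)^*.

Lemma final_form1_sesq : sesq_family final_form1.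
Proof. by move=> d; apply: sesquilin_rank1; exact: Lf_scalar. Qed.

Lemma final_form2_sesq : sesq_family final_form2.
Proof.
move=> d; apply: sesquilinZ; apply: sesquilin_rank1; first exact: ev_scalar.
exact: Lf_scalar.
Qed.

Lemma final_form3_sesq : sesq_family final_form3.
Proof. by move=> d; apply: sesquilin_rank1; exact: ev_scalar. Qed.

Lemma start_form_sesq : sesq_family start_form.
Proof.
by move=> d; apply: sesquilin_rank1 => c u v; rewrite linearP sesqDl sesqZl.
Qed.

(** By Parseval each letter d contributes the squared norm of the component of [vb] at d^-1, nonzero
    only if d^-1 = b. *)
Lemma twin_pairing_final (q : frames S) :
  (forall a v, v = \sum_(p <- q a) sesq (B a) v p *: p) ->
  pairing (twin_frame B q) final_form3 = sesq (B b) vb vb.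
Proof.
move=> hq; rewrite /pairing.
transitivity (\sum_d sesq (B (linv d)) (w d) (w d)).
  apply: eq_bigr => d _; rewrite big_map (parseval _ _ hq).
  apply: eq_bigr => p _.
  transitivity (sesq (B (linv d)) p (w d) * (sesq (B (linv d)) p (w d))^*) => //.
  by rewrite (posdef_herm (BN.1 _)) mulrC.
rewrite -(sum_linv (fun c => sesq (B c) (component c (Tagged (msV S) vb))
                                 (component c (Tagged (msV S) vb)))).
rewrite (bigD1 b)//= big1 ?addr0 ?componentE// => c cb.
by rewrite component_neq 1?eq_sym// (sesquilin0l (sesquilin_sesq _)).
Qed.

Lemma sphere_sumS n : sphere_sum n.+1 =
  orb (defectQ B Q) va (- Q a va) (fun d t x => obs1 final_form1 t x
    + (obs2 final_form2 t x + obs3 final_form3 t x)) n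
  + orb (defectQ B Q) vb (0 : msV T b) (obs1 start_form) n.
Proof.
rewrite /sphere_sum (coefw_sphere B va vb (defectQ B Q)); congr (_ + _).
  (* The functional starts at psi = 0, that is at chi = - Q va. *)
  transitivity (iter n (step (Emap B)) (final_obs B vb) a va (- Q a va + Q a va)).
    by rewrite addNr.
  rewrite defect_iter.
  apply: iter_step_ext => d t x; rewrite -sqnormD; congr sqnorm.
  by rewrite /Lf add_lfunE -addrA [X in _ = _ + X]addrC.
apply: iter_step_ext => d t x; rewrite /start_obs sqnormE /obs1.
by rewrite /start_form !(posdef_herm (BN.1 _)) mulrC.
Qed.

Lemma abel_sphere_sum : abelO 1 sphere_sum (fun z => main_coef / (1 - z) ^+ 2).
Proof.
have [P hP] := exists_frame_of Bh_twin; have hPf := frame_of_fixed Bh_twin hP.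
have [q hq] := exists_parseval_frames BN.
have hPt := twin_frame_fixed BN hq.
have kapS := esym (k0_pairing B hP); have kapT := esym (k0_twin_pairing BN Bh hq).
have mixed := mixed_decomposition S_irr Bh_twin S_neq.
have orthog := defectQ_orthogonal Bh_twin hP Q_def.
have e1 := abelO_simple_pole (abel_obs1 BN (defectQ B Q) va (- Q a va) hPf
  S_schur k0_pos kapS final_form1_sesq).
have e2 := abelO_weaken (leq0n 1) (abel_obs2 BN BhN va (- Q a va) hPf S_schur
  k0_pos kapS mixed orthog final_form2_sesq).
have e3 := abel_obs3 BN BhN va (- Q a va) hPf hPt S_schur T_schur k0_pos kapS
  kapT mixed orthog final_form3_sesq.
have f1 := abelO_simple_pole (abel_obs1 BN (defectQ B Q) vb (0 : msV T b) hPf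
  S_schur k0_pos kapS start_form_sesq).
apply: abelO_cons.
have := abelO_lin 1 e1 (abelO_lin 1 e2 (abelO_lin 1 f1 e3)).
apply: abelO_ext => [n|z _ _].
  by rewrite !mul1r sphere_sumS !orbD; ring.
rewrite !mulr0 !add0r (twin_pairing_final hq) -(E0_pairing B hP).
by [].
Qed.

Lemma sphere_sum_lower : va != 0 -> vb != 0 ->
  exists c : R, exists2 f : nat -> R, 0 < c /\ (forall n, f n <= sphere_sum n.+1) &
    abelO 0 f (fun z => c / (1 - z)).
Proof.
move=> va0 vb0.
have [P hP] := exists_frame_of Bh_twin; have hPf := frame_of_fixed Bh_twin hP.
have kapS := esym (k0_pairing B hP).
have f1 := abel_obs1 BN (defectQ B Q) vb (0 : msV T b) hPf S_schur k0_pos kapS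
  start_form_sesq.
eexists; exists (orb (defectQ B Q) vb (0 : msV T b) (obs1 start_form)); last exact: f1.
split=> [|n]; last first.
  rewrite sphere_sumS lerDr; apply: orb_ge0 => d t x.
  by rewrite -sqnormD sqnorm_ge0.
have nn : sesquilin (fun u v => sesq (B a) u va * (sesq (B a) v va)^*).
  by apply: sesquilin_rank1 => c u v; rewrite sesqDl sesqZl.
have pV : pairing P start_form = \sum_(p <- P a) `|sesq (B a) p va| ^+ 2.
  rewrite /pairing /start_form (hPf.2 a _ nn); apply: eq_bigr => p _.
  by rewrite normCK.
have pV0 : 0 < pairing P start_form.
  rewrite pV lt_neqAle eq_sym sumr_ge0 ?andbT => [|p _]; last by rewrite exprn_ge0.
  apply/negP; rewrite psumr_eq0 => [/allP h|p _]; last by rewrite exprn_ge0.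
  (* If every product of [va] with a frame vector vanished, [va], a combination of these vectors,
     would be orthogonal to itself. *)
  have : va \in <<in_tuple (P a)>>%VS by rewrite (hP.1 a) memvf.
  move=> /coord_span vaE; have := BN.1 a va va0.
  rewrite {1}vaE (sesquilin_suml (sesquilin_sesq _)) big1 ?ltxx// => i _.
  rewrite sesqZl; have /h : (in_tuple (P a))`_i \in P a by rewrite mem_nth.
  by rewrite /= sqrf_eq0 normr_eq0 => /eqP ->; rewrite mulr0.
have Re_gt0 (x : C) : 0 < x -> 0 < Re x by rewrite ltcE => /andP[].
rewrite mulr_gt0//; first by apply: Re_gt0; rewrite divr_gt0.
exact/Re_gt0/BN.1.
Qed.

Lemma phi_norm2_series (eps : R) : phi_norm2 B eps va vb =
  (\sum_(0 <= n <oo) (expR (- eps) ^+ n * sphere_sum n)%:E)%E.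
Proof.
rewrite /phi_norm2 (esum_spheres (F := fun X =>
  sqnorm (coefw B vb va X) * expR (- eps * (size X)%:R))).
- apply: eq_eseriesr => n _; congr EFin; rewrite /sphere_sum mulr_sumr big_seq.
  rewrite [RHS]big_seq; apply: eq_bigr => X; rewrite mem_reduced_words.
  by move=> /andP[/eqP -> _]; rewrite mulrC [- eps * _]mulrC expRM_natl.
- by move=> x; rewrite mulr_ge0 ?expR_ge0 ?sqr_ge0.
- by move=> x; rewrite innerE_coefw.
Qed.

End Asymptotics.

(** * Translation from z to eps *)

Section PhiAsymptotics.
Variables (R : realType) (k : nat).
Local Notation C := R[i].
Local Notation Re := (@complex.Re R).
Variables (S : matrix_system k C) (B : form_tuple S).
Hypotheses (BN : normalized B) (S_irr : irreducible_system S).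
Variable (Bh : form_tuple (twin S)).
Hypotheses (Bh_twin : twin_forms Bh) (S_neq : ~ equivalent_systems S (twin S)).
Variable Q : forall b, 'Hom(msV S b, msV (twin S) b).
Hypothesis Q_def : is_Q B Bh Q.
Variables (a b : letter k) (va : msV S a) (vb : msV S b).

Local Notation M := (main_coef B Bh Q va vb).

Lemma phi_norm2_asymp : exists2 K : R, 0 <= K &
  forall eps : R, 0 < eps -> eps <= 2^-1 ->
  exists2 r : R, phi_norm2 B eps va vb = r%:E & `|r - M / eps ^+ 2| <= K / eps.
Proof.
have [K K0 hK] := abelO_nneg (abel_sphere_sum BN S_irr Bh_twin S_neq Q_def va vb).
(* With x = 1 / (1 - z) and y = 1 / eps, y <= x <= y + 1 and y >= 2 give K x <= 2 K y and x^2 - y^2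
   <= 3 y. *)
exists (2 * K + 3 * `|M|) => [|eps e0 e2]; first by rewrite addr_ge0 ?mulr_ge0.
have [z2 z1 lo hi] := exp_pole e0 e2; set z := expR (- eps) in z2 z1 lo hi *.
have d0 : 0 < 1 - z by lra.
have z0 := ge_half_gt0 z2.
have : ((M / (1 - z) ^+ 2 - K / (1 - z))%:E <= phi_norm2 B eps va vb
        <= (M / (1 - z) ^+ 2 + K / (1 - z))%:E)%E.
  rewrite phi_norm2_series//; apply: nneseries_bounds => [n|].
    by rewrite mulr_ge0 ?exprn_ge0 ?expR_ge0 ?sphere_sum_ge0.
  apply: filterS (hK z z2 z1) => N; rewrite expr1 ler_norml /abel -/z.
  by move=> /andP[h1 h2]; lra.
case: (phi_norm2 _ _ _ _) => [r| |] /andP[]; rewrite ?leNye_eq ?leye_eq//.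
rewrite !lee_fin => h1 h2; exists r => //.
set x := (1 - z)^-1 in lo hi h1 h2; set y := eps^-1 in lo hi *.
have y2 : 2 <= y by rewrite /y -[2]invrK lef_pV2 ?posrE//; lra.
have e : `|M * (x ^+ 2 - y ^+ 2)| <= `|M| * (3 * y).
  rewrite normrM ler_wpM2l// ger0_norm; nra.
rewrite -exprVn -/y; rewrite -exprVn -/x in h1 h2.
have -> : r - M * y ^+ 2 = (r - M * x ^+ 2) + M * (x ^+ 2 - y ^+ 2) by ring.
apply: le_trans (ler_normD _ _) _; rewrite mulrDl; apply: lerD.
  apply: le_trans (_ : K * x <= _); first by rewrite ler_norml; lra.
  by rewrite [2 * K]mulrC -mulrA ler_wpM2l//; lra.
by apply: le_trans e _; lra.
Qed.

Lemma phi_norm2_lower : va != 0 -> vb != 0 ->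
  exists2 c : R, 0 < c &
    \forall eps \near (0 : R)^'+, ((c / eps)%:E <= phi_norm2 B eps va vb)%E.
Proof.
move=> va0 vb0.
have [c [f [c0 fle] /abelO_nneg[K K0 hK]]] :=
  sphere_sum_lower BN S_irr Bh_twin Q va0 vb0.
(* One factor 1/2 is the lower bound on z; the other absorbs [K], which is at most (c / 2) / eps for
   small eps. *)
exists (c / 4); first by rewrite divr_gt0.
near=> eps.
have e0 : 0 < eps by near: eps; exact: nbhs_right_gt.
have e2 : eps <= 2^-1 by near: eps; apply: nbhs_right_le.
have eK : eps <= c / (2 * K + 1).
  by near: eps; apply: nbhs_right_le; rewrite divr_gt0//; lra.
have [z2 z1 lo hi] := exp_pole e0 e2; set z := expR (- eps) in z2 z1 lo hi *.
have d0 : 0 < 1 - z by lra.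
have z0 := ge_half_gt0 z2.
rewrite phi_norm2_series//.
have term_ge0 n : 0 <= z ^+ n * sphere_sum B va vb n.
  by rewrite mulr_ge0 ?exprn_ge0 ?(ltW z0)// sphere_sum_ge0.
suff : \forall N \near \oo,
    c / 4 / eps <= \sum_(0 <= n < N) z ^+ n * sphere_sum B va vb n.
  move=> [N _ hN].
  apply: lime_ge; first by apply: is_cvg_nneseries => n _ _; rewrite lee_fin.
  by exists N => // n /hN h; rewrite sumEFin lee_fin.
have [N _ hN] := hK z z2 z1; exists N.+1 => // -[//|n] /= Nn.
have {hN} := hN n Nn; rewrite expr0 divr1 ler_norml => /andP[hA _].
rewrite big_nat_recl//.
have : z * abel z n f <= \sum_(0 <= i < n) z ^+ i.+1 * sphere_sum B va vb i.+1.
  rewrite /abel mulr_sumr; apply: ler_sum => i _; rewrite exprS -mulrA.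
  by rewrite !ler_wpM2l ?exprn_ge0// ltW.
have := term_ge0 0%N.
have K_le : K <= c / 2 / eps.
  rewrite ler_pdivlMr// mulrC.
  move: eK; rewrite ler_pdivlMr; last by lra.
  by nra.
have cx : c / eps <= c / (1 - z) by rewrite ler_wpM2l// ltW.
have zA : 2^-1 * abel z n f <= z * abel z n f.
  rewrite ler_wpM2r//.
  have : 0 <= c / eps by rewrite divr_ge0// ltW.
  by rewrite [c / 2 / eps]mulrAC in K_le; lra.
have e4 : c / 4 / eps = c / eps / 4 by rewrite mulrAC.
have e22 : c / 2 / eps = c / eps / 2 by rewrite mulrAC.
rewrite e4; rewrite e22 in K_le.
lra.
Unshelve. all: end_near. Qed.

Lemma main_coefE : ((M%:C)%C : C) =
  E0 B Bh Q / k0 B Bh ^+ 2 * sesq (B a) va va * sesq (B b) vb vb.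
Proof.
have [P hP] := exists_frame_of Bh_twin.
have k0p := k0_gt0 BN S_irr hP; have E00 := E0_ge0 B Bh_twin hP Q.
rewrite /main_coef !rmorphM /= !real_nneg ?divr_ge0 ?(ltW k0p)//;
  try exact/posdef_ge0/BN.1.
by field; rewrite gt_eqF.
Qed.

Lemma main_coef_ge0 : 0 <= M.
Proof.
have [P hP] := exists_frame_of Bh_twin.
have k0p := k0_gt0 BN S_irr hP; have E00 := E0_ge0 B Bh_twin hP Q.
rewrite -ler0c main_coefE !mulr_ge0 ?invr_ge0 ?exprn_ge0 ?(ltW k0p)//.
  exact/posdef_ge0/BN.1.
exact/posdef_ge0/BN.1.
Qed.

Lemma main_coef_eq0 : va != 0 -> vb != 0 -> M = 0 -> E0 B Bh Q = 0.
Proof.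
move=> va0 vb0 M0; have [P hP] := exists_frame_of Bh_twin.
have := main_coefE; rewrite M0 => /esym/eqP.
rewrite !mulf_eq0 invr_eq0 expf_eq0 /= (gt_eqF (k0_gt0 BN S_irr hP)).
by rewrite (gt_eqF (BN.1 a va va0)) (gt_eqF (BN.1 b vb vb0)) !orbF => /eqP.
Qed.

Lemma phi_norm2_simple_pole : simeq_inv (fun eps => phi_norm2 B eps va vb) -> M = 0.
Proof.
have [K K0 hK] := phi_norm2_asymp; move=> [c1 [c2 [c10 c20 h]]].
apply/eqP; rewrite eq_le main_coef_ge0 andbT leNgt; apply/negP => Mp.
have : \forall eps \near (0 : R)^'+, False; last by move=> /filter_ex[].
near=> eps.
have e0 : 0 < eps by near: eps; exact: nbhs_right_gt.
have e2 : eps <= 2^-1 by near: eps; apply: nbhs_right_le.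
have eM : eps < M / (c2 + K).
  by near: eps; apply: nbhs_right_lt; rewrite divr_gt0//; lra.
have [r rE rK] := hK eps e0 e2.
have /andP[_] : ((c1 / eps)%:E <= phi_norm2 B eps va vb <= (c2 / eps)%:E)%E.
  by near: eps.
rewrite rE lee_fin => rc; move: rK; rewrite ler_norml => /andP[rK _].
have : M / eps ^+ 2 <= (c2 + K) / eps by rewrite mulrDl; lra.
rewrite ler_pdivrMr ?exprn_gt0// expr2 mulrA divfK ?gt_eqF//.
move: eM; rewrite ltr_pdivlMr; last by lra.
by lra.
Unshelve. all: end_near. Qed.

End PhiAsymptotics.

Unset Implicit Arguments.

Local Open Scope complex_scope.

Theorem lemma5p17 (R : realType) (k : nat) (k_gt1 : (1 < k)%N)
    (S : matrix_system k R[i]) (B : form_tuple S)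
    (S_norm : normalized B) (S_irr : irreducible_system S)
    (Bh : form_tuple (twin S)) (Bh_twin : twin_forms Bh)
    (S_neq : ~ equivalent_systems S (twin S))
    (Q : forall b : letter k, 'Hom(msV S b, msV (twin S) b))
    (Q_def : is_Q B Bh Q) :
  (forall (a b : letter k) (va : msV S a) (vb : msV S b),
     va != 0 -> vb != 0 ->
     (simeq_inv (fun eps : R => phi_norm2 B eps va vb) <-> E0 B Bh Q = 0)) /\
  (E0 B Bh Q != 0 ->
   forall (a b : letter k) (va : msV S a) (vb : msV S b),
     forall eps : R,
       ((fine (phi_norm2 B eps va vb))%:C : R[i]^o) =
         (E0 B Bh Q / k0 B Bh ^+ 2 * (eps ^- 2)%:C
           * sesq (B a) va va * sesq (B b) vb vb : R[i]^o)
         +o_(eps \near 0^'+) ((eps ^- 2)%:C : R[i]^o)).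
Proof.
split=> [a b va vb va0 vb0|_ a b va vb].
  have [K K0 hK] := phi_norm2_asymp S_norm S_irr Bh_twin S_neq Q_def va vb.
  have mE := main_coefE S_norm S_irr Bh_twin Q va vb.
  split=> [h|E00].
    apply: (main_coef_eq0 S_norm S_irr Bh_twin va0 vb0).
    exact: (phi_norm2_simple_pole S_norm S_irr Bh_twin S_neq Q_def h).
  have [c c0 hc] := phi_norm2_lower S_norm S_irr Bh_twin Q va0 vb0.
  have M00 : main_coef B Bh Q va vb = 0.
    by apply: complexI; rewrite mE E00 !mul0r.
  (* The upper constant must be positive while [K] may be 0, hence [K + 1]. *)
  exists c, (K + 1); split=> //; first by lra.
  near=> eps; apply/andP; split; first by near: eps.
  have e0 : 0 < eps by near: eps; exact: nbhs_right_gt.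
  have e2 : eps <= 2^-1 by near: eps; apply: nbhs_right_le.
  have [r -> rK] := hK eps e0 e2; rewrite lee_fin.
  move: rK; rewrite M00 mul0r subr0 => /(le_trans (ler_norm _)) /le_trans; apply.
  by rewrite ler_pM2r ?invr_gt0//; lra.
have [K K0 hK] := phi_norm2_asymp S_norm S_irr Bh_twin S_neq Q_def va vb.
have mE := main_coefE S_norm S_irr Bh_twin Q va vb.
apply/funeqP/eqaddoP => e e0.
have er : e = (complex.Re e)%:C by rewrite RRe_real// ger0_real// ltW.
have re0 : 0 < complex.Re e by rewrite -ltcR -er.
near=> eps.
have eps0 : 0 < eps by near: eps; exact: nbhs_right_gt.
have eps2 : eps <= 2^-1 by near: eps; apply: nbhs_right_le.
(* This makes the error K / eps at most Re e / eps^2. *)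
have epsK : eps <= complex.Re e / (K + 1).
  by near: eps; apply: nbhs_right_le; rewrite divr_gt0//; lra.
have [r rE rK] := hK eps eps0 eps2.
have normR (y : R) : `|(y%:C : R[i])| = (`|y|)%:C.
  by rewrite normc_def /= expr0n addr0 sqrtr_sqr.
have -> : ((fun x : R => (fine (phi_norm2 B x va vb))%:C : R[i]^o)
    - (fun x : R => E0 B Bh Q / k0 B Bh ^+ 2 * (x ^- 2)%:C * sesq (B a) va va
         * sesq (B b) vb vb : R[i]^o)) eps
  = ((r - main_coef B Bh Q va vb / eps ^+ 2)%:C : R[i]^o).
  rewrite fctE /= rE /= rmorphB rmorphM /= mE; congr (_ - _).
  by rewrite -!mulrA; congr (_ * (_ * _)); rewrite mulrC mulrA.
rewrite [leLHS]normR [X in _ <= _ * X]normR er -rmorphM lecR /=.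
apply: le_trans rK _; rewrite ger0_norm ?invr_ge0 ?exprn_ge0 ?(ltW eps0)//.
rewrite ler_pdivrMr//.
have -> : complex.Re e * eps ^- 2 * eps = complex.Re e / eps by field; lra.
rewrite ler_pdivlMr//; move: epsK; rewrite ler_pdivlMr; last by lra.
by nra.
Unshelve. all: end_near. Qed.
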